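(* Consider the generalized plant $\dot x=Ax+b_1w+b_2u$, $z=c_1^Tx+d_{11}w+d_{12}u$, $y=c_2^Tx+d_{21}w$ with $A\in\mathbb{R}^{n\times n}$, $b_1,b_2,c_1,c_2\in\mathbb{R}^n$, $d_{11},d_{12},d_{21}\in\mathbb{R}$, satisfying the standing assumptions (i)–(iv) listed in the context. Let $\gamma^*$ be the optimal value of the LMI problem (LMI) of $H_\infty$ output feedback control given in the context. Let $\lambda_1,\dots,\lambda_{m_1}$ and their complex conjugates (resp. $\omega_1,\dots,\omega_{m_2}$ and their complex conjugates) be the invariant zeros of $G_{zu}$ (resp. $G_{yw}$) on the imaginary axis, and assume that all of $\lambda_1,\dots,\lambda_{m_1},\omega_1,\dots,\omega_{m_2}$ and their complex conjugates are not eigenvalues of $A$. Let $\hat\gamma=\lambda_{\max}(E)$, where $E$ is the symmetric matrix defined in the context from the invariant zeros of $G_{zu}$ and $G_{yw}$ in the open right half plane and the associated null vectors. 1. If $d_{12}\neq0$ and $d_{21}\neq 0$, then $$\gamma^*=\max\{\hat\gamma,\ |G_{zw}(\lambda_j)|\ (j=1,\dots,m_1),\ |G_{zw}(\omega_j)|\ (j=1,\dots,m_2)\}.$$ 2. If $d_{12}=0$ or $d_{21}=0$, then $$\gamma^*=\max\{\hat\gamma,\ |G_{zw}(\lambda_j)|\ (j=1,\dots,m_1),\ |G_{zw}(\omega_j)|\ (j=1,\dots,m_2),\ |G_{zw}(\infty)|\},$$ where $G_{zw}(\infty)$ is the value of $G_{zw}$ at infinity. Here the terms $|G_{zw}(\lambda_j)|$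 (resp. $|G_{zw}(\omega_j)|$) are omitted if $G_{zu}$ (resp. $G_{yw}$) has no invariant zeros on the imaginary axis.
   Context: Notation: $\mathbb{S}^k,\mathbb{S}^k_+,\mathbb{S}^k_{++}$ are the real symmetric, positive semidefinite, positive definite $k\times k$ matrices; $\mathrm{He}(M)=M+M^T$; $\lambda_{\max}$ is the maximum eigenvalue (with $\lambda_{\max}$ of an empty matrix equal to $0$). For a real $p\times q$ matrix $M$ of rank $\rho$, $M^\perp$ is any $p\times(p-\rho)$ matrix with $M^TM^\perp=0$ and $(M^\perp)^TM^\perp$ positive definite, and $M^{\perp T}$ is its transpose. Transfer functions: $G_{zw}(s)=c_1^T(sI-A)^{-1}b_1+d_{11}$, $G_{zu}(s)=c_1^T(sI-A)^{-1}b_2+d_{12}$, $G_{yw}(s)=c_2^T(sI-A)^{-1}b_1+d_{21}$. (LMI): minimize (infimum) $\gamma$ over $\gamma\in\mathbb{R}$, $X,Y\in\mathbb{S}^n$ subject to $$-\begin{pmatrix}b_2\\ d_{12}\\ 0\end{pmatrix}^{\perp T}\begin{pmatrix}\mathrm{He}(AX)&Xc_1&b_1\\ c_1^TX&-\gamma&d_{11}\\ b_1^T&d_{11}&-\gamma\end{pmatrix}\begin{pmatrix}b_2\\ d_{12}\\ 0\end{pmatrix}^{\perp}\in\mathbb{S}^{n+1}_+,$$ $$-\begin{pmatrix}c_2\\ d_{21}\\ 0\end{pmatrix}^{\perp T}\begin{pmatrix}\mathrm{He}(YA)&Yb_1&c_1\\ b_1^TY&-\gamma&d_{11}\\ c_1^T&d_{11}&-\gamma\end{pmatrix}\begin{pmatrix}c_2\\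 d_{21}\\ 0\end{pmatrix}^{\perp}\in\mathbb{S}^{n+1}_+,\qquad \begin{pmatrix}X&-I_n\\ -I_n&Y\end{pmatrix}\in\mathbb{S}^{2n}_+.$$ Invariant zeros: $\lambda\in\mathbb{C}$ is an invariant zero of $G_{zu}$ (more precisely of the realization $(A,b_2,c_1^T,d_{12})$) if $\mathrm{rank}\begin{pmatrix}A-\lambda I_n&b_2\\ c_1^T&d_{12}\end{pmatrix}<n+1$, and of $G_{yw}$ (realization $(A^T,c_2,b_1^T,d_{21})$) if $\mathrm{rank}\begin{pmatrix}A^T-\lambda I_n&c_2\\ b_1^T&d_{21}\end{pmatrix}<n+1$. Multiplicities are those of the roots of the determinants of these matrices as polynomials in $\lambda$. Standing assumptions: (i) $(A,b_2)$ is stabilizable and $(A,c_2^T)$ is detectable; (ii) all invariant zeros of $G_{zu}$ and of $G_{yw}$ that are not on the imaginary axis are real; (iii) the invariant zeros of $G_{zu}$ on the imaginary axis are nonzero and simple, so they are $2m_1$ distinct numbers $\lambda_j,\bar\lambda_j$; likewise those of $G_{yw}$ are $2m_2$ distinct nonzero simple $\omega_j,\bar\omega_j$; (iv) $G_{zu}$ and $G_{yw}$ are not identically zero. Definition of $E$: let $k_1$ (resp. $k_2$) be the number, with multiplicity, of invariant zeros of $G_{zu}$ (resp. $G_{yw}$) in the open right half plane. Let $\Lambda_+\in\mathbb{R}^{k_1\times k_1}$ (resp. $\Omega_+\in\mathbb{R}^{k_2\times k_2}$) be a Jordan matrix whose eigenvalues with multiplicity are these zeros, and $S_+\in\mathbb{R}^{n\times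 k_1}$, $f_+\in\mathbb{R}^{k_1}$, $T_+\in\mathbb{R}^{n\times k_2}$, $g_+\in\mathbb{R}^{k_2}$ be such that $\begin{pmatrix}S_+\\ f_+^T\end{pmatrix}$, $\begin{pmatrix}T_+\\ g_+^T\end{pmatrix}$ have full column rank and $$\begin{pmatrix}S_+^T&f_+\end{pmatrix}\begin{pmatrix}A&b_2\\ c_1^T&d_{12}\end{pmatrix}=\Lambda_+^T\begin{pmatrix}S_+^T&0\end{pmatrix},\qquad \begin{pmatrix}T_+^T&g_+\end{pmatrix}\begin{pmatrix}A^T&c_2\\ b_1^T&d_{21}\end{pmatrix}=\Omega_+^T\begin{pmatrix}T_+^T&0\end{pmatrix}.$$ Put $J_+=T_+^TS_+$, $h_{1+}=S_+^Tb_1+d_{11}f_+$, $h_{2+}=T_+^Tc_1+d_{11}g_+$, $F_+=\int_0^\infty e^{-\Lambda_+^Tt}f_+f_+^Te^{-\Lambda_+t}dt$, $G_+=\int_0^\infty e^{-\Omega_+^Tt}g_+g_+^Te^{-\Omega_+t}dt$, $H_{1+}=\int_0^\infty e^{-\Lambda_+^Tt}h_{1+}h_{1+}^Te^{-\Lambda_+t}dt$, $H_{2+}=\int_0^\infty e^{-\Omega_+^Tt}h_{2+}h_{2+}^Te^{-\Omega_+t}dt$ ($F_+,G_+$ are positive definite under (i)). Then $$E=\begin{pmatrix}O&F_+^{-1/2}J_+^TG_+^{-1/2}&F_+^{-1/2}H_{1+}^{1/2}&O\\ G_+^{-1/2}J_+F_+^{-1/2}&O&O&G_+^{-1/2}H_{2+}^{1/2}\\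 H_{1+}^{1/2}F_+^{-1/2}&O&O&O\\ O&H_{2+}^{1/2}G_+^{-1/2}&O&O\end{pmatrix},$$ where blocks of size zero are deleted if $k_1=0$ or $k_2=0$. *)

(* Defs.v *)
From HB Require Import structures.
From mathcomp Require Import all_boot all_order all_algebra.
From mathcomp Require Import all_classical all_reals all_analysis.
From mathcomp Require Import complex.

Set Implicit Arguments.
Unset Strict Implicit.
Unset Printing Implicit Defensive.

Import Order.TTheory GRing.Theory Num.Theory.
Import numFieldNormedType.Exports.

Local Open Scope classical_set_scope.
Local Open Scope ring_scope.

Section RealMatrices.
Variable R : realType.

Definition psdmx k (M : 'M[R]_k) : Prop :=
  M^T = M /\ forall x : 'cV[R]_k, 0 <= (x^T *m M *m x) 0 0.

Definition pdmx k (M : 'M[R]_k) : Prop :=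
  M^T = M /\ forall x : 'cV[R]_k, x != 0 -> 0 < (x^T *m M *m x) 0 0.

(* The unique positive semidefinite square root (0 if M is not psd). *)
Definition sqrtmx k (M : 'M[R]_k) : 'M[R]_k :=
  xget 0 [set B : 'M[R]_k | psdmx B /\ B *m B = M].

Definition isqrtmx k (M : 'M[R]_k) : 'M[R]_k := invmx (sqrtmx M).

(* Used on symmetric matrices only.  The set is empty when k = 0, and the
   supremum of the empty set is 0, which is the convention wanted there. *)
Definition lambda_max k (M : 'M[R]_k) : R := sup [set a : R | eigenvalue M a].

Definition He k (M : 'M[R]_k) : 'M[R]_k := M + M^T.

Definition is_perp p q (M : 'M[R]_(p, q)) (N : 'M[R]_(p, p - \rank M)) : Prop :=
  M^T *m N = 0 /\ pdmx (N^T *m N).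

Definition expmx k (M : 'M[R]_k) : 'M[R]_k :=
  \matrix_(i, j) limn (series (fun m : nat => (M ^+ m) i j / m`!%:R)).

(* int_0^oo e^{-L^T t} v v^T e^{-L t} dt, entrywise.  In its intended use, the
   eigenvalues of L are in the open right half plane, so that the integrand is
   absolutely integrable and the Lebesgue and improper Riemann integrals agree. *)
Definition gramian k (L : 'M[R]_k) (v : 'cV[R]_k) : 'M[R]_k :=
  \matrix_(i, j) \int[lebesgue_measure]_(t in `[0, +oo[)
    ((expmx ((- t) *: L^T) *m v *m v^T *m expmx ((- t) *: L)) i j).

(* Direct sum of upper Jordan blocks: constant diagonal along each maximal run of
   ones on the superdiagonal, a zero on the superdiagonal separating two blocks. *)
Definition jordan_mx k (L : 'M[R]_k) : Prop :=
  forall i j : 'I_k, i != j ->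
    if j == i.+1 :> nat then L i j = 0 \/ (L i j = 1 /\ L i i = L j j)
    else L i j = 0.

End RealMatrices.

Section Plant.
Variables (R : realType) (n : nat).
Local Notation C := R[i].
Local Notation toC := (real_complex R).
Local Notation toCmx := (map_mx toC).

Implicit Types (A : 'M[R]_n) (b c : 'cV[R]_n) (d : R).

Definition hurwitz A : Prop :=
  forall z : C, eigenvalue (toCmx A) z -> complex.Re z < 0.

Definition stabilizable p A (B : 'M[R]_(n, p)) : Prop :=
  exists K : 'M[R]_(p, n), hurwitz (A + B *m K).

Definition detectable p A (H : 'M[R]_(p, n)) : Prop :=
  exists L : 'M[R]_(n, p), hurwitz (A + L *m H).

(* c^T (s I - A)^{-1} b + d; meaningful when s is not an eigenvalue of A. *)
Definition tf A b c d (s : C) : C :=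
  ((toCmx c)^T *m invmx (s%:M - toCmx A) *m toCmx b) 0 0 + toC d.

Definition tf_not_identically_zero A b c d : Prop :=
  exists s : C, ~~ eigenvalue (toCmx A) s /\ tf A b c d s != 0.

(* The limit of the transfer function as |s| tends to infinity in C. *)
Definition tf_infty A b c d : C :=
  xget 0 [set v : C | forall e : R, 0 < e -> exists M : R,
    forall s : C, M < Normc.normc s -> Normc.normc (tf A b c d s - v) < e].

Definition invariant_zero A b c d (z : C) : Prop :=
  (\rank (block_mx (toCmx A - z%:M) (toCmx b)
                   (toCmx c)^T (toC d)%:M) < n + 1)%N.

Definition zero_poly A b c d : {poly R} :=
  \det (block_mx (map_mx polyC A - 'X%:M) (map_mx polyC b)
                 (map_mx polyC c)^T (d%:P)%:M).

Definition zero_mult A b c d (z : C) : nat :=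
  mup z (map_poly toC (zero_poly A b c d)).

Definition off_axis_zeros_real A b c d : Prop :=
  forall z : C, invariant_zero A b c d z -> complex.Re z != 0 ->
    complex.Im z = 0.

(* lam lists one representative of each conjugate pair of invariant zeros on
   the imaginary axis; these zeros are nonzero and simple. *)
Definition imaginary_zeros A b c d (lam : seq C) : Prop :=
  let zs := lam ++ map conjc lam in
  [/\ uniq zs,
      forall z : C, z \in zs <-> invariant_zero A b c d z /\ complex.Re z = 0
    & forall z : C, z \in zs -> z != 0 /\ zero_mult A b c d z = 1%N].

(* zs lists, with multiplicity, the invariant zeros in the open right half
   plane, so that k is their number. *)
Definition rhp_zeros A b c d k (zs : k.-tuple C) : Prop :=
  forall z : C, count_mem z zs =
    if 0 < complex.Re z then zero_mult A b c d z else 0%N.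

Definition rhp_null_data A b c d k (zs : k.-tuple C)
    (L : 'M[R]_k) (S : 'M[R]_(n, k)) (f : 'cV[R]_k) : Prop :=
  [/\ jordan_mx L,
      map_poly toC (char_poly L) = \prod_(z <- zs) ('X - z%:P),
      \rank (col_mx S f^T) = k
    & row_mx S^T f *m block_mx A b c^T d%:M
        = L^T *m row_mx S^T (0 : 'cV[R]_k)].

Definition lmi_perp_mx b d : 'cV[R]_(n + 1 + 1) :=
  col_mx (col_mx b d%:M) 0.

Definition lmi_control_mx A b1 c1 d11 (gamma : R) (X : 'M[R]_n)
    : 'M[R]_(n + 1 + 1) :=
  block_mx (block_mx (He (A *m X)) (X *m c1) (c1^T *m X) (- gamma)%:M)
           (col_mx b1 d11%:M)
           (row_mx b1^T d11%:M)
           (- gamma)%:M.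

Definition lmi_filter_mx A b1 c1 d11 (gamma : R) (Y : 'M[R]_n)
    : 'M[R]_(n + 1 + 1) :=
  block_mx (block_mx (He (Y *m A)) (Y *m b1) (b1^T *m Y) (- gamma)%:M)
           (col_mx c1 d11%:M)
           (row_mx c1^T d11%:M)
           (- gamma)%:M.

Definition lmi_feasible A b1 b2 c1 c2 d11 d12 d21
    (N1 : 'M[R]_(n + 1 + 1, n + 1 + 1 - \rank (lmi_perp_mx b2 d12)))
    (N2 : 'M[R]_(n + 1 + 1, n + 1 + 1 - \rank (lmi_perp_mx c2 d21)))
    (gamma : R) (X Y : 'M[R]_n) : Prop :=
  [/\ X^T = X /\ Y^T = Y,
      psdmx (- (N1^T *m lmi_control_mx A b1 c1 d11 gamma X *m N1)),
      psdmx (- (N2^T *m lmi_filter_mx A b1 c1 d11 gamma Y *m N2))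
    & psdmx (block_mx X (- 1%:M) (- 1%:M) Y)].

Definition lmi_value A b1 b2 c1 c2 d11 d12 d21
    (N1 : 'M[R]_(n + 1 + 1, n + 1 + 1 - \rank (lmi_perp_mx b2 d12)))
    (N2 : 'M[R]_(n + 1 + 1, n + 1 + 1 - \rank (lmi_perp_mx c2 d21))) : \bar R :=
  ereal_inf [set gamma%:E | gamma in [set gamma : R |
    exists X Y : 'M[R]_n, lmi_feasible A b1 c1 d11 N1 N2 gamma X Y]].

Definition Emx b1 c1 d11 k1 k2
    (L : 'M[R]_k1) (S : 'M[R]_(n, k1)) (f : 'cV[R]_k1)
    (W : 'M[R]_k2) (T : 'M[R]_(n, k2)) (g : 'cV[R]_k2)
    : 'M[R]_((k1 + k2) + (k1 + k2)) :=
  let J := T^T *m S in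
  let h1 := S^T *m b1 + d11 *: f in
  let h2 := T^T *m c1 + d11 *: g in
  let Fi := isqrtmx (gramian L f) in
  let Gi := isqrtmx (gramian W g) in
  let H1r := sqrtmx (gramian L h1) in
  let H2r := sqrtmx (gramian W h2) in
  block_mx
    (block_mx 0 (Fi *m J^T *m Gi) (Gi *m J *m Fi) 0)
    (block_mx (Fi *m H1r) 0 0 (Gi *m H2r))
    (block_mx (H1r *m Fi) 0 0 (H2r *m Gi))
    0.

End Plant.

(* Main.v *)
Require Import Defs.
From HB Require Import structures.
From mathcomp Require Import all_boot all_order all_algebra.
From mathcomp Require Import all_classical all_reals all_analysis.
From mathcomp Require Import complex measurable_realfun spectral sesquilinear.
From mathcomp Require Import ring lra.

(** Since [0] is not an invariant zero, the system matrix is invertible and the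
    equations [A^T p + c1 q = xi], [b2^T p + d12 q = 0] have a unique solution
    [p = B xi], [q = beta^T xi] for every [xi]. These pairs [(p, q)] fill the orthogonal
    complement of [(b2, d12)], and for [gamma > 0] a Schur complement turns the first
    inequality of the problem into the Lyapunov inequality
    [B^T X + X B <= Q] with [Q = gamma beta beta^T - e e^T / gamma], where
    [e^T xi = b1^T p + d11 q] ([lmi_control_lyapunov]). The eigenvalues of [B] are the
    inverses of the invariant zeros; if [d12 = 0], the zeros at infinity appear as one
    Jordan chain of [B] for the eigenvalue [0], so that both cases of the theorem become
    one. The second inequality is the first one for the transposed plant.

    Lower bound ([channel_lower], [feasible_bound]). On an eigenvector [w] of [B] with
    an imaginary eigenvalue [1 / z] the terms in [X] cancel, and [w^* Q w >= 0] says
    [|G_zw z| <= gamma]; for the eigenvalue [0] it says [|d11| <= gamma]. The antistable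
    null vectors [S] give a Lyapunov inequality for [S^T X S], whose solutions are at
    most [gamma F - H1 / gamma] because the gramians solve the corresponding equations
    ([gramian_lyapunov], [lyapunov_psd]). With the same bound for [T^T Y T], the
    coupling constraint compressed by [S] and [T] says that [gamma] is at least the
    largest eigenvalue of [E] ([gamma_hat_le]).

    Upper bound ([channel_upper], [bound_feasible]). For [gamma] above the bound, fix
    [S^T X S = Z] slightly below [gamma F - H1 / gamma]. The strict Lyapunov inequality
    then has solutions [X] that extend [Z] and are otherwise as large as desired
    ([lyapunov_inequality]). The solution is built over the complex numbers by enlarging
    an invariant subspace one vector at a time. A stable eigenvalue is handled by a large
    diagonal entry; an imaginary one by [w^* Q w > 0], as the new diagonal entry does not
    enter the inequality there; a repeated eigenvalue [0] by a left null vector which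
    pairs nontrivially with the chain. In each case the new diagonal entry of [X] is
    free to be large. What remains is the coupling constraint: [X >= W^-1] and [Y >= W]
    suffice, and [W = S Z^-1 S^T + delta] with a small [delta > 0] is compatible with both
    prescriptions because the block matrix behind [E] is positive definite ([coupling],
    [gamma_hat_lt]). *)

Set Implicit Arguments.
Unset Strict Implicit.
Unset Printing Implicit Defensive.

Import Order.TTheory GRing.Theory Num.Theory.
Import numFieldNormedType.Exports.

Local Open Scope ring_scope.

Local Open Scope sesquilinear_scope.
Local Notation "A ^H" := (A ^t*) (at level 8, format "A ^H").
Local Close Scope sesquilinear_scope.

(** * Sesquilinear forms and positive definiteness over a closed field *)

Section Adjoint.
Variable C : numClosedFieldType.

Lemma adjM m n p (A : 'M[C]_(m, n)) (B : 'M[_]_(n, p)) :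
  (A *m B)^H = B^H *m A^H.
Proof. by rewrite trmx_mul map_mxM. Qed.

Lemma adjD m n (A B : 'M[C]_(m, n)) : (A + B)^H = A^H + B^H.
Proof. by rewrite linearD /= map_mxD. Qed.

Lemma adjN m n (A : 'M[C]_(m, n)) : (- A)^H = - A^H.
Proof. by rewrite linearN /= map_mxN. Qed.

Lemma adjZ m n a (A : 'M[C]_(m, n)) : (a *: A)^H = a^* *: A^H.
Proof. by rewrite linearZ /= map_mxZ. Qed.

Lemma adj_scalar n a : (a%:M : 'M[C]_n)^H = (a^*)%:M.
Proof. by rewrite tr_scalar_mx map_scalar_mx. Qed.

Lemma adj_inv n (A : 'M[C]_n) : (invmx A)^H = invmx (A^H).
Proof. by rewrite trmx_inv map_invmx. Qed.

Lemma adj_row_mx m n1 n2 (A : 'M[C]_(m, n1)) (B : 'M[C]_(m, n2)) :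
  (row_mx A B)^H = col_mx A^H B^H.
Proof. by rewrite tr_row_mx map_col_mx. Qed.

Lemma adj_col_mx m1 m2 n (A : 'M[C]_(m1, n)) (B : 'M[C]_(m2, n)) :
  (col_mx A B)^H = row_mx A^H B^H.
Proof. by rewrite tr_col_mx map_row_mx. Qed.

Lemma adj_block_mx m1 m2 n1 n2 (A : 'M[C]_(m1, n1)) (B : 'M[_]_(m1, n2))
    (D : 'M[_]_(m2, n1)) (E : 'M[_]_(m2, n2)) :
  (block_mx A B D E)^H = block_mx A^H D^H B^H E^H.
Proof. by rewrite tr_block_mx map_block_mx. Qed.

Definition hform m n (M : 'M[C]_(m, n)) (x : 'cV_m) (y : 'cV_n) : C := (x^H *m M *m y) 0 0.

Lemma hformDl m n (M : 'M[C]_(m, n)) x x' y :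
  hform M (x + x') y = hform M x y + hform M x' y.
Proof. by rewrite /hform adjD !mulmxDl mxE. Qed.

Lemma hformDr m n (M : 'M[C]_(m, n)) x y y' :
  hform M x (y + y') = hform M x y + hform M x y'.
Proof. by rewrite /hform !mulmxDr mxE. Qed.

Lemma hformZl m n (M : 'M[C]_(m, n)) a x y : hform M (a *: x) y = a^* * hform M x y.
Proof. by rewrite /hform adjZ -!scalemxAl mxE. Qed.

Lemma hformZr m n (M : 'M[C]_(m, n)) a x y : hform M x (a *: y) = a * hform M x y.
Proof. by rewrite /hform -!scalemxAr mxE. Qed.

Lemma hformD m n (M N : 'M[C]_(m, n)) x y : hform (M + N) x y = hform M x y + hform N x y.
Proof. by rewrite /hform mulmxDr mulmxDl mxE. Qed.

Lemma hformN m n (M : 'M[C]_(m, n)) x y : hform (- M) x y = - hform M x y.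
Proof. by rewrite /hform mulmxN mulNmx mxE. Qed.

Lemma hform_adj m n (M : 'M[C]_(m, n)) x y : (hform M x y)^* = hform M^H y x.
Proof.
rewrite /hform; set u := _ *m y; transitivity ((u^H) 0 0); first by rewrite !mxE.
by rewrite /u !adjM trmxCK mulmxA.
Qed.

Lemma hform_mull m n p (N : 'M[C]_(m, p)) (M : 'M[C]_(m, n)) x y :
  hform (N^H *m M) x y = hform M (N *m x) y.
Proof. by rewrite /hform adjM !mulmxA. Qed.

Lemma hform_mulr m n p (N : 'M[C]_(n, p)) (M : 'M[C]_(m, n)) x y :
  hform (M *m N) x y = hform M x (N *m y).
Proof. by rewrite /hform !mulmxA. Qed.

Lemma hform0l m n (M : 'M[C]_(m, n)) y : hform M 0 y = 0.
Proof. by rewrite /hform trmx0 map_mx0 !mul0mx mxE. Qed.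

Lemma hform0r m n (M : 'M[C]_(m, n)) x : hform M x 0 = 0.
Proof. by rewrite /hform mulmx0 mxE. Qed.

Lemma hform_block m n (P : 'M[C]_m) (r : 'M[_]_(m, n)) s t x a :
  hform (block_mx P r s t) (col_mx x a) (col_mx x a)
    = hform P x x + hform r x a + hform s a x + hform t a a.
Proof.
rewrite /hform adj_col_mx mul_row_block mul_row_col !mulmxDl !mxE.
by rewrite [X in _ = X + _]addrAC !addrA.
Qed.

(** Positivity in the partial order of [C] entails that the values are real. *)
Definition hpd n (M : 'M[C]_n) :=
  M^H = M /\ forall x : 'cV_n, x != 0 -> 0 < hform M x x.

Lemma hpd_ge0 n (M : 'M[C]_n) x : hpd M -> 0 <= hform M x x.
Proof.
by case=> _ P; have [->|/P/ltW//] := eqVneq x 0; rewrite hform0l.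
Qed.

Lemma hpd_unit n (M : 'M[C]_n) : hpd M -> M \in unitmx.
Proof.
case=> Mh P; rewrite -row_free_unit -kermx_eq0; apply/rowV0P => v /sub_kermxP vM.
apply/eqP/negP => /negP v0.
have /P : v^H != 0.
  by apply: contra v0 => /eqP E; rewrite -[v]trmxCK E trmx0 map_mx0.
by rewrite /hform trmxCK vM mul0mx mxE ltxx.
Qed.

Lemma cV_split k (z : 'cV[C]_(k + 1)) : exists x a, z = col_mx x (a%:M).
Proof. by exists (usubmx z), (dsubmx z 0 0); rewrite -mx11_scalar vsubmxK. Qed.

(** Schur complement: completing the square leaves [t - r^* P^-1 r] on the last
    coordinate. *)
Lemma hpd_border k (P : 'M[C]_k) (r : 'cV_k) (t : C) :
  hpd P -> hform (invmx P) r r < t -> hpd (block_mx P r r^H t%:M).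
Proof.
move=> hP rt; have [Ph Pp] := hP; have Pu := hpd_unit hP.
have hr : hform (invmx P) r r \is Num.real.
  by apply/CrealP; rewrite hform_adj adj_inv Ph.
have tr : t \is Num.real by rewrite -(ler_real (ltW rt)).
split; first by rewrite adj_block_mx Ph trmxCK adj_scalar (CrealP tr).
move=> z; have [x [a ->]] := cV_split z => {z} xa0.
have -> : hform (block_mx P r r^H t%:M) (col_mx x a%:M) (col_mx x a%:M)
   = hform P (x + a *: (invmx P *m r)) (x + a *: (invmx P *m r))
     + `|a| ^+ 2 * (t - hform (invmx P) r r).
  rewrite hform_block hformDl !hformDr !hformZl !hformZr -![hform P _ (_ *m _)]hform_mulr.
  rewrite mulmxV //.
  rewrite -[hform P (invmx P *m _) _]hform_mull -[hform _ (invmx P *m _) _]hform_mull.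
  rewrite adj_inv Ph mulVmx // mulmx1 normCK.
  have E1 : hform r x a%:M = a * hform 1%:M x r.
    by rewrite /hform mul_mx_scalar mulmx1 mxE.
  have E2 : hform r^H a%:M x = a^* * hform 1%:M r x.
    by rewrite /hform adj_scalar mul_scalar_mx -scalemxAl mulmx1 mxE.
  have E3 : hform t%:M (a%:M : 'M[_]_1) a%:M = a * a^* * t.
    by rewrite /hform adj_scalar !mul_mx_scalar !mxE !eqxx !mulr1n; ring.
  rewrite E1 E2 E3; ring.
have h1 : 0 <= hform P (x + a *: (invmx P *m r)) (x + a *: (invmx P *m r)).
  exact: hpd_ge0.
have [a0|a0] := eqVneq a 0; last first.
  by rewrite ltr_wpDl // mulr_gt0 ?exprn_gt0 ?normr_gt0 // subr_gt0.
rewrite a0 normr0 expr0n mul0r addr0 scale0r addr0; apply: Pp.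
by apply: contra xa0 => /eqP ->; rewrite a0 raddf0 col_mx0.
Qed.
End Adjoint.

(** * Bordering a solution of a Lyapunov inequality *)

Section LyapunovGrowth.
Variables (C : numClosedFieldType) (n : nat) (B Q L : 'M[C]_n).
Hypotheses (Qh : Q^H = Q) (Lh : L^H = L).

(** For an invariant subspace [B S = S M] and [Z = S^* X S], these are the
    restrictions to the range of [S] of the two matrices [Q - B^* X - X B] and
    [X - L] that have to become positive. *)
Definition lyap_defect k (S : 'M[C]_(n, k)) (M Z : 'M[_]_k) : 'M[_]_k :=
  S^H *m Q *m S - (M^H *m Z + Z *m M).

Definition excess k (S : 'M[C]_(n, k)) (Z : 'M[_]_k) : 'M[_]_k := Z - S^H *m L *m S.

Lemma gram_row_mx k (N : 'M[C]_n) (S : 'M[_]_(n, k)) (v : 'cV_n) : N^H = N ->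
  (row_mx S v)^H *m N *m row_mx S v =
  block_mx (S^H *m N *m S) (S^H *m N *m v) (S^H *m N *m v)^H (hform N v v)%:M.
Proof.
move=> Nh; rewrite adj_row_mx mul_col_mx mul_col_row !adjM trmxCK Nh mulmxA.
by congr block_mx; rewrite [LHS]mx11_scalar.
Qed.

Lemma lyap_defect_border k (S : 'M[C]_(n, k)) (M Z : 'M[_]_k) v m (mu xi : C) x :
  Z^H = Z -> xi \is Num.real ->
  lyap_defect (row_mx S v) (block_mx M m 0 mu%:M) (block_mx Z x x^H xi%:M) =
  let r := S^H *m Q *m v - (Z *m m + mu *: x + M^H *m x) in
  block_mx (lyap_defect S M Z) r r^H
    (hform Q v v - (hform 1%:M x m + (hform 1%:M x m)^* + (mu + mu^*) * xi))%:M.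
Proof.
move=> Zh xir; rewrite /lyap_defect gram_row_mx // adj_block_mx.
rewrite !mulmx_block !add_block_mx opp_block_mx add_block_mx trmx0 map_mx0.
rewrite !mul0mx !mulmx0 !addr0 !adj_scalar !mul_mx_scalar !mul_scalar_mx.
congr block_mx.
- by rewrite [M^H *m x + _]addrC.
- by rewrite !(adjD, adjN, adjM, adjZ, trmxCK) Zh.
- rewrite [LHS]mx11_scalar; congr (_%:M).
  rewrite hform_adj adj_scalar (CrealP (_ : 1 \is Num.real)) ?rpred1 //.
  by rewrite /hform !mulmx1 !mxE !eqxx !mulr1n; ring.
Qed.

Lemma excess_border k (S : 'M[C]_(n, k)) (Z : 'M[_]_k) v (xi : C) x :
  excess (row_mx S v) (block_mx Z x x^H xi%:M) =
  block_mx (excess S Z) (x - S^H *m L *m v) (x - S^H *m L *m v)^H (xi - hform L v v)%:M.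
Proof.
rewrite /excess gram_row_mx // opp_block_mx add_block_mx adjD adjN.
by rewrite raddfB.
Qed.

(** The corner entry [xi] of [Z'] is free. A large [xi] makes the excess positive,
    so only the corner of the defect has to be controlled. *)
Lemma grow_step k (S : 'M[C]_(n, k)) (M Z : 'M[_]_k) v m (mu : C) x :
  Z^H = Z -> hpd (lyap_defect S M Z) -> hpd (excess S Z) ->
  (exists2 c : C, c \is Num.real & forall xi, c < xi ->
     let r := S^H *m Q *m v - (Z *m m + mu *: x + M^H *m x) in
     hform (invmx (lyap_defect S M Z)) r r <
     hform Q v v - (hform 1%:M x m + (hform 1%:M x m)^* + (mu + mu^*) * xi)) ->
  exists Z' : 'M[_]_(k + 1), [/\ Z'^H = Z',
    hpd (lyap_defect (row_mx S v) (block_mx M m 0 mu%:M) Z')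
    & hpd (excess (row_mx S v) Z')].
Proof.
move=> Zh Dp Ep [c cr large].
pose e := x - S^H *m L *m v.
pose d := hform (invmx (excess S Z)) e e + hform L v v.
have hr m' (N : 'M[C]_m') y : N^H = N -> hform N y y \is Num.real.
  by move=> Nh; apply/CrealP; rewrite hform_adj Nh.
have dr : d \is Num.real.
  by rewrite rpredD ?hr // adj_inv; case: Ep => ->.
have [xi xir [cxi dxi]] : exists2 xi : C, xi \is Num.real & c < xi /\ d < xi.
  exists (`|c| + `|d| + 1); first by rewrite !rpredD ?normr_real ?rpred1.
  split; apply: ltr_pwDr; rewrite ?ltr01 //.
  - by apply: (le_trans (real_ler_norm cr)); rewrite lerDl.
  - by apply: (le_trans (real_ler_norm dr)); rewrite lerDr.
exists (block_mx Z x x^H xi%:M); split.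
- by rewrite adj_block_mx Zh trmxCK adj_scalar (CrealP xir).
- rewrite lyap_defect_border //; apply: hpd_border => //; exact: large.
- by rewrite excess_border; apply: hpd_border => //; rewrite ltrBrDr.
Qed.
End LyapunovGrowth.

(** * Eigenvectors modulo an invariant subspace *)

Section FactorChain.
Variables (F : fieldType) (n : nat) (B : 'M[F]_n).

Definition shifts (s : seq F) (u : 'cV[F]_n) : 'cV_n :=
  foldr (fun a w => B *m w - a *: w) u s.

Lemma char_poly_shifts s u :
  char_poly B = \prod_(a <- s) ('X - a%:P) -> shifts s u = 0.
Proof.
rewrite /shifts; move: B u; case: n => [|k] D u chD.
  by apply/matrixP => -[].
have := Cayley_Hamilton D; rewrite chD => /(congr1 (mulmx^~ u)).
rewrite mul0mx => <-; elim: s {chD} => [|a s IH] /=.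
  by rewrite big_nil rmorph1 mul1mx.
rewrite IH big_cons rmorphM /= rmorphB /= horner_mx_X horner_mx_C.
by rewrite -mulmxA mulmxBl mul_scalar_mx.
Qed.

(** A triangularization step: inside a [B]-stable set [K], the factors of an
    annihilating polynomial move [u] into [P] one after the other, and the last
    vector outside [P] is an eigenvector modulo [P]. *)
Lemma shifts_eigenvector (K P : 'cV[F]_n -> Prop) s u :
  (forall a w, K w -> K (B *m w - a *: w)) -> K u -> ~ P u -> P (shifts s u) ->
  exists a v, [/\ a \in s, K v, ~ P v & P (B *m v - a *: v)].
Proof.
move=> Kst Ku nPu; elim: s => //= a s IH Ps.
have [/IH [b [v [bs Kv nPv Pv]]]|nPs] := boolp.EM (P (shifts s u)).
  by exists b, v; split=> //; rewrite inE bs orbT.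
exists a, (shifts s u); split=> //; first by rewrite inE eqxx.
by rewrite /shifts; elim: s {IH Ps nPs} => //= b s IH; apply: Kst.
Qed.
End FactorChain.

(** * Invariant subspaces and the reversed characteristic polynomial *)

Section InvariantSubspace.
Variables (F : fieldType) (n : nat).

Definition inj_cols k (S : 'M[F]_(n, k)) := forall y : 'cV_k, S *m y = 0 -> y = 0.

Definition in_cols k (S : 'M[F]_(n, k)) (v : 'cV_n) := exists y : 'cV_k, v = S *m y.

Lemma inj_colsP k (S : 'M[F]_(n, k)) : inj_cols S <-> row_free S^T.
Proof.
split=> [S_free|Sfree y Sy].
  rewrite -kermx_eq0; apply/rowV0P => v /sub_kermxP vS.
  by rewrite -[v]trmxK (S_free v^T) ?trmx0 // -[S]trmxK -trmx_mul vS trmx0.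
apply: trmx_inj; rewrite trmx0; apply/eqP.
by rewrite -(mulmx_free_eq0 _ Sfree) -trmx_mul Sy trmx0.
Qed.

Lemma inj_cols_leq k (S : 'M[F]_(n, k)) : inj_cols S -> (k <= n)%N.
Proof. by move/inj_colsP => /eqP <-; apply: rank_leq_col. Qed.

Lemma inj_cols_unit (S : 'M[F]_n) : inj_cols S -> S \in unitmx.
Proof. by move/inj_colsP; rewrite row_free_unit unitmx_tr. Qed.

Lemma not_in_cols k (S : 'M[F]_(n, k)) : (k < n)%N -> exists u, ~ in_cols S u.
Proof.
move=> kn; have /row_subPn [i iS] : ~~ (1%:M <= S^T)%MS.
  apply: contraL kn => /mxrankS; rewrite mxrank1 -leqNgt => /leq_trans; apply.
  exact: rank_leq_row.
exists (row i 1%:M)^T => -[y Ey]; case/negP: iS; apply/submxP.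
by exists y^T; rewrite -trmx_mul -Ey trmxK.
Qed.

Lemma inj_cols_border k (S : 'M[F]_(n, k)) v :
  inj_cols S -> ~ in_cols S v -> inj_cols (row_mx S v).
Proof.
move=> S_free vS z; rewrite -[z]vsubmxK mul_row_col [dsubmx z]mx11_scalar.
set a := dsubmx z 0 0; rewrite mul_mx_scalar => E.
have [a0|a0] := eqVneq a 0.
  move: E; rewrite a0 scale0r addr0 => /S_free ->.
  by rewrite raddf0 col_mx0.
case: vS; exists (- a^-1 *: usubmx z); rewrite -scalemxAr.
by rewrite scaleNr -scalerN (addr0_eq E) scalerA mulVf // scale1r.
Qed.

Lemma invariant_border (B : 'M[F]_n) k (S : 'M[_]_(n, k)) M (v : 'cV_n) (m : 'cV_k) a :
  B *m S = S *m M -> B *m v = S *m m + a *: v ->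
  B *m row_mx S v = row_mx S v *m block_mx M m 0 a%:M.
Proof.
move=> BS Bv; rewrite mul_mx_row mul_row_block BS Bv mulmx0 addr0.
by rewrite mul_mx_scalar.
Qed.
End InvariantSubspace.

Section ReversedCharPoly.
Variables (C : fieldType).

(** [det (1 - 'X M)], whose roots are the inverses of the nonzero eigenvalues. *)
Definition rev_char k (M : 'M[C]_k) : {poly C} :=
  \det (1%:M - 'X *: map_mx polyC M).

Lemma horner_rev_char k (M : 'M[C]_k) z : (rev_char M).[z] = \det (1%:M - z *: M).
Proof.
rewrite /rev_char -horner_evalE -det_map_mx; congr (\det _).
apply/matrixP => i j; rewrite !mxE /= horner_evalE hornerD hornerN hornerM.
by rewrite hornerX !hornerC; case: eqP => _; rewrite ?hornerC ?horner0.
Qed.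

Lemma rev_char_neq0 k (M : 'M[C]_k) : rev_char M != 0.
Proof.
apply: contra_neq (oner_neq0 C) => /(congr1 (fun p => p.[0])).
by rewrite horner_rev_char scale0r subr0 det1 horner0.
Qed.

Lemma rev_char_border k (M : 'M[C]_k) (m : 'cV_k) a :
  rev_char (block_mx M m 0 a%:M) = rev_char M * (1 - a *: 'X).
Proof.
rewrite /rev_char map_block_mx scale_block_mx scalar_mx_block opp_block_mx.
rewrite add_block_mx map_mx0 scaler0 oppr0 addr0 det_ublock.
congr (_ * _); rewrite det_mx11 !mxE !eqxx !mulr1n.
by rewrite mulrC mul_polyC.
Qed.

Lemma root_rev_char k (M : 'M[C]_k) a (y : 'cV_k) :
  a != 0 -> y != 0 -> M *m y = a *: y -> root (rev_char M) a^-1.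
Proof.
move=> a0 y0 My; rewrite rootE horner_rev_char -det_tr; apply/det0P.
exists y^T; first by rewrite -trmx0 (inj_eq (@trmx_inj _ _ _)).
rewrite -trmx_mul mulmxBl mul1mx -scalemxAl My scalerA mulVf // scale1r subrr.
by rewrite trmx0.
Qed.

Lemma rev_char_root_vec k (M : 'M[C]_k) z : root (rev_char M) z ->
  exists2 w : 'cV_k, w != 0 & w = z *: (M *m w).
Proof.
rewrite rootE horner_rev_char -det_tr => /det0P [u u0 uM].
exists u^T; first by rewrite -trmx0 (inj_eq (@trmx_inj _ _ _)).
apply/eqP; rewrite -subr_eq0 scalemxAl -[X in X - _]mul1mx -mulmxBl.
by rewrite -[_ - _]trmxK -trmx_mul uM trmx0.
Qed.

Lemma rev_char_similar k (S : 'M[C]_k) B M :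
  S \in unitmx -> B *m S = S *m M -> rev_char B = rev_char M.
Proof.
move=> Su BS; pose Sp := map_mx polyC S.
have Spd : \det Sp != 0.
  by rewrite det_map_mx polyC_eq0 -unitfE -unitmxE.
apply: (mulIf Spd); rewrite -det_mulmx mulrC -det_mulmx; congr (\det _).
rewrite mulmxBl mulmxBr mul1mx mulmx1 -scalemxAl -scalemxAr.
by rewrite -!map_mxM BS.
Qed.



End ReversedCharPoly.

Section ReversedCharPolyClosed.
Variables (C : closedFieldType).

(** The characteristic polynomial splits, so [shifts_eigenvector] applies to any
    vector outside the range of [S]. *)
Lemma invariant_extend n (B : 'M[C]_n) k (S : 'M[_]_(n, k)) M :
  B *m S = S *m M -> (k < n)%N ->
  exists v m a, ~ in_cols S v /\ B *m v = S *m m + a *: v.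
Proof.
move=> BS /(not_in_cols S) [u uS].
have [r] := closed_field_poly_normal (char_poly B).
rewrite (monicP (char_poly_monic B)) scale1r => chB.
have := @shifts_eigenvector _ _ B (fun=> True) (in_cols S) r u (fun _ _ _ => I) I uS.
case; first by exists 0; rewrite (char_poly_shifts _ chB) mulmx0.
move=> a [v [_ _ vS [m Em]]]; exists v, m, a; split=> //.
by rewrite -Em subrK.
Qed.

(** Extending [S] up to a basis multiplies [rev_char] by linear factors. *)
Lemma rev_char_dvd n (B : 'M[C]_n) k (S : 'M[_]_(n, k)) M :
  inj_cols S -> B *m S = S *m M -> rev_char M %| rev_char B.
Proof.
have [d] := ubnP (n - k); elim: d k S M => // d IH k S M dk S_free BS.
have := inj_cols_leq S_free; rewrite leq_eqVlt => /orP[/eqP kn|kn].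
  move: S M S_free BS {dk IH}; rewrite kn => S M S_free BS.
  by rewrite (rev_char_similar (inj_cols_unit S_free) BS).
have [v [m [a [vS Bv]]]] := invariant_extend BS kn.
have := IH _ _ _ _ (inj_cols_border S_free vS) (invariant_border BS Bv).
rewrite rev_char_border addn1 subnS prednK ?subn_gt0 // -ltnS => /(_ dk).
by apply: dvdp_trans; apply: dvdp_mulr.
Qed.

Lemma leq_mup (p q : {poly C}) x : q != 0 -> p %| q -> (mup x p <= mup x q)%N.
Proof.
move=> q0 pq; have p0 : p != 0 by apply: contraNneq q0 => p0; rewrite -dvd0p -p0.
by rewrite mup_geq // (dvdp_trans _ pq) // -mup_geq.
Qed.

Lemma mup_border k (M : 'M[C]_k) (m : 'cV_k) a : a != 0 ->
  (mup a^-1 (rev_char M) < mup a^-1 (rev_char (block_mx M m 0 a%:M)))%N.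
Proof.
move=> a0; have f0 : 1 - a *: 'X != 0 :> {poly C}.
  apply: contra_neq (oner_neq0 C) => /(congr1 (fun p => p.[0])).
  by rewrite hornerD hornerN hornerZ hornerX mulr0 subr0 hornerC horner0.
rewrite rev_char_border mupM ?rev_char_neq0 // -addn1 leq_add2l.
rewrite -XsubC_dvd // dvdp_XsubCl rootE hornerD hornerN hornerZ hornerX hornerC.
by rewrite mulfV // subrr.
Qed.
End ReversedCharPolyClosed.

(** * A strict Lyapunov inequality with a prescribed lower bound *)

Section LyapunovInequality.
Variables (C : numClosedFieldType) (n : nat) (B Q L : 'M[C]_n).
Hypotheses (Qh : Q^H = Q) (Lh : L^H = L).

Local Notation defect := (lyap_defect Q).
Local Notation excess := (excess L).

Hypothesis imag_simple : forall z, 'Re z = 0 -> (mup z (rev_char B) <= 1)%N.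
Hypothesis ker_line : forall w w' : 'cV_n,
  B *m w = 0 -> B *m w' = 0 -> w != 0 -> exists c, w' = c *: w.
Hypothesis imag_pos : forall a (w : 'cV_n),
  'Re a = 0 -> w != 0 -> B *m w = a *: w -> 0 < hform Q w w.

Definition extension k (S : 'M[C]_(n, k)) (M Z : 'M[C]_k) :=
  exists (S' : 'M[_]_(n, k + 1)) (M' Z' : 'M[_]_(k + 1)), 
  [/\ [/\ inj_cols S', B *m S' = S' *m M' & rev_char M %| rev_char M'],
   Z'^H = Z', hpd (defect S' M' Z') & hpd (excess S' Z')].

Lemma extension_intro k (S : 'M[C]_(n, k)) (M Z : 'M[_]_k) v m (a : C) x :
  inj_cols S -> B *m S = S *m M -> Z^H = Z ->
  hpd (defect S M Z) -> hpd (excess S Z) ->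
  ~ in_cols S v -> B *m v = S *m m + a *: v ->
  (exists2 c : C, c \is Num.real & forall xi, c < xi ->
     let r := S^H *m Q *m v - (Z *m m + a *: x + M^H *m x) in
     hform (invmx (defect S M Z)) r r <
     hform Q v v - (hform 1%:M x m + (hform 1%:M x m)^* + (a + a^*) * xi)) ->
  extension S M Z.
Proof.
move=> S_free BS Zh Dp Ep vS Bv /(grow_step Qh Lh Zh Dp Ep) [Z' [Z'h D' E']].
exists (row_mx S v), (block_mx M m 0 a%:M), Z'; split=> //; split.
- exact: inj_cols_border.
- exact: invariant_border.
- by rewrite rev_char_border dvdp_mulr.
Qed.

(** A stable eigenvalue: the corner entry alone makes the defect positive. *)
Lemma extend_stable k (S : 'M[C]_(n, k)) (M Z : 'M[_]_k) v m (a : C) :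
  inj_cols S -> B *m S = S *m M -> Z^H = Z ->
  hpd (defect S M Z) -> hpd (excess S Z) ->
  ~ in_cols S v -> B *m v = S *m m + a *: v -> 'Re a < 0 -> extension S M Z.
Proof.
move=> S_free BS Zh Dp Ep vS Bv a_lt0.
apply: (extension_intro (x := 0) S_free BS Zh Dp Ep vS Bv).
rewrite scaler0 mulmx0 !addr0 hform0l conjC0 !addr0.
pose r := S^H *m Q *m v - Z *m m; pose h := hform (invmx (defect S M Z)) r r.
have a2 : a + a^* = 2 * 'Re a by rewrite ReE mulrC divfK // pnatr_eq0.
have nr : 0 < - (a + a^*) by rewrite a2 -mulrN mulr_gt0 ?oppr_gt0.
exists ((h - hform Q v v) / - (a + a^*)).
  rewrite rpred_div ?rpredB //; last exact: gtr0_real.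
  - by apply/CrealP; rewrite hform_adj adj_inv; case: Dp => ->.
  - by apply/CrealP; rewrite hform_adj Qh.
move=> xi; rewrite ltr_pdivrMr //= -/r -/h => hxi.
rewrite add0r ltrBrDl -ltrBrDr; move: hxi.
by rewrite mulrN ltrNr opprB [xi * _]mulrC.
Qed.

(** A new eigenvalue on the imaginary axis: along an eigenvector [w] the defect
    is [hform Q w w] whatever the extension, and the border of the defect can be
    made zero since [M^H + a] is invertible. *)
Lemma extend_imag_new k (S : 'M[C]_(n, k)) (M Z : 'M[_]_k) v m (a : C) :
  inj_cols S -> B *m S = S *m M -> Z^H = Z ->
  hpd (defect S M Z) -> hpd (excess S Z) ->
  ~ in_cols S v -> B *m v = S *m m + a *: v ->
  'Re a = 0 -> M - a%:M \in unitmx -> extension S M Z.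
Proof.
move=> S_free BS Zh Dp Ep vS Bv a0 Mu.
(* correct [v] by a vector of the subspace into a true eigenvector [w] *)
pose y := - (invmx (M - a%:M) *m m); pose w := v + S *m y.
have wS : ~ in_cols S w.
  case=> u Eu; apply: vS; exists (u - y).
  by rewrite mulmxBr -Eu /w addrK.
have My : M *m y + m = a *: y.
  have : (M - a%:M) *m y = - m by rewrite mulmxN mulmxA mulmxV // mul1mx.
  rewrite mulmxBl mul_scalar_mx => /(canRL (subrK _)) ->; rewrite addrAC addNr.
  by rewrite add0r.
have Bw : B *m w = S *m 0 + a *: w.
  rewrite mulmx0 add0r mulmxDr Bv mulmxA BS scalerDr scalemxAr.
  by rewrite -My mulmxDr mulmxA [RHS]addrC addrAC [S *m M *m y + _]addrC.
have ac : a^* = - a.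
  by apply/eqP; rewrite -addr_eq0 addrC; move: a0; rewrite ReE => /eqP;
     rewrite mulf_eq0 invr_eq0 pnatr_eq0 orbF.
pose x := invmx (M - a%:M)^H *m (S^H *m Q *m w).
have Ex : a *: x + M^H *m x = S^H *m Q *m w.
  have <- : (M - a%:M)^H *m x = S^H *m Q *m w.
    by rewrite /x mulmxA mulmxV ?mul1mx // map_unitmx unitmx_tr.
  by rewrite adjD adjN adj_scalar ac mulmxBl mul_scalar_mx scaleNr opprK addrC.
apply: (extension_intro (x := x) S_free BS Zh Dp Ep wS Bw).
exists 0 => // xi _; rewrite mulmx0 add0r Ex subrr /=.
rewrite !hform0r conjC0 addr0 ac subrr mul0r addr0 subr0.
apply: (imag_pos a0); last by rewrite Bw mulmx0 add0r.
by apply: contra_notN wS => /eqP ->; exists 0; rewrite mulmx0.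
Qed.

(** A repeated eigenvalue [0] with a one-dimensional kernel: the chain condition
    puts [m] outside the range of [M], and a left null vector [x] of [M] with
    [x^* m] very negative dominates the border. *)
Lemma extend_nilpotent k (S : 'M[C]_(n, k)) (M Z : 'M[_]_k) v m :
  inj_cols S -> B *m S = S *m M -> Z^H = Z ->
  hpd (defect S M Z) -> hpd (excess S Z) ->
  ~ in_cols S v -> B *m v = S *m m -> M \notin unitmx -> extension S M Z.
Proof.
move=> S_free BS Zh Dp Ep vS Bv Mu.
have [y0 y0n My0] : exists2 y : 'cV_k, y != 0 & M *m y = 0.
  have : ~~ row_free M^T by rewrite row_free_unit unitmx_tr.
  rewrite -kermx_eq0 => /rowV0Pn [u /sub_kermxP uM u0]; exists u^T.
    by rewrite -trmx0 (inj_eq (@trmx_inj _ _ _)).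
  by rewrite -[M]trmxK -trmx_mul uM trmx0.
have mM : ~~ (m^T <= M^T)%MS.
  apply/negP => /submxP [y /(congr1 trmx)]; rewrite trmx_mul !trmxK => Em.
  have Bw : B *m (v - S *m y^T) = 0 by rewrite mulmxBr Bv mulmxA BS Em mulmxA subrr.
  have BSy : B *m (S *m y0) = 0 by rewrite mulmxA BS -mulmxA My0 mulmx0.
  have Sy0 : S *m y0 != 0 by apply: contra_neq y0n; apply: S_free.
  have [c Ec] := ker_line BSy Bw Sy0.
  apply: vS; exists (c *: y0 + y^T); rewrite mulmxDr -scalemxAr -Ec.
  by rewrite subrK.
have [x0 Mx0 mx0] : exists2 x : 'cV_k, M^H *m x = 0 & hform 1%:M x m != 0.
  move: mM; rewrite submxE => /rV0Pn [j]; set K := cokermx M^T => mj.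
  pose u := col j K; exists (map_mx Num.conj u); last first.
    rewrite /hform mulmx1; have -> : (map_mx Num.conj u)^H = u^T.
      by apply/matrixP => p q; rewrite !mxE conjCK.
    rewrite -[u^T *m m]trmxK trmx_mul trmxK mxE.
    by rewrite /u colE mulmxA -colE mxE.
  by rewrite -map_mxM /u colE mulmxA mulmx_coker mul0mx map_mx0.
pose r := S^H *m Q *m v - Z *m m; pose h := hform (invmx (defect S M Z)) r r.
(* [x^* m = - s / 2] contributes [s] to the corner of the defect *)
pose s := h - hform Q v v + 1.
have sr : s \is Num.real.
  rewrite /s !(rpredB, rpredD) ?rpred1 //.
  - by apply/CrealP; rewrite hform_adj adj_inv; case: Dp => ->.
  - by apply/CrealP; rewrite hform_adj Qh.
pose x := (- s / 2 / hform 1%:M x0 m)^* *: x0.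
have Ex : hform 1%:M x m = - s / 2 by rewrite hformZl conjCK divfK.
have Ex' : (- s / 2)^* = - s / 2.
  by apply/CrealP; rewrite rpred_div ?rpredN ?realn.
have Bv' : B *m v = S *m m + 0 *: v by rewrite scale0r addr0.
apply: (extension_intro (x := x) S_free BS Zh Dp Ep vS Bv').
exists 0 => // xi _.
rewrite Ex Ex' scale0r addr0 /x -scalemxAr Mx0 scaler0 addr0 conjC0 addr0 mul0r addr0.
have -> : hform Q v v - (- s / 2 + - s / 2) = h + 1 by rewrite /s; field.
by rewrite /= -/r -/h ltrDl ltr01.
Qed.

Lemma hpd_cong k (S N : 'M[C]_k) : S \in unitmx -> hpd (S^H *m N *m S) -> hpd N.
Proof.
move=> Su [Nh Np]; have SHu : S^H \in unitmx by rewrite map_unitmx unitmx_tr.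
split=> [|x x0].
  move: Nh; rewrite !adjM trmxCK -mulmxA => /(can_inj (mulKmx SHu)).
  by move/(can_inj (mulmxK Su)).
rewrite -[x](mulKVmx Su) -hform_mulr -hform_mull mulmxA; apply: Np.
by apply: contra x0 => /eqP E; rewrite -[x](mulKVmx Su) E mulmx0.
Qed.

(** Grow [S] one vector at a time until it is square, so that [Z] becomes [X]. The
    multiplicity bounds decide how: [anti] says that the antistable eigenvalues are
    used up by the initial subspace, [imag_simple] that a nonzero imaginary
    eigenvalue is new, and [ker_line] that [0] has a single chain. *)
Theorem lyapunov_inequality k (S : 'M[C]_(n, k)) (M Z : 'M[_]_k) :
  inj_cols S -> B *m S = S *m M -> Z^H = Z ->
  (forall z, 0 < 'Re z -> (mup z (rev_char B) <= mup z (rev_char M))%N) ->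
  hpd (defect S M Z) -> hpd (excess S Z) ->
  exists X : 'M[_]_n, [/\ X^H = X, hpd (Q - (B^H *m X + X *m B)) & hpd (X - L)].
Proof.
have [d] := ubnP (n - k); elim: d k S M Z => // d IH k S M Z dk S_free BS Zh anti Dp Ep.
have := inj_cols_leq S_free; rewrite leq_eqVlt => /orP[/eqP kn|kn].
  move: S M Z S_free BS Zh Dp Ep {dk IH anti}; rewrite kn => S M Z S_free BS Zh Dp Ep.
  have Su := inj_cols_unit S_free.
  have SHu : S^H \in unitmx by rewrite map_unitmx unitmx_tr.
  pose X := invmx S^H *m Z *m invmx S.
  have XS : S^H *m X *m S = Z by rewrite /X !mulmxA mulmxV // mul1mx mulmxKV.
  exists X; split.
  - by rewrite /X !adjM !adj_inv trmxCK Zh mulmxA.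
  - apply: (hpd_cong Su); suff -> : S^H *m (Q - (B^H *m X + X *m B)) *m S = defect S M Z by [].
    have E : M^H *m S^H = S^H *m B^H by rewrite -!adjM BS.
    rewrite /lyap_defect -XS mulmxBr mulmxBl mulmxDr mulmxDl !mulmxA E.
    by congr (_ - (_ + _)); rewrite -!mulmxA BS.
  - by apply: (hpd_cong Su); rewrite mulmxBr mulmxBl XS.
have [v [m [a [vS Bv]]]] := invariant_extend BS kn.
suff [S' [M' [Z' [[S'inj BS' dvd] Z'h D' E']]]] : extension S M Z.
  apply: (IH _ S' M' Z') => //.
    by rewrite addn1 subnS prednK ?subn_gt0 // -ltnS.
  move=> z /anti/leq_trans; apply; apply: leq_mup => //; exact: rev_char_neq0.
have dvdB : (mup a^-1 (rev_char (block_mx M m 0 a%:M)) <= mup a^-1 (rev_char B))%N.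
  apply: leq_mup; first exact: rev_char_neq0.
  exact: rev_char_dvd (inj_cols_border S_free vS) (invariant_border BS Bv).
have [ra|ra|ra] := real_ltgtP (Creal_Re a) (real0 C).
- exact: extend_stable Bv ra.
- have a0 : a != 0 by apply: contraTneq ra => ->; rewrite raddf0 ltxx.
  have : 0 < 'Re a^-1 by rewrite ReV divr_gt0 // exprn_gt0 // normr_gt0.
  move=> /anti; rewrite leqNgt => /negP; case.
  exact: leq_trans (mup_border M m a0) dvdB.
- have [Mu|Mu] := boolP (M - a%:M \in unitmx).
    exact: extend_imag_new Bv ra Mu.
  have [a0|a0] := eqVneq a 0.
    move: Bv Mu; rewrite a0 scale0r addr0 raddf0 subr0 => Bv Mu.
    exact: extend_nilpotent Bv Mu.
  have : 'Re a^-1 = 0 by rewrite ReV ra mul0r.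
  move=> /imag_simple; rewrite leqNgt => /negP; case.
  apply: leq_trans dvdB; apply: leq_trans (mup_border M m a0); rewrite ltnS.
  rewrite -XsubC_dvd ?rev_char_neq0 // dvdp_XsubCl.
  have : ~~ row_free (M - a%:M)^T by rewrite row_free_unit unitmx_tr.
  rewrite -kermx_eq0 => /rowV0Pn [u /sub_kermxP uM u0].
  apply: (@root_rev_char _ _ _ _ u^T a0).
    by rewrite -trmx0 (inj_eq (@trmx_inj _ _ _)).
  apply/eqP; rewrite -subr_eq0 -mul_scalar_mx -mulmxBl -[_ - _]trmxK -trmx_mul uM.
  by rewrite trmx0.
Qed.
End LyapunovInequality.

(** * Real semidefinite matrices *)

Section RealPsd.
Variable R : realType.

Lemma psdmx_cong k l (M : 'M[R]_k) (G : 'M[_]_(k, l)) :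
  psdmx M -> psdmx (G^T *m M *m G).
Proof.
move=> [Ms Mp]; split=> [|x]; first by rewrite !trmx_mul trmxK Ms mulmxA.
by have := Mp (G *m x); rewrite trmx_mul !mulmxA.
Qed.

Lemma psdmxD k (M N : 'M[R]_k) : psdmx M -> psdmx N -> psdmx (M + N).
Proof.
move=> [Ms Mp] [Ns Np]; split=> [|x]; first by rewrite linearD /= Ms Ns.
by rewrite mulmxDr mulmxDl mxE addr_ge0.
Qed.

Lemma psdmxZ k (M : 'M[R]_k) a : 0 <= a -> psdmx M -> psdmx (a *: M).
Proof.
move=> a0 [Ms Mp]; split=> [|x]; first by rewrite linearZ /= Ms.
by rewrite -scalemxAr -scalemxAl mxE mulr_ge0.
Qed.

Lemma pdmx_psdmx k (M : 'M[R]_k) : pdmx M -> psdmx M.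
Proof.
move=> [Ms Mp]; split=> // x; have [->|/Mp/ltW//] := eqVneq x 0.
by rewrite mulmx0 mxE.
Qed.

Lemma sqnorm_ge0 k (v : 'cV[R]_k) : 0 <= (v^T *m v) 0 0.
Proof. by rewrite mxE sumr_ge0 // => i _; rewrite mxE -expr2 sqr_ge0. Qed.

Lemma gram_ge0 k l (V : 'M[R]_(k, l)) : psdmx (V^T *m V).
Proof.
split=> [|x]; first by rewrite trmx_mul trmxK.
by rewrite !mulmxA -trmx_mul -mulmxA sqnorm_ge0.
Qed.

Lemma psdmx_diag k l (P : 'M[R]_k) (Q : 'M[R]_l) :
  psdmx P -> psdmx Q -> psdmx (block_mx P 0 0 Q).
Proof.
move=> [Ps P0] [Qs Q0]; split=> [|x]; first by rewrite tr_block_mx Ps Qs !trmx0.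
rewrite -[x]vsubmxK tr_col_mx mul_row_block mul_row_col !mulmx0 addr0 add0r mxE.
exact: addr_ge0.
Qed.

Lemma psdmx_schur k l (P : 'M[R]_k) (r : 'M[R]_(k, l)) (g : R) : 0 < g ->
  psdmx (block_mx P r r^T g%:M) <-> psdmx (P - g^-1 *: (r *m r^T)).
Proof.
move=> g0; have gn : g != 0 by rewrite gt_eqF.
pose T (a : R) : 'M[R]_(k + l) := block_mx 1%:M 0 (a *: r^T) 1%:M.
have E : (T g^-1)^T *m block_mx (P - g^-1 *: (r *m r^T)) 0 0 g%:M *m T g^-1
    = block_mx P r r^T g%:M.
  have tZ : (g^-1 *: r^T)^T = g^-1 *: r by rewrite linearZ /= trmxK.
  rewrite /T tr_block_mx !mulmx_block !trmx0 !trmx1 !mul0mx !mulmx0 !mul1mx !mulmx1.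
  rewrite !addr0 !add0r tZ !mul_mx_scalar !scalerA mulfV // scale1r.
  by rewrite mul_scalar_mx scalerA mulfV // scale1r -scalemxAr subrK.
have E' : (row_mx 1%:M (- g^-1 *: r)) *m block_mx P r r^T g%:M *m
     (row_mx 1%:M (- g^-1 *: r))^T = P - g^-1 *: (r *m r^T).
  rewrite tr_row_mx trmx1 linearZ /= mul_row_block mul_row_col !mul1mx mulmx1.
  rewrite mul_mx_scalar scalerA mulrN mulfV // scaleN1r addrN mul0mx addr0.
  by rewrite -scalemxAl scaleNr.
split=> [H|H].
  by rewrite -E'; have := psdmx_cong (row_mx 1%:M (- g^-1 *: r))^T H; rewrite trmxK.
rewrite -E; apply/psdmx_cong/psdmx_diag => //.
split=> [|x]; first by rewrite tr_scalar_mx.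
by rewrite mul_mx_scalar -scalemxAl mxE mulr_ge0 ?sqnorm_ge0 // ltW.
Qed.

End RealPsd.

(** * Inverting the system matrix *)

Section SystemMatrix.
Variables (F : fieldType) (n : nat).

(** The inverse of the transposed system matrix, given blockwise, turns the
    null-vector equations [A^T p + c q = xi], [b^T p + d q = 0] into
    [p = B xi], [q = beta^T xi]. *)
Variables (A B : 'M[F]_n) (b c beta r : 'cV[F]_n) (d s : F).
Hypothesis inv_sys :
  block_mx B r beta^T s%:M *m block_mx A^T c b^T d%:M = 1%:M.

Lemma null_eqs : A^T *m B + c *m beta^T = 1%:M /\ b^T *m B + d *: beta^T = 0.
Proof.
have := mulmx1C inv_sys; rewrite mulmx_block scalar_mx_block.
by move=> /eq_block_mx [-> _ + _]; rewrite mul_scalar_mx.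
Qed.

Lemma null_solution l (p xi : 'M[F]_(n, l)) (q : 'M[_]_(1, l)) :
  A^T *m p + c *m q = xi -> b^T *m p + d *: q = 0 ->
  p = B *m xi /\ q = beta^T *m xi.
Proof.
move=> <- E2.
have : block_mx B r beta^T s%:M *m (block_mx A^T c b^T d%:M *m col_mx p q) = col_mx p q.
  by rewrite mulmxA inv_sys mul1mx.
rewrite mul_block_col mul_scalar_mx E2 mul_block_col !mulmx0 !addr0.
by move=> /eq_col_mx [-> ->].
Qed.

(** Up to a constant, the zero polynomial is [det (1 - s B)]; the zeros at infinity
    have become the eigenvalue [0] of [B]. *)
Lemma det_system :
  \det (block_mx (map_mx polyC A - 'X%:M) (map_mx polyC b)
                 (map_mx polyC c)^T (d%:P)%:M)
  = (\det (block_mx A b c^T d%:M))%:P * rev_char B.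
Proof.
set P := block_mx A^T c b^T d%:M.
have PT : P^T = block_mx A b c^T d%:M by rewrite /P tr_block_mx !trmxK tr_scalar_mx.
pose E : 'M[{poly F}]_(n + 1) :=
  block_mx (1%:M - 'X *: map_mx polyC B) 0 (- 'X *: map_mx polyC beta^T) 1%:M.
have -> : rev_char B = \det E by rewrite /E det_lblock det1 mulr1.
rewrite -PT det_tr -det_map_mx -det_mulmx -[RHS]det_tr; congr (\det _).
apply: trmx_inj; rewrite trmxK /P map_block_mx /E mulmx_block.
have [e1 e2] := null_eqs.
rewrite tr_block_mx !map_scalar_mx tr_scalar_mx !trmxK !mulmx0 !add0r !mulmx1 map_trmx.
rewrite !mulmxBr !mulmx1 -!scalemxAr !scaleNr -!map_mxM linearB /= tr_scalar_mx.
congr block_mx.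
- rewrite -addrA -opprD -scalerDr -map_mxD e1 map_scalar_mx rmorph1.
  by rewrite scalemx1 map_trmx.
- rewrite -addrA -opprD.
  by rewrite mul_scalar_mx -[d%:P *: _]map_mxZ -scalerDr -map_mxD e2 map_mx0 scaler0 subr0.
Qed.
End SystemMatrix.

(** * The projected inequality as a Lyapunov inequality *)

Section Projection.
Variables (R : realType) (n : nat).
Variables (A B X : 'M[R]_n) (b c beta r b1 : 'cV[R]_n) (d s d11 gamma : R).
Hypothesis inv_sys :
  block_mx B r beta^T s%:M *m block_mx A^T c b^T d%:M = 1%:M.
Hypothesis Xs : X^T = X.

(** The functional [b1^T p + d11 q] in terms of [xi]. *)
Definition dist_vec : 'cV[R]_n := B^T *m b1 + d11 *: beta.

(** Gram matrix of [gamma |q|^2 - |b1^T p + d11 q|^2 / gamma] in terms of [xi]. *)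
Definition supply : 'M[R]_n :=
  gamma *: (beta *m beta^T) - gamma^-1 *: (dist_vec *m dist_vec^T).

(* [K] parametrizes the orthogonal complement of [lmi_perp_mx b d] by [xi] and the
   last coordinate. *)
Let K : 'M[R]_(n + 1 + 1, n + 1) := block_mx (col_mx B beta^T) 0 0 1%:M.

Lemma perp_kernel : (lmi_perp_mx b d)^T *m K = 0.
Proof.
have [_ e2] := null_eqs inv_sys.
rewrite /lmi_perp_mx /K !tr_col_mx tr_scalar_mx mul_row_block !mul_row_col.
by rewrite trmx0 mul_scalar_mx e2 !mulmx0 mul0mx !addr0 row_mx0.
Qed.

Lemma lmi_control_congruence :
  - (K^T *m lmi_control_mx A b1 c d11 gamma X *m K)
  = block_mx (gamma *: (beta *m beta^T) - (B^T *m X + X *m B))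
             (- dist_vec) (- dist_vec)^T gamma%:M.
Proof.
have [e1 _] := null_eqs inv_sys.
have ecb : c *m beta^T = 1%:M - A^T *m B by rewrite -e1 addrC addKr.
have ebc : beta *m c^T = 1%:M - B^T *m A.
  by apply: trmx_inj; rewrite trmx_mul trmxK ecb linearB /= trmx1 trmx_mul trmxK.
rewrite /K /lmi_control_mx tr_block_mx !trmx0 trmx1 tr_col_mx trmxK.
rewrite !mulmx_block !mul1mx !mul0mx !mulmx1 !mulmx0 !addr0 !add0r.
rewrite !mul_row_block !mul_row_col opp_block_mx /He trmx_mul Xs.
have Eeta : dist_vec = B^T *m b1 + beta *m d11%:M by rewrite mul_mx_scalar.
congr block_mx; last first.
- by rewrite raddfN /= opprK.
- have etaT : dist_vec^T = b1^T *m B + d11%:M *m beta^T.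
    by rewrite /dist_vec linearD linearZ /= trmx_mul trmxK mul_scalar_mx.
  by rewrite raddfN /= etaT.
- by rewrite -Eeta.
rewrite mul_mx_scalar !mulmxDl !mulmxDr -!scalemxAl !mulmxDl -!mulmxA ecb.
rewrite !mulmxA ebc !mulmxBl !mulmxBr !mul1mx !mulmx1 !mulmxA scaleNr.
set a := B^T *m A *m X *m B; set e := _ *m A^T *m B.
set t := gamma *: _; set u := B^T *m X; set v := X *m B.
by clearbody a e t u v; apply/matrixP => i j; rewrite !mxE; ring.
Qed.

Variable N : 'M[R]_(n + 1 + 1, n + 1 + 1 - \rank (lmi_perp_mx b d)).
Hypothesis Np : is_perp N.

Lemma perp_sub l (V : 'M[R]_(n + 1 + 1, l)) :
  (lmi_perp_mx b d)^T *m V = 0 -> exists G, V = N *m G.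
Proof.
have [PN [_ Npd]] := Np.
move=> PV; have NK : (N^T <= kermx (lmi_perp_mx b d))%MS.
  by apply/sub_kermxP; apply: trmx_inj; rewrite trmx_mul trmxK PN trmx0.
have Nfree : row_free N^T.
  apply/inj_colsP => y Ny; apply/eqP/negP => /negP /Npd.
  by rewrite -!mulmxA Ny !mulmx0 mxE ltxx.
have KN : (kermx (lmi_perp_mx b d) <= N^T)%MS.
  by rewrite -(mxrank_leqif_sup NK) mxrank_ker (eqP Nfree).
have /submxP [D /(congr1 trmx)] : (V^T <= N^T)%MS.
  apply: submx_trans KN; apply/sub_kermxP; apply: trmx_inj.
  by rewrite trmx_mul trmxK PV trmx0.
by rewrite trmx_mul !trmxK => ->; exists D^T.
Qed.

Lemma kernel_sub l (V : 'M[R]_(n + 1 + 1, l)) :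
  (lmi_perp_mx b d)^T *m V = 0 -> exists G, V = K *m G.
Proof.
rewrite /lmi_perp_mx !tr_col_mx tr_scalar_mx trmx0 -[V]vsubmxK -[usubmx V]vsubmxK.
set p := usubmx (usubmx V); set q := dsubmx (usubmx V).
rewrite !mul_row_col mul0mx addr0 mul_scalar_mx => E2.
have [Ep Eq] := null_solution inv_sys (erefl _) E2.
exists (col_mx (A^T *m p + c *m q) (dsubmx V)).
by rewrite /K mul_block_col !mul0mx mul1mx addr0 add0r mul_col_mx -Ep -Eq.
Qed.

(** The last coordinate vector is orthogonal to [lmi_perp_mx b d], and the form takes
    the value [- gamma] on it. *)
Lemma lmi_control_level : psdmx (- (N^T *m lmi_control_mx A b1 c d11 gamma X *m N)) -> 0 <= gamma.
Proof.
pose e : 'cV[R]_(n + 1 + 1) := col_mx 0 1%:M.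
have [|G EG] := @perp_sub _ e.
  by rewrite /lmi_perp_mx tr_col_mx mul_row_col mulmx0 trmx0 mul0mx addr0.
move=> /(psdmx_cong G) [_ /(_ 1%:M)].
have -> : G^T *m - (N^T *m lmi_control_mx A b1 c d11 gamma X *m N) *m G =
    - (e^T *m lmi_control_mx A b1 c d11 gamma X *m e).
  by rewrite EG trmx_mul mulmxN mulNmx !mulmxA.
rewrite trmx1 mul1mx mulmx1 /lmi_control_mx /e tr_col_mx trmx0 trmx1.
rewrite mul_row_block mul_row_col !mul0mx !mul1mx !mulmx0 mulmx1 !add0r.
by rewrite !mxE eqxx mulr1n opprK.
Qed.

(** [N] and [K] have the same range, and after the congruence by [K] a Schur complement
    with respect to [gamma] removes the last coordinate. *)
Lemma lmi_control_lyapunov : 0 < gamma ->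
  psdmx (- (N^T *m lmi_control_mx A b1 c d11 gamma X *m N))
  <-> psdmx (supply - (B^T *m X + X *m B)).
Proof.
move=> g0; set M := lmi_control_mx _ _ _ _ _ _.
have -> : supply - (B^T *m X + X *m B) =
    gamma *: (beta *m beta^T) - (B^T *m X + X *m B) - gamma^-1 *: (- dist_vec *m (- dist_vec)^T).
  by rewrite linearN /= mulmxN mulNmx opprK /supply addrAC.
rewrite -(psdmx_schur _ _ g0) -lmi_control_congruence -/M.
have cong k l (V : 'M[R]_(n + 1 + 1, k)) (W : 'M[R]_(n + 1 + 1, l)) G :
    W = V *m G -> psdmx (- (V^T *m M *m V)) -> psdmx (- (W^T *m M *m W)).
  move=> ->; have -> : - ((V *m G)^T *m M *m (V *m G)) = G^T *m - (V^T *m M *m V) *m G.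
    by rewrite mulmxN mulNmx trmx_mul !mulmxA.
  exact: psdmx_cong.
have [G EG] := perp_sub perp_kernel; have [G' EG'] := kernel_sub (proj1 Np).
by split; [apply: cong EG | apply: cong EG'].
Qed.

Lemma lmi_control_mono g' : gamma <= g' ->
  psdmx (- (N^T *m lmi_control_mx A b1 c d11 gamma X *m N)) ->
  psdmx (- (N^T *m lmi_control_mx A b1 c d11 g' X *m N)).
Proof.
move=> gg H; pose V : 'M[R]_(1 + 1, n + 1 + 1) :=
  block_mx (row_mx 0 1%:M) 0 0 1%:M.
have -> : lmi_control_mx A b1 c d11 g' X =
    lmi_control_mx A b1 c d11 gamma X - (g' - gamma) *: (V^T *m V).
  rewrite /lmi_control_mx /V tr_block_mx mulmx_block !trmx0 !mulmx0 !mul0mx !addr0 !add0r.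
  rewrite tr_row_mx trmx0 trmx1 mul_col_row !mulmx0 !mul0mx !mulmx1.
  rewrite scale_block_mx opp_block_mx add_block_mx !scaler0 !oppr0 !addr0.
  rewrite scale_block_mx opp_block_mx add_block_mx !scaler0 !oppr0 !addr0.
  have E : (- g')%:M = (- gamma)%:M - (g' - gamma) *: 1%:M :> 'M[R]_1.
    by rewrite scalemx1 -raddfB; congr (_%:M); rewrite opprB addKr.
  by rewrite -!E.
rewrite mulmxBr mulmxBl opprB addrC; apply: psdmxD => //.
rewrite -scalemxAr -scalemxAl; apply: psdmxZ; first by rewrite subr_ge0.
have := gram_ge0 (V *m N); by rewrite trmx_mul !mulmxA.
Qed.
End Projection.

(** * Passing between real and complex matrices *)

Section Complexification.
Variable R : realType.
Local Notation C := R[i].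
Local Notation toC := (real_complex R).
Local Notation toCmx := (map_mx toC).

Lemma conj_real (x : R) : (toC x)^* = toC x.
Proof. by apply/CrealP; apply/complex_realP; exists x. Qed.

Lemma adj_real m n (M : 'M[R]_(m, n)) : (toCmx M)^H = toCmx M^T.
Proof. by apply/matrixP => i j; rewrite !mxE conj_real. Qed.

Lemma hform_real m n (M : 'M[R]_(m, n)) x y :
  hform (toCmx M) (toCmx x) (toCmx y) = toC ((x^T *m M *m y) 0 0).
Proof. by rewrite /hform adj_real -!map_mxM mxE. Qed.

Local Notation Remx := (map_mx (@complex.Re R)).
Local Notation Immx := (map_mx (@complex.Im R)).

Lemma mx_ReIm m n (M : 'M[C]_(m, n)) : M = toCmx (Remx M) + 'i *: toCmx (Immx M).
Proof. by apply/matrixP => i j; rewrite !mxE [LHS]complexE complexiE. Qed.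

Lemma hform_ReIm k (M : 'M[R]_k) (x : 'cV[C]_k) : M^T = M ->
  hform (toCmx M) x x = toC (((Remx x)^T *m M *m Remx x) 0 0
                           + ((Immx x)^T *m M *m Immx x) 0 0).
Proof.
move=> Ms; rewrite {1 2}(mx_ReIm x); set a := Remx x; set b := Immx x.
rewrite hformDl !hformDr !hformZl !hformZr !hform_real conjCi.
have -> : (b^T *m M *m a) 0 0 = (a^T *m M *m b) 0 0.
  transitivity ((b^T *m M *m a)^T 0 0); first by rewrite [RHS]mxE.
  by rewrite !trmx_mul trmxK Ms mulmxA.
rewrite rmorphD /= addrA mulNr addrK mulrA mulNr -expr2 sqrCi opprK mul1r.
by [].
Qed.

Lemma psdmx_hform k (M : 'M[R]_k) (x : 'cV[C]_k) :
  psdmx M -> 0 <= hform (toCmx M) x x.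
Proof. by move=> [Ms Mp]; rewrite hform_ReIm // ler0c addr_ge0. Qed.

Lemma pdmx_hpd k (M : 'M[R]_k) : pdmx M -> hpd (toCmx M).
Proof.
move=> Mpd; have [Ms Mp] := Mpd; have [_ ge0] := pdmx_psdmx Mpd.
split=> [|x x0]; first by rewrite adj_real Ms.
have ab : (Remx x != 0) || (Immx x != 0).
  apply: contraNT x0; rewrite negb_or !negbK => /andP[/eqP a0 /eqP b0].
  by rewrite (mx_ReIm x) a0 b0 !map_mx0 scaler0 addr0.
rewrite hform_ReIm // (ltcR 0).
by case/orP: ab => /Mp p; [apply: ltr_wpDr | apply: ltr_wpDl].
Qed.


Lemma Re_mulr (z : C) (x : R) : complex.Re (z * toC x) = complex.Re z * x.
Proof. by case: z => a b /=; rewrite mulr0 subr0. Qed.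

Lemma Re_sum I (s : seq I) (F : I -> C) :
  complex.Re (\sum_(i <- s) F i) = \sum_(i <- s) complex.Re (F i).
Proof. by elim/big_rec2: _ => // i _ z _ <-; case: (F i) z => [a b] []. Qed.

Lemma Remx_mulr m n p (M : 'M[C]_(m, n)) (N : 'M[R]_(n, p)) :
  Remx (M *m toCmx N) = Remx M *m N.
Proof.
apply/matrixP => i j; rewrite !mxE Re_sum; apply: eq_bigr => l _.
by rewrite !mxE Re_mulr.
Qed.

Lemma Remx_mull m n p (N : 'M[R]_(m, n)) (M : 'M[C]_(n, p)) :
  Remx (toCmx N *m M) = N *m Remx M.
Proof.
apply/matrixP => i j; rewrite !mxE Re_sum; apply: eq_bigr => l _.
by rewrite !mxE mulrC Re_mulr mulrC.
Qed.

Lemma RemxD m n (M N : 'M[C]_(m, n)) : Remx (M + N) = Remx M + Remx N.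
Proof. by apply/matrixP => i j; rewrite !mxE; case: (M i j) (N i j) => ? ? []. Qed.

Lemma RemxN m n (M : 'M[C]_(m, n)) : Remx (- M) = - Remx M.
Proof. by apply/matrixP => i j; rewrite !mxE; case: (M i j). Qed.

Lemma Remx_real m n (M : 'M[R]_(m, n)) : Remx (toCmx M) = M.
Proof. by apply/matrixP => i j; rewrite !mxE. Qed.

Lemma Remx_adj n (M : 'M[C]_n) : M^H = M -> (Remx M)^T = Remx M.
Proof.
move=> Mh; rewrite -{2}Mh; apply/matrixP => i j; rewrite !mxE.
by rewrite -[Num.conj _]/(conjc _); case: (M j i).
Qed.

Lemma hpd_Remx k (M : 'M[C]_k) : hpd M -> psdmx (Remx M).
Proof.
move=> hM; have [Mh _] := hM; split=> [|x]; first exact: Remx_adj.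
have := hpd_ge0 (toCmx x) hM; rewrite /hform adj_real lecE => /andP[_].
have -> : (x^T *m Remx M *m x) 0 0 = complex.Re ((toCmx x^T *m M *m toCmx x) 0 0) by
  rewrite -Remx_mull -Remx_mulr [LHS]mxE.
by [].
Qed.

Lemma map_rev_char k (M : 'M[R]_k) : map_poly toC (rev_char M) = rev_char (toCmx M).
Proof.
rewrite /rev_char -det_map_mx map_mxB map_scalar_mx rmorph1 map_mxZ /= map_polyX.
by rewrite -!map_mx_comp; congr (\det (_ - _ *: _)); apply: eq_map_mx => x; exact: map_polyC.
Qed.

Lemma tf_conj n (A : 'M[R]_n) b c d (z : C) :
  tf A b c d (conjc z) = conjc (tf A b c d z).
Proof.
have conjmx_real m p (M : 'M[R]_(m, p)) : map_mx conjc (toCmx M) = toCmx M.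
  by apply/matrixP => i j; rewrite !mxE conjc_real.
rewrite /tf rmorphD; congr (_ + _); last by rewrite [RHS]conjc_real.
set M := (_ *m _ in RHS); transitivity ((map_mx conjc M) 0 0); last by rewrite mxE.
by rewrite /M !map_mxM map_invmx map_mxB map_scalar_mx -!map_trmx !conjmx_real.
Qed.

Lemma normc_conj (z : C) : Normc.normc (conjc z) = Normc.normc z.
Proof. by case: z => a b /=; rewrite sqrrN. Qed.
End Complexification.

(** * Invariant zeros as eigenvectors *)

Section NullDynamics.
Variables (R : realType) (n : nat).
Local Notation C := R[i].
Local Notation toC := (real_complex R).
Local Notation toCmx := (map_mx toC).

Variables (A B : 'M[R]_n) (b c beta r b1 : 'cV[R]_n) (d s d11 : R).
Hypothesis inv_sys :
  block_mx B r beta^T s%:M *m block_mx A^T c b^T d%:M = 1%:M.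

Let inv_sysC : block_mx (toCmx B) (toCmx r) (toCmx beta)^T (toC s)%:M *m
  block_mx (toCmx A)^T (toCmx c) (toCmx b)^T (toC d)%:M = 1%:M.
Proof.
have := congr1 (map_mx toC) inv_sys.
by rewrite map_mxM !map_block_mx !map_scalar_mx rmorph1 !map_trmx.
Qed.

Local Notation dist_vec := (dist_vec B beta b1 d11).
Local Notation supply := (supply B beta b1 d11).

Lemma zero_polyE :
  map_poly toC (zero_poly A b c d) =
  (toC (\det (block_mx A b c^T d%:M)))%:P * rev_char (toCmx B).
Proof.
by rewrite /zero_poly (det_system inv_sys) rmorphM /= map_polyC /= map_rev_char.
Qed.

Lemma det_sys_neq0 : \det (block_mx A b c^T d%:M) != 0.
Proof.
have [_] := mulmx1_unit inv_sys; rewrite unitmxE unitfE.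
by rewrite -det_tr tr_block_mx !trmxK tr_scalar_mx.
Qed.

Lemma zero_multE z : zero_mult A b c d z = mup z (rev_char (toCmx B)).
Proof.
rewrite /zero_mult zero_polyE mupMr // rootC fmorph_eq0; exact: det_sys_neq0.
Qed.

(** A left null vector [(p, q)] of the pencil at [z] satisfies [p = B (z p)] and
    [q = beta^T (z p)]. *)
Lemma invariant_zeroP z : invariant_zero A b c d z <->
  exists2 w : 'cV[C]_n, w != 0 & w = z *: (toCmx B *m w).
Proof.
have [e1 e2] := null_eqs inv_sysC.
rewrite /invariant_zero; set M := block_mx _ _ _ _.
have -> : (\rank M < n + 1)%N <-> exists2 u : 'rV_(n + 1), u != 0 & u *m M = 0.
  rewrite ltn_neqAle rank_leq_row andbT -[_ == _]/(row_free M) -kermx_eq0.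
  split=> [/rowV0Pn [u /sub_kermxP uM u0]|[u u0 uM]]; first by exists u.
  by apply/rowV0Pn; exists u => //; apply/sub_kermxP.
split=> [[u u0]|[w w0 Ew]].
  rewrite -[u]hsubmxK mul_row_block => /eqP; rewrite -row_mx0.
  move=> /eqP /eq_row_mx [/(congr1 trmx) + /(congr1 trmx)].
  rewrite !trmx0 !linearD /= !trmx_mul linearN /= !trmxK !tr_scalar_mx => E1 E2.
  set p := (lsubmx u)^T in E1 E2; set q := (rsubmx u)^T in E1 E2.
  have {}E1 : (toCmx A)^T *m p + toCmx c *m q = z *: p.
    by move/eqP: E1; rewrite mulNmx mul_scalar_mx addrAC subr_eq0 => /eqP.
  rewrite mul_scalar_mx in E2.
  have [Ep Eq] := null_solution inv_sysC E1 E2.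
  exists p; last by rewrite {1}Ep -scalemxAr.
  apply: contraNneq u0 => p0; rewrite -[u]hsubmxK -[lsubmx u]trmxK -/p p0.
  by rewrite -[rsubmx u]trmxK -/q Eq p0 scaler0 mulmx0 !trmx0 row_mx0.
exists (row_mx w^T (z *: ((toCmx beta)^T *m w)^T)).
  apply: contraNneq w0; rewrite -row_mx0 => /eq_row_mx [w0 _].
  by rewrite -[w]trmxK w0 trmx0.
rewrite mul_row_block -row_mx0; congr row_mx; apply: trmx_inj.
  rewrite trmx0 linearD /= !trmx_mul !trmxK linearB /= tr_scalar_mx linearZ /= trmx_mul !trmxK.
  rewrite -scalemxAr mulmxBl mul_scalar_mx {1}Ew -scalemxAr mulmxA addrAC.
  rewrite -scalerDr mulmxA -mulmxDl e1 mul1mx subrr //.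
rewrite trmx0 linearD /= !trmx_mul tr_scalar_mx linearZ /= !trmxK.
rewrite -scalemxAr {1}Ew -scalemxAr mul_scalar_mx -scalerDr mulmxA trmx_mul trmxK scalemxAl.
by rewrite -mulmxDl e2 mul0mx scaler0.
Qed.

Lemma hform_rank1 m (v : 'cV[R]_m) (w : 'cV[C]_m) :
  hform (toCmx (v *m v^T)) w w = `|((toCmx v)^T *m w) 0 0| ^+ 2.
Proof.
rewrite normCK mulrC; set x := (_ *m w) 0 0.
have Ex : (toCmx v)^T *m w = x%:M by rewrite [LHS]mx11_scalar.
rewrite /hform map_mxM -[toCmx v^T]map_trmx mulmxA -mulmxA Ex.
rewrite mul_mx_scalar mxE mulrC; congr (_ * _).
have -> : w^H *m toCmx v = ((toCmx v)^T *m w)^H.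
  by rewrite adjM map_trmx adj_real trmxK.
by rewrite Ex adj_scalar mxE eqxx mulr1n.
Qed.

Lemma hform_supply g (w : 'cV[C]_n) q G :
  (toCmx beta)^T *m w = q%:M -> (toCmx dist_vec)^T *m w = (q * G)%:M ->
  hform (toCmx (supply g)) w w = `|q| ^+ 2 * (toC g - (toC g)^-1 * `|G| ^+ 2).
Proof.
move=> Eq EG; rewrite /supply map_mxB !map_mxZ hformD hformN.
have hZ m (M : 'M[C]_m) a x : hform (a *: M) x x = a * hform M x x.
  by rewrite /hform -scalemxAr -scalemxAl mxE.
rewrite !hZ !hform_rank1 Eq EG !mxE eqxx !mulr1n normrM exprMn fmorphV /=; ring.
Qed.

(** Here [p = B w] solves [(z - A^T) p = q c], which makes [b1^T p + d11 q] equal to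
    [q] times the transfer function; [w] vanishes with [q]. *)
Lemma zero_eigenvector z (w : 'cV[C]_n) :
  ~~ eigenvalue (toCmx A) z -> w = z *: (toCmx B *m w) ->
  let q := ((toCmx beta)^T *m w) 0 0 in
  [/\ (toCmx beta)^T *m w = q%:M,
      (toCmx dist_vec)^T *m w = (q * tf A b1 c d11 z)%:M & (w != 0 -> q != 0)].
Proof.
move=> zA Ew q; have [e1 e2] := null_eqs inv_sysC.
have Eq : (toCmx beta)^T *m w = q%:M by rewrite [LHS]mx11_scalar.
pose p := toCmx B *m w.
have Mu : z%:M - toCmx A \in unitmx.
  move: zA; rewrite /eigenvalue negbK /eigenspace kermx_eq0 row_free_unit.
  by rewrite -opprB -scaleN1r unitmxZ ?unitrN1.
have Ep : p^T = q *: ((toCmx c)^T *m invmx (z%:M - toCmx A)).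
  rewrite scalemxAl; apply: (canRL (mulmxK Mu)); apply: trmx_inj.
  rewrite trmx_mul trmxK linearB /= tr_scalar_mx mulmxBl mul_scalar_mx -Ew.
  rewrite -{1}[w]mul1mx -e1 mulmxDl mulmxA addrAC subrr add0r -mulmxA Eq.
  by rewrite mul_mx_scalar linearZ /= trmxK.
split=> //.
- rewrite /dist_vec map_mxD linearD /= mulmxDl map_mxM trmx_mul -!map_trmx trmxK.
  rewrite map_mxZ linearZ /= -scalemxAl Eq -mulmxA -/p.
  have -> : (toCmx b1)^T *m p = (q * (tf A b1 c d11 z - toC d11))%:M.
    rewrite -[LHS]trmxK trmx_mul trmxK Ep -scalemxAl /tf addrK.
    by rewrite [X in _ *: X]mx11_scalar scale_scalar_mx tr_scalar_mx.
  by rewrite scale_scalar_mx -raddfD; congr (_%:M); rewrite mulrBr [toC d11 * q]mulrC subrK.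
- apply: contra_neq => q0; rewrite Ew -/p -[p]trmxK Ep q0 scale0r trmx0.
  by rewrite scaler0.
Qed.

(** The null vector at infinity has [p = 0]: the transfer function is replaced by its
    limit [d11]. *)
Lemma kernel_vector (w : 'cV[C]_n) : toCmx B *m w = 0 ->
  let q := ((toCmx beta)^T *m w) 0 0 in
  [/\ (toCmx beta)^T *m w = q%:M, w = q *: toCmx c,
      (toCmx dist_vec)^T *m w = (q * toC d11)%:M & toC d * q = 0].
Proof.
move=> Bw q; have [e1 e2] := null_eqs inv_sysC.
have Eq : (toCmx beta)^T *m w = q%:M by rewrite [LHS]mx11_scalar.
split=> //; first by rewrite -[LHS]mul1mx -e1 mulmxDl -!mulmxA Bw mulmx0 add0r Eq mul_mx_scalar.
- rewrite /dist_vec map_mxD linearD /= mulmxDl map_mxM trmx_mul -!map_trmx trmxK.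
  rewrite map_mxZ linearZ /= -scalemxAl Eq -mulmxA Bw mulmx0 add0r.
  by rewrite scale_scalar_mx mulrC.
- have := congr1 (mulmx^~ w) e2; rewrite mulmxDl -mulmxA Bw mulmx0 add0r mul0mx.
  by rewrite -scalemxAl Eq => /matrixP /(_ 0 0); rewrite !mxE eqxx mulr1n.
Qed.
End NullDynamics.

(** * The inequality in one of the two variables *)

Section Channel.
Variables (R : realType) (n : nat).
Local Notation C := R[i].
Local Notation toC := (real_complex R).
Local Notation toCmx := (map_mx toC).

Variables (A : 'M[R]_n) (b c b1 : 'cV[R]_n) (d d11 : R).
Variables (lam : seq C) (k : nat) (zs : k.-tuple C).
Variables (L : 'M[R]_k) (S : 'M[R]_(n, k)) (f : 'cV[R]_k).
Variable N : 'M[R]_(n + 1 + 1, n + 1 + 1 - \rank (lmi_perp_mx b d)).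
Hypothesis Np : is_perp N.
Hypothesis imag : imaginary_zeros A b c d lam.
Hypothesis not_eig : forall z, z \in lam ->
  ~~ eigenvalue (toCmx A) z /\ ~~ eigenvalue (toCmx A) (conjc z).
Hypothesis rhp : rhp_zeros A b c d zs.
Hypothesis data : rhp_null_data A b c d zs L S f.

Local Notation h := (S^T *m b1 + d11 *: f).
Local Notation G := (tf A b1 c d11).

(** The point [0] is not an invariant zero, so the system matrix is invertible. *)
Lemma system_unit : exists (B : 'M[R]_n) r beta s,
  block_mx B r beta^T s%:M *m block_mx A^T c b^T d%:M = 1%:M.
Proof.
set P := block_mx A^T c b^T d%:M.
have Pu : P \in unitmx.
  have [_ zsP zs0] := imag; rewrite -unitmx_tr -row_free_unit -(row_free_map toC).
  apply: contraT => Pn; suff z0 : 0 \in lam ++ map conjc lam.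
    by have [/eqP] := zs0 _ z0.
  apply/zsP; split=> //; rewrite /invariant_zero ltn_neqAle rank_leq_row andbT.
  move: Pn; rewrite /row_free /P tr_block_mx !trmxK tr_scalar_mx map_block_mx.
  by rewrite map_scalar_mx raddf0 subr0 map_trmx.
pose V := invmx P.
exists (ulsubmx V), (ursubmx V), (dlsubmx V)^T, (drsubmx V 0 0).
by rewrite trmxK -mx11_scalar submxK mulVmx.
Qed.

Lemma zs_pos z : z \in zs -> 0 < complex.Re z.
Proof. by rewrite -has_pred1 has_count rhp; case: ifP. Qed.

Lemma char_poly_null_data : map_poly toC (char_poly L) = \prod_(z <- zs) ('X - z%:P).
Proof. by case: data. Qed.

Lemma L_unit : L \in unitmx.
Proof.
rewrite unitmxE unitfE; apply/negP => /eqP L0.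
have := char_poly_det L; rewrite L0 mulr0 => /(congr1 toC).
rewrite rmorph0 -coef_map char_poly_null_data => /eqP; rewrite -horner_coef0 -rootE root_prod_XsubC.
by move/zs_pos; rewrite ltxx.
Qed.

Lemma zs_real z : off_axis_zeros_real A b c d -> z \in zs -> z = toC (complex.Re z).
Proof.
move=> off zz; have z0 := zs_pos zz; have [B [r [beta [s inv_sys]]]] := system_unit.
have : invariant_zero A b c d z.
  apply/(invariant_zeroP inv_sys)/rev_char_root_vec.
  rewrite -dvdp_XsubCl XsubC_dvd ?rev_char_neq0 // -(zero_multE inv_sys).
  by have := rhp z; rewrite z0 => <-; rewrite -has_count has_pred1.
by move=> /off /(_ (lt0r_neq0 z0)); case: z {zz z0} => x y /= ->.
Qed.

Lemma char_poly_null_data_real : off_axis_zeros_real A b c d ->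
  char_poly L = \prod_(x <- [seq complex.Re z | z <- zs]) ('X - x%:P).
Proof.
move=> off; apply: (@map_poly_inj _ _ toC); rewrite char_poly_null_data rmorph_prod big_map.
rewrite !big_seq; apply: eq_bigr => z zz.
by rewrite rmorphB /= map_polyX map_polyC /= -zs_real.
Qed.

Lemma Re_zs_pos x : x \in [seq complex.Re z | z <- zs] -> 0 < x.
Proof. by case/mapP => z /zs_pos ? ->. Qed.

Section InverseSystem.
Variables (B : 'M[R]_n) (r beta : 'cV[R]_n) (s : R).
Hypothesis inv_sys :
  block_mx B r beta^T s%:M *m block_mx A^T c b^T d%:M = 1%:M.
Local Notation supply := (supply B beta b1 d11).
Local Notation dist_vec := (dist_vec B beta b1 d11).
Local Notation SL := (S *m L).

Lemma null_data_B : B *m SL = S /\ beta^T *m SL = f^T.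
Proof.
have [_ _ _] := data; rewrite mul_row_block mul_mx_row mulmx0 mul_mx_scalar.
move=> /eq_row_mx [/(congr1 trmx) + /(congr1 trmx)].
rewrite trmx0 !linearD /= !trmx_mul !trmxK linearZ /= => E1 E2.
by have [<- <-] := null_solution inv_sys E1 E2.
Qed.

Lemma null_data_dist_vec : dist_vec^T *m SL = h^T.
Proof.
have [E1 E2] := null_data_B.
rewrite /dist_vec linearD linearZ /= trmx_mul trmxK mulmxDl -mulmxA E1 -scalemxAl E2.
by rewrite linearD linearZ /= trmx_mul trmxK.
Qed.

Lemma supply_null_data g :
  SL^T *m supply g *m SL = g *: (f *m f^T) - g^-1 *: (h *m h^T).
Proof.
have [_ E2] := null_data_B.
have outer (v : 'cV[R]_n) : SL^T *m (v *m v^T) *m SL = (v^T *m SL)^T *m (v^T *m SL).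
  by rewrite [in RHS]trmx_mul trmxK !mulmxA.
rewrite /supply mulmxBr mulmxBl -!scalemxAr -!scalemxAl !outer E2 null_data_dist_vec.
by rewrite !trmxK.
Qed.

Lemma S_inj : inj_cols S.
Proof.
have [E1 E2] := null_data_B; have [_ _ rk _] := data.
move=> y; rewrite -[y](mulKVmx L_unit); set u := invmx L *m y => Su.
have u0 : col_mx S f^T *m u = 0.
  rewrite mul_col_mx -E2 -{1}E1 -!mulmxA [S *m _]mulmxA -[S *m L *m u]mulmxA Su.
  by rewrite !mulmx0 col_mx0.
have /inj_colsP inj : row_free (col_mx S f^T)^T by rewrite /row_free mxrank_tr rk.
by rewrite (inj _ u0) mulmx0.
Qed.

(** The conjugate of an imaginary zero is again an imaginary zero, represented in
    [lam] by one of the two. *)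
Lemma imaginary_eigenvector z : complex.Re z = 0 ->
  (exists2 w : 'cV[C]_n, w != 0 & w = z *: (toCmx B *m w)) ->
  [/\ ~~ eigenvalue (toCmx A) z, (mup z (rev_char (toCmx B)) <= 1)%N
    & exists2 z', z' \in lam & z = z' \/ z = conjc z'].
Proof.
move=> z0 /(invariant_zeroP inv_sys) iz; have [_ zsP zs1] := imag.
have zin : z \in lam ++ map conjc lam by apply/zsP.
have [_] := zs1 _ zin; rewrite (zero_multE inv_sys) => ->.
move: zin; rewrite mem_cat => /orP[zl|/mapP[z' zl ->]].
- by have [? _] := not_eig zl; split=> //; exists z => //; left.
- by have [_ ?] := not_eig zl; split=> //; exists z' => //; right.
Qed.

Lemma channel_lower_inv g X : 0 < g -> X^T = X ->
  psdmx (supply g - (B^T *m X + X *m B)) ->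
  let Z := S^T *m X *m S in
  [/\ psdmx (g *: (f *m f^T) - g^-1 *: (h *m h^T) - (L^T *m Z + Z *m L)),
      forall z, z \in lam -> Normc.normc (G z) <= g & d = 0 -> `|d11| <= g].
Proof.
move=> g0 Xs Hp Z.
(* on a vector where the terms in [X] cancel, only the supply is left *)
have bound (w : 'cV[C]_n) q x : q != 0 ->
    (forall v, hform (toCmx (B^T *m X + X *m B)) w w = v -> v = 0) ->
    (toCmx beta)^T *m w = q%:M -> (toCmx dist_vec)^T *m w = (q * x)%:M ->
    Normc.normc x <= g.
  move=> q0 h0 Eq EG; have := psdmx_hform w Hp.
  rewrite map_mxB hformD hformN (h0 _ (erefl _)) subr0 (hform_supply _ Eq EG).
  rewrite pmulr_rge0 ?exprn_gt0 ?normr_gt0 // subr_ge0.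
  have gC : 0 < toC g by rewrite (ltcR 0).
  rewrite mulrC ler_pdivrMr // -expr2 ler_sqr ?nnegrE ?normr_ge0 ?(ltW gC) //.
  by rewrite -lecR.
have swap w : hform (toCmx (B^T *m X + X *m B)) w w =
    hform (toCmx X) (toCmx B *m w) w + hform (toCmx X) w (toCmx B *m w).
  by rewrite map_mxD hformD !map_mxM -adj_real hform_mull hform_mulr.
split.
- have := psdmx_cong SL Hp; rewrite mulmxBr mulmxBl supply_null_data.
  have [E1 _] := null_data_B.
  suff -> : SL^T *m (B^T *m X + X *m B) *m SL = L^T *m Z + Z *m L by [].
  have E1' : SL^T *m B^T = S^T by rewrite -trmx_mul E1.
  rewrite mulmxDr mulmxDl -!mulmxA E1 [SL^T *m (B^T *m _)]mulmxA E1' addrC.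
  by rewrite trmx_mul /Z -!mulmxA.
- move=> z zl; have [_ zsP zs1] := imag.
  have zin : z \in lam ++ map conjc lam by rewrite mem_cat zl.
  have [iz rz] := (zsP z).1 zin; have [zn _] := zs1 z zin.
  have [w w0 Ew] := (invariant_zeroP inv_sys z).1 iz.
  have [za _] := not_eig zl.
  have [Eq EG q0] := zero_eigenvector b1 d11 inv_sys za Ew.
  apply: (bound w _ (G z) (q0 w0)) Eq EG => v <-; rewrite swap.
  have -> : toCmx B *m w = z^-1 *: w by rewrite {2}Ew scalerA mulVf ?scale1r.
  rewrite hformZl hformZr -mulrDl.
  suff -> : (z^-1)^* + z^-1 = 0 by rewrite mul0r.
  apply/eqP; have : 'Re z^-1 == 0 by rewrite ReV -complexRe rz rmorph0 mul0r.
  by rewrite ReE mulf_eq0 invr_eq0 pnatr_eq0 orbF addrC.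
- move=> d0; have [e1 e2] := null_eqs inv_sys.
  have [Bc bc] : 0 = B *m c /\ 1%:M = beta^T *m c.
    by apply: (null_solution inv_sys); rewrite ?d0 mulmx0 ?mulmx1 ?add0r ?scale0r ?addr0.
  have Eq : (toCmx beta)^T *m toCmx c = 1%:M by rewrite map_trmx -map_mxM -bc map_mx1.
  have -> : `|d11| = Normc.normc (toC d11) by rewrite /= expr0n addr0 sqrtr_sqr.
  apply: (bound (toCmx c) 1 _ (oner_neq0 _) _ Eq).
  + by move=> v <-; rewrite swap -map_mxM -Bc map_mx0 hform0l hform0r addr0.
  + rewrite map_trmx -map_mxM /dist_vec linearD /= mulmxDl trmx_mul trmxK -mulmxA -Bc.
    by rewrite mulmx0 add0r linearZ /= -scalemxAl -bc scalemx1 map_scalar_mx mul1r.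
Qed.

Lemma channel_upper_inv g (Z : 'M[R]_k) (Lb : 'M[R]_n) : 0 < g ->
  (forall z, z \in lam -> Normc.normc (G z) < g) -> (d = 0 -> `|d11| < g) ->
  pdmx (g *: (f *m f^T) - g^-1 *: (h *m h^T) - (L^T *m Z + Z *m L)) ->
  Z^T = Z -> Lb^T = Lb -> pdmx (Z - S^T *m Lb *m S) ->
  exists X : 'M[R]_n, [/\ X^T = X,
    psdmx (supply g - (B^T *m X + X *m B)) & psdmx (X - Lb)].
Proof.
move=> g0 Gz Gi Dp Zs Lbs Ep.
pose Bc := toCmx B; pose Q := toCmx (supply g); pose M := toCmx (invmx L).
have Qh : Q^H = Q.
  have oT (v : 'cV[R]_n) : (v *m v^T)^T = v *m v^T by rewrite trmx_mul trmxK.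
  by rewrite adj_real /supply linearB /= !linearZ /= !oT scalerN.
have Lh : (toCmx Lb)^H = toCmx Lb by rewrite adj_real Lbs.
have Zh : (toCmx Z)^H = toCmx Z by rewrite adj_real Zs.
have [E1 E2] := null_data_B.
have BS : Bc *m toCmx S = toCmx S *m M.
  by rewrite -!map_mxM -{2}E1 -!mulmxA mulmxV ?L_unit // mulmx1.
have S_free : inj_cols (toCmx S).
  by apply/inj_colsP; rewrite map_trmx row_free_map; apply/inj_colsP; exact: S_inj.
have bound (w : 'cV[C]_n) q x : q != 0 -> Normc.normc x < g ->
    (toCmx beta)^T *m w = q%:M -> (toCmx dist_vec)^T *m w = (q * x)%:M ->
    0 < hform Q w w.
  move=> q0 xg Eq EG; rewrite (hform_supply _ Eq EG).
  rewrite pmulr_rgt0 ?exprn_gt0 ?normr_gt0 // subr_gt0.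
  have gC : 0 < toC g by rewrite (ltcR 0).
  rewrite mulrC ltr_pdivrMr // -expr2 ltr_sqr ?nnegrE ?normr_ge0 ?(ltW gC) //.
  by rewrite ltcR.
have Re0 z : 'Re z = 0 -> complex.Re z = 0.
  by rewrite -complexRe => /eqP; rewrite fmorph_eq0 => /eqP.
have simple z : 'Re z = 0 -> (mup z (rev_char Bc) <= 1)%N.
  move=> /Re0 rz; rewrite leqNgt; apply/negP => gt1; move: (gt1).
  move=> /ltnW; rewrite -XsubC_dvd ?rev_char_neq0 //.
  rewrite dvdp_XsubCl => /rev_char_root_vec.
  by case/(imaginary_eigenvector rz) => _; rewrite leqNgt gt1.
have ker (w w' : 'cV[C]_n) : Bc *m w = 0 -> Bc *m w' = 0 -> w != 0 ->
    exists x, w' = x *: w.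
  move=> /(kernel_vector b1 d11 inv_sys) [_ Ew _ _].
  move=> /(kernel_vector b1 d11 inv_sys) [_ Ew' _ _] w0.
  rewrite Ew'; rewrite Ew in w0 *.
  set q := (_ 0 0) in w0 *; set q' := (_ 0 0).
  exists (q' / q); rewrite scalerA divfK //.
  by apply: contraNneq w0 => ->; rewrite scale0r.
have pos a (w : 'cV[C]_n) : 'Re a = 0 -> w != 0 -> Bc *m w = a *: w -> 0 < hform Q w w.
  move=> ra w0 Bw; have [a0|a0] := eqVneq a 0.
    move: Bw; rewrite a0 scale0r => /(kernel_vector b1 d11 inv_sys) [Eq Ew Ee Ed].
    set q := (_ 0 0) in Eq Ew Ee Ed.
    have q0 : q != 0 by apply: contraNneq w0 => q0; rewrite Ew q0 scale0r.
    apply: (bound w _ _ q0) Eq Ee; rewrite /= expr0n addr0 sqrtr_sqr; apply: Gi.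
    by move/eqP: Ed; rewrite mulf_eq0 (negPf q0) orbF fmorph_eq0 => /eqP.
  have Ew : w = a^-1 *: (Bc *m w) by rewrite Bw scalerA mulVf ?scale1r.
  have rz : complex.Re a^-1 = 0 by apply: Re0; rewrite ReV ra mul0r.
  have [zA _ [z' zl zz']] : [/\ ~~ eigenvalue (toCmx A) a^-1,
      (mup a^-1 (rev_char Bc) <= 1)%N
      & exists2 z', z' \in lam & a^-1 = z' \/ a^-1 = conjc z'].
    by apply: imaginary_eigenvector => //; exists w.
  have [Eq EG q0] := zero_eigenvector b1 d11 inv_sys zA Ew.
  apply: (bound w _ _ (q0 w0)) Eq EG.
  by case: zz' => ->; rewrite ?tf_conj ?normc_conj Gz.
have anti z : 0 < 'Re z -> (mup z (rev_char Bc) <= mup z (rev_char M))%N.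
  rewrite -complexRe (ltcR 0) => rz; rewrite -(zero_multE inv_sys).
  have := rhp z; rewrite rz => <-; rewrite -mu_prod_XsubC -char_poly_null_data.
  apply: leq_mup; first exact: rev_char_neq0.
  have Lpu : map_mx polyC (invmx L) *m map_mx polyC L = 1%:M.
    by rewrite -map_mxM mulVmx ?L_unit // map_mx1.
  have -> : rev_char M = map_poly toC (rev_char (invmx L)) by rewrite map_rev_char.
  rewrite dvdp_map; apply/dvdpP; exists (\det (- map_mx polyC (invmx L))).
  rewrite /char_poly -det_mulmx /rev_char; congr (\det _).
  by rewrite /char_poly_mx mulmxBr !mulNmx opprK Lpu mul_mx_scalar addrC.
have Lcu : toCmx L \in unitmx by rewrite map_unitmx L_unit.
have Dp' : hpd (lyap_defect Q (toCmx S) M (toCmx Z)).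
  apply: (hpd_cong Lcu).
  suff -> : (toCmx L)^H *m lyap_defect Q (toCmx S) M (toCmx Z) *m toCmx L =
     toCmx (g *: (f *m f^T) - g^-1 *: (h *m h^T) - (L^T *m Z + Z *m L)).
    exact: pdmx_hpd.
  rewrite /lyap_defect !adj_real -!map_mxM -map_mxD -map_mxB -!map_mxM.
  congr (map_mx _ _); rewrite -supply_null_data mulmxBr mulmxBl mulmxDr mulmxDl.
  rewrite trmx_mul -!mulmxA mulVmx ?L_unit // mulmx1.
  rewrite [L^T *m ((invmx L)^T *m _)]mulmxA -(trmx_mul (invmx L)) mulVmx ?L_unit //.
  by rewrite trmx1 mul1mx [Z *m L + _]addrC.
have Ep' : hpd (excess (toCmx Lb) (toCmx S) (toCmx Z)).
  by rewrite /excess adj_real -!map_mxM -map_mxB; apply: pdmx_hpd.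
have [X [Xh XQ XL]] :=
  lyapunov_inequality Qh Lh simple ker pos S_free BS Zh anti Dp' Ep'.
exists (map_mx (@complex.Re R) X); split; first exact: Remx_adj.
- have := hpd_Remx XQ; rewrite RemxD RemxN RemxD adj_real Remx_mulr Remx_mull.
  by rewrite Remx_real.
- by have := hpd_Remx XL; rewrite RemxD RemxN Remx_real.
Qed.
End InverseSystem.

(** A stabilizing feedback cannot move a mode [S x] that the input does not
    reach, so an antistable null vector has a nonzero input component. *)
Lemma null_data_observable : stabilizable A b ->
  forall a (x : 'cV[R]_k), x != 0 -> 0 < a -> L *m x = a *: x -> f^T *m x != 0.
Proof.
move=> [K hK] a x x0 a0 Lx; apply: contra_ltN a0 => /eqP fx.
have [B [r [beta [s inv_sys]]]] := system_unit.
have Sx : S *m x != 0 by apply: contra_neq x0; exact: (S_inj inv_sys).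
have [_ _ _] := data; rewrite mul_row_block mul_mx_row mulmx0 mul_mx_scalar.
move=> /eq_row_mx [/(congr1 trmx) + /(congr1 trmx)].
rewrite trmx0 !linearD /= !trmx_mul !trmxK linearZ /= => E1 E2.
have {}E1 : A^T *m (S *m x) = a *: (S *m x).
  have := congr1 (mulmx^~ x) E1; rewrite mulmxDl -!mulmxA fx mulmx0 addr0 Lx.
  by rewrite scalemxAr.
have {}E2 : b^T *m (S *m x) = 0.
  have := congr1 (mulmx^~ x) E2; rewrite mulmxDl -scalemxAl fx scaler0 addr0.
  by rewrite mul0mx mulmxA.
have /hK : eigenvalue (toCmx (A + b *m K)) (toC a).
  rewrite eigenvalue_map; apply/eigenvalueP; exists (S *m x)^T.
    apply: trmx_inj; rewrite trmx_mul linearZ /= trmxK linearD /= mulmxDl E1.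
    by rewrite trmx_mul -mulmxA E2 mulmx0 addr0.
  by rewrite -trmx0 (inj_eq (@trmx_inj _ _ _)).
exact: ltW.
Qed.

(** On the range of [S L] the matrix [B] acts as [L^-1], so the congruence by [S L]
    turns the inequality into a Lyapunov inequality for [Z]. On an eigenvector of [B]
    for an imaginary eigenvalue the terms in [X] cancel, and the sign of the supply
    compares [|G z|] with [g]. *)
Theorem channel_lower g X : 0 < g -> X^T = X ->
  psdmx (- (N^T *m lmi_control_mx A b1 c d11 g X *m N)) ->
  let Z := S^T *m X *m S in
  [/\ psdmx (g *: (f *m f^T) - g^-1 *: (h *m h^T) - (L^T *m Z + Z *m L)),
      forall z, z \in lam -> Normc.normc (G z) <= g & d = 0 -> `|d11| <= g].
Proof.
move=> g0 Xs; have [B [r [beta [s inv_sys]]]] := system_unit.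
move=> /(lmi_control_lyapunov b1 d11 inv_sys Xs Np g0).
exact: (channel_lower_inv inv_sys g0 Xs).
Qed.

(** Apply [lyapunov_inequality] from the antistable invariant subspace, where [Z]
    prescribes [X]; the real part of the Hermitian solution satisfies the same real
    inequalities. *)
Theorem channel_upper g (Z : 'M[R]_k) (Lb : 'M[R]_n) : 0 < g ->
  (forall z, z \in lam -> Normc.normc (G z) < g) -> (d = 0 -> `|d11| < g) ->
  pdmx (g *: (f *m f^T) - g^-1 *: (h *m h^T) - (L^T *m Z + Z *m L)) ->
  Z^T = Z -> Lb^T = Lb -> pdmx (Z - S^T *m Lb *m S) ->
  exists X : 'M[R]_n, [/\ X^T = X,
    psdmx (- (N^T *m lmi_control_mx A b1 c d11 g X *m N)) & psdmx (X - Lb)].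
Proof.
move=> g0 Gz Gi Dp Zs Lbs Ep; have [B [r [beta [s inv_sys]]]] := system_unit.
have [X [Xs XQ XL]] := channel_upper_inv inv_sys g0 Gz Gi Dp Zs Lbs Ep.
by exists X; split=> //; apply/(lmi_control_lyapunov b1 d11 inv_sys Xs Np g0).
Qed.
End Channel.

(** * The scalar functions [v^T e^{-t L} a] *)

Section MatrixExponential.
Local Open Scope classical_set_scope.
Local Open Scope ring_scope.
Variables (R : realType) (k : nat) (L : 'M[R]_k).
Implicit Types (v a : 'cV[R]_k).

(** Taylor coefficients of [t |-> v^T e^{-t L} a]. *)
Definition phi_coef v a (m : nat) : R :=
  (-1) ^+ m * (v^T *m (L ^+ m) *m a) 0 0 / m`!%:R.

Definition phi v a (t : R) : R := limn (pseries (phi_coef v a) t).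

Let nrm a : R := \sum_i `|a i 0|.
Let alpha : R := \sum_i \sum_j `|L i j|.

Lemma phi_coef_bound v a m : `|(v^T *m (L ^+ m) *m a) 0 0| <= nrm v * alpha ^+ m * nrm a.
Proof.
elim: m a => [|m IH] a.
  rewrite expr0 mulmx1 mulr1 mxE (le_trans (ler_norm_sum _ _ _)) // /nrm mulr_suml.
  apply: ler_sum => i _; rewrite normrM mxE ler_wpM2l //.
  by rewrite (bigD1 i) //= lerDl sumr_ge0.
rewrite exprSr mulmxA -mulmxA; apply: (le_trans (IH (L *m a))).
rewrite exprSr -!mulrA ler_wpM2l ?sumr_ge0 // ler_wpM2l ?exprn_ge0 ?sumr_ge0 //.
  by move=> i _; rewrite sumr_ge0.
rewrite /alpha mulr_suml /nrm; apply: ler_sum => i _.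
rewrite mxE (le_trans (ler_norm_sum _ _ _)) // mulr_suml.
apply: ler_sum => j _; rewrite normrM ler_wpM2l // (bigD1 j) //= lerDl sumr_ge0 //.
Qed.

Lemma phi_cvg v a t : cvgn (pseries (phi_coef v a) t).
Proof.
apply: normed_cvg; pose C := nrm v * nrm a.
have C0 : 0 <= C by rewrite mulr_ge0 // sumr_ge0.
apply: (@series_le_cvg _ _ (C *: exp_coeff (alpha * `|t|))) => [m|m|m|].
- by rewrite /= normr_ge0.
- apply: mulr_ge0 => //; rewrite /exp_coeff /= divr_ge0 // exprn_ge0 // mulr_ge0 //.
  by rewrite sumr_ge0 // => i _; rewrite sumr_ge0.
- rewrite /phi_coef [X in X <= _]/= !normrM normfV normrX normrN1 expr1n mul1r.
  rewrite normrX [`|_%:R|]ger0_norm //.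
  have -> : (C *: exp_coeff (alpha * `|t|)) m =
      nrm v * alpha ^+ m * nrm a / m`!%:R * `|t| ^+ m.
    rewrite -[LHS]/(C * ((alpha * `|t|) ^+ m / m`!%:R)) exprMn /C; ring.
  by rewrite ler_wpM2r ?exprn_ge0 // ler_wpM2r ?invr_ge0 // phi_coef_bound.
- by apply: is_cvg_seriesZ; exact: is_cvg_series_exp_coeff.
Qed.

Lemma phi_coefD v a a' x m :
  phi_coef v (x *: a + a') m = x * phi_coef v a m + phi_coef v a' m.
Proof. by rewrite /phi_coef mulmxDr -scalemxAr mxE mxE; ring. Qed.

Lemma phi_lin v a a' x t : phi v (x *: a + a') t = x * phi v a t + phi v a' t.
Proof.
rewrite /phi; have -> : pseries (phi_coef v (x *: a + a')) t =
    series (x *: (fun i => phi_coef v a i * t ^+ i) + (fun i => phi_coef v a' i * t ^+ i)).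
  by rewrite /pseries; congr series; apply/funext => i /=; rewrite phi_coefD mulrDl -mulrA.
have ca := @phi_cvg v a t; have ca' := @phi_cvg v a' t.
rewrite lim_seriesD //; last exact: is_cvg_seriesZ.
by rewrite lim_seriesZ.
Qed.

Lemma phiZ v a x t : phi v (x *: a) t = x * phi v a t.
Proof.
have := phi_lin v a 0 x t; rewrite addr0 => ->.
have := phi_lin v 0 0 0 t; rewrite scaler0 addr0 mul0r add0r => E.
suff -> : phi v 0 t = 0 by rewrite addr0.
have := phi_lin v 0 0 1 t; rewrite scaler0 addr0 mul1r => /eqP.
by rewrite -subr_eq subrr eq_sym => /eqP.
Qed.

(** Termwise differentiation shifts the coefficients into those of [- L a]. *)
Lemma phi_deriv v a t : is_derive t (1 : R) (phi v a) (- phi v (L *m a) t).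
Proof.
have diffs a' : pseries_diffs (phi_coef v a') = phi_coef v (- 1 *: (L *m a')).
  apply/funext => m; rewrite /pseries_diffs /phi_coef exprS exprSr.
  rewrite -[L ^+ m * L]/(L ^+ m *m L) -scalemxAr !mulmxA factS natrM.
  have sc (x : R) (M : 'M[R]_1) : (x *: M) 0 0 = x * M 0 0 by rewrite mxE.
  rewrite sc.
  have m1 : m.+1%:R != 0 :> R by rewrite pnatr_eq0.
  have m2 : m`!%:R != 0 :> R by rewrite pnatr_eq0 -lt0n fact_gt0.
  by field; rewrite m2 -natr1 addrC in m1 *; rewrite m1.
have -> : - phi v (L *m a) t = limn (pseries (pseries_diffs (phi_coef v a)) t).
  by rewrite diffs -/(phi v _ t) phiZ mulN1r.
apply: (@pseries_snd_diffs _ (phi_coef v a) (`|t| + 1)).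
- exact: phi_cvg.
- by rewrite diffs; exact: phi_cvg.
- by rewrite !diffs; exact: phi_cvg.
- by rewrite [ltRHS]ger0_norm ?addr_ge0 // ltrDl.
Qed.

(** Identifies the power series with the entrywise defined exponential, by exchanging
    the finite sum and the limit. *)
Lemma expmx_phi v a t (j : 'I_k) :
  (v^T *m expmx (- t *: L)) 0 j = phi v (delta_mx j 0) t.
Proof.
have entry i : expmx (- t *: L) i j = phi (delta_mx i 0) (delta_mx j 0) t.
  rewrite mxE /phi; congr (limn (series _)); apply/funext => m /=.
  have -> : (- t *: L) ^+ m = (- t) ^+ m *: L ^+ m.
    elim: m => [|m IH]; first by rewrite !expr0 scale1r.
    by rewrite !exprS IH -[_ * _]/(_ *m _) -scalemxAl -scalemxAr scalerA.
  rewrite mxE /phi_coef trmx_delta -rowE -colE !mxE [(- t) ^+ m]exprNn; ring.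
rewrite mxE.
have -> : \sum_l v^T 0 l * expmx (- t *: L) l j =
     \sum_l v l 0 * phi (delta_mx l 0) (delta_mx j 0) t.
  by apply: eq_bigr => l _; rewrite entry mxE.
rewrite {1}/phi.
have -> : phi v (delta_mx j 0) t =
    limn (\sum_l v l 0 *: pseries (phi_coef (delta_mx l 0) (delta_mx j 0)) t).
  rewrite /phi; congr (limn _); apply/funext => m.
  rewrite /pseries /series /= fct_sumE; rewrite [RHS](eq_bigr
    (fun l => \sum_(0 <= p < m)
       v l 0 * (phi_coef (delta_mx l 0) (delta_mx j 0) p * t ^+ p))); last first.
    by move=> l _; rewrite -mulr_sumr.
  rewrite exchange_big /=; apply: eq_bigr => i _.
  under eq_bigr => l _ do rewrite mulrA; rewrite -mulr_suml; congr (_ * _).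
  rewrite /phi_coef; rewrite {1}(matrix_sum_delta v^T) big_ord1.
  rewrite !mulmx_suml summxE mulr_sumr mulr_suml; apply: eq_bigr => l _.
  by rewrite -!scalemxAl mxE !trmx_delta mxE; ring.
apply/esym/cvg_lim => //.
apply: (big_ind2 (fun (u : R^nat) (y : R) => u @ \oo --> y)) => [|u y u' y'|l _].
- exact: cvg_cst.
- exact: cvgD.
- by apply: cvgZl_tmp; exact: phi_cvg.
Qed.

Lemma phi0 v a : phi v a 0 = (v^T *m a) 0 0.
Proof.
apply: cvg_lim => //; apply: cvg_near_cst; near=> m.
have m0 : (0 < m)%N by near: m; exists 1%N.
rewrite /pseries /series /= (bigD1_seq 0%N) ?mem_index_iota ?iota_uniq //=.
rewrite /phi_coef !expr0 mulmx1 mul1r fact0 divr1 mulr1 big1 ?addr0 // => i i0.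
by rewrite expr0n (negPf i0) mulr0.
Unshelve. all: by end_near. Qed.
End MatrixExponential.

(** * The fundamental theorem of calculus for decaying functions *)

Section ExponentialDecay.
Local Open Scope classical_set_scope.
Local Open Scope ring_scope.
Variable R : realType.
Implicit Types (f F : R -> R).

Lemma is_derive_scale F (m t f : R) : is_derive t (1 : R) F f ->
  is_derive t (1 : R) (fun x => m * F x) (m * f).
Proof. by move=> h; exact: (is_deriveZ m h). Qed.

Lemma is_derive_expRM (c t : R) :
  is_derive t (1 : R) (fun x => expR (c * x)) (c * expR (c * t)).
Proof.
have H : is_derive t (1 : R) (fun x => c * x) c.
  by rewrite -[X in is_derive _ _ _ X]mulr1; apply: is_derive_scale.
have := @is_derive1_comp _ expR (fun x => c * x) t _ _ (is_derive_expR _) H.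
by rewrite mulrC.
Qed.

Lemma derive_continuous F f : (forall t, is_derive t (1 : R) F (f t)) -> continuous F.
Proof.
move=> dF t; apply: differentiable_continuous; apply/derivable1_diffP.
by have [] := dF t.
Qed.

Lemma expRM_continuous (c : R) : continuous (fun x : R => expR (c * x)).
Proof. by apply: derive_continuous => t; exact: is_derive_expRM. Qed.

Lemma derive_nincr F f : (forall t, is_derive t (1 : R) F (f t)) ->
  (forall t, 0 <= t -> f t <= 0) -> forall t, 0 <= t -> F t <= F 0.
Proof.
move=> dF f0 t t0; apply: (@ler0_derive1_nincry _ F 0) => // [x|].
- rewrite in_itv /= andbT => /ltW x0; rewrite derive1E.
  by have [_ ->] := dF x; exact: f0.
- by apply: continuous_subspaceT; exact: derive_continuous dF.
Qed.

Lemma expRM_cvg0 (c : R) : 0 < c -> expR (- c * x) @[x --> +oo] --> (0 : R).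
Proof.
move=> c0; have -> : (fun x => expR (- c * x)) = (fun y => expR (- y)) \o (fun x => c * x).
  by apply/funext => x /=; rewrite mulNr.
apply: cvg_comp; last exact: cvgr_expR.
by apply/cvgryPge => A; near=> x; rewrite -ler_pdivrMl //; near: x; exact: nbhs_pinfty_ge.
Unshelve. all: by end_near. Qed.

Local Notation mu := lebesgue_measure.

Lemma ge0_decay_FTC F f : (forall t, is_derive t (1 : R) F (f t)) ->
  continuous f -> (forall t, 0 <= t -> 0 <= f t) -> F x @[x --> +oo] --> (0 : R) ->
  (\int[mu]_(t in `[0%R, +oo[) (f t)%:E = (- F 0)%:E)%E.
Proof.
move=> dF cf f0 F0.
rewrite (@ge0_continuous_FTC2y _ f F 0 0) ?sub0e // => [||x _].
- exact: continuous_subspaceT.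
- by apply: cvg_at_right_filter; exact: derive_continuous dF _.
- by rewrite derive1E; have [_ ->] := dF x.
Qed.

Lemma expRM_integrable (K c : R) : 0 < c -> 0 <= K ->
  mu.-integrable `[0, +oo[ (EFin \o (fun t => K * expR (- c * t)))
  /\ \int[mu]_(t in `[0, +oo[) (K * expR (- c * t)) = K / c.
Proof.
move=> c0 K0; pose E t := K * expR (- c * t); pose F t := - (K / c) * expR (- c * t).
have cE : continuous E.
  by move=> t; apply: cvgM; [exact: cvg_cst|exact: expRM_continuous].
have dF t : is_derive t (1 : R) F (E t).
  have -> : E t = - (K / c) * (- c * expR (- c * t)) by rewrite /E; field; rewrite gt_eqF.
  exact: is_derive_scale (is_derive_expRM _ _).
have F0 : F x @[x --> +oo] --> (0 : R).
  rewrite -(mulr0 (- (K / c))); apply: cvgM; [exact: cvg_cst|exact: expRM_cvg0].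
have E0 t : 0 <= E t by rewrite mulr_ge0 // expR_ge0.
have IE : (\int[mu]_(t in `[0%R, +oo[) (E t)%:E = (K / c)%:E)%E.
  by rewrite (ge0_decay_FTC dF cE) // /F mulr0 expR0 mulr1 opprK.
split; last by rewrite /Rintegral IE.
apply/integrableP; split.
  apply/measurable_EFinP; apply: measurable_funTS; exact: continuous_measurable_fun.
rewrite [ltLHS](_ : _ = (K / c)%:E) ?ltry // -IE.
by apply: eq_integral => t _ /=; rewrite ger0_norm // E0.
Qed.

(** Adding a dominating exponential reduces the fundamental theorem on the half
    line to integrands of constant sign. *)
Lemma decay_FTC F f (K c : R) : 0 < c -> 0 <= K ->
  (forall t, is_derive t (1 : R) F (f t)) -> continuous f ->
  (forall t, 0 <= t -> `|f t| <= K * expR (- c * t)) ->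
  (forall t, 0 <= t -> `|F t| <= K * expR (- c * t)) ->
  mu.-integrable `[0, +oo[ (EFin \o f) /\
  \int[mu]_(t in `[0, +oo[) f t = - F 0.
Proof.
move=> c0 K0 dF cf bf bF; have [intE IE] := expRM_integrable c0 K0.
pose E t := K * expR (- c * t).
have cE : continuous E by move=> t; apply: cvgM; [exact: cvg_cst|exact: expRM_continuous].
have mf : measurable_fun (`[0%R, +oo[ : set R) f.
  by apply: measurable_funTS; exact: continuous_measurable_fun.
have intf : mu.-integrable `[0, +oo[ (EFin \o f).
  apply: (le_integrable _ _ _ intE) => //; first exact/measurable_EFinP.
  move=> t /=; rewrite in_itv /= andbT => t0; rewrite lee_fin.
  by apply: (le_trans (bf _ t0)); exact: ler_norm.
split=> //.
have dFE t : is_derive t (1 : R) (fun x => F x + - (K / c) * expR (- c * x)) (f t + E t).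
  apply: is_deriveD.
  have -> : E t = - (K / c) * (- c * expR (- c * t)) by rewrite /E; field; rewrite gt_eqF.
  exact: is_derive_scale (is_derive_expRM _ _).
have cfE : continuous (fun t => f t + E t) by move=> t; apply: cvgD; [exact: cf|exact: cE].
have e0 : expR (- c * x) @[x --> +oo] --> (0 : R) by exact: expRM_cvg0.
have F0 : F x @[x --> +oo] --> (0 : R).
  apply: norm_cvg0; apply: (@squeeze_cvgr _ _ _ _ (cst 0) (fun t => K * expR (- c * t))).
  - near=> t; rewrite normr_ge0 /=; apply: bF; near: t; exact: nbhs_pinfty_ge.
  - exact: cvg_cst.
  - by rewrite -(mulr0 K); apply: cvgM => //; exact: cvg_cst.
have := ge0_decay_FTC dFE cfE.
have fE0 t : 0 <= t -> 0 <= f t + E t.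
  by move=> /bf; rewrite ler_norml => /andP[]; rewrite lerNl -subr_ge0 opprK addrC.
have cv : F x + - (K / c) * expR (- c * x) @[x --> +oo] --> (0 : R).
  rewrite -[0]addr0 -{2}(mulr0 (- (K / c))); apply: cvgD => //.
  by apply: cvgM => //; exact: cvg_cst.
move=> /(_ fE0 cv) /(congr1 fine) /=; rewrite -[LHS]/(\int[mu]_(t in `[0, +oo[) (f t + E t)).
rewrite RintegralD // IE mulr0 expR0 mulr1 => /eqP.
by rewrite opprD opprK (inj_eq (addIr _)) => /eqP.
Unshelve. all: by end_near. Qed.
End ExponentialDecay.

(** * The Lyapunov equation of the gramian *)

Section Gramian.
Local Open Scope classical_set_scope.
Local Open Scope ring_scope.
Variables (R : realType) (k : nat) (L : 'M[R]_k) (s : seq R).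
Hypothesis char_split : char_poly L = \prod_(a <- s) ('X - a%:P).
Hypothesis s_pos : forall a, a \in s -> 0 < a.
Implicit Types (v a : 'cV[R]_k).

Local Notation phi := (phi L).
Local Notation mu := lebesgue_measure.

Lemma phiD v a a' t : phi v (a + a') t = phi v a t + phi v a' t.
Proof. by have := phi_lin L v a a' 1 t; rewrite scale1r mul1r. Qed.

Lemma phi_shift_upper v a (l delta K : R) : 0 < delta < l -> 0 <= K ->
  (forall t, 0 <= t -> `|phi v (L *m a - l *: a) t| <= K * expR (- delta * t)) ->
  forall t, 0 <= t -> phi v a t <= (`|phi v a 0| + K / (l - delta)) * expR (- delta * t).
Proof.
move=> /andP[d0 dl] K0 bnd t t0; have ld : 0 < l - delta by rewrite subr_gt0.
(* [e^{l t} phi a] has derivative [- e^{l t} phi (L a - l a)], which the exponential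
   term of [F] dominates *)
pose F x := expR (l * x) * phi v a x + - (K / (l - delta)) * expR ((l - delta) * x).
pose f x := - expR (l * x) * phi v (L *m a - l *: a) x - K * expR ((l - delta) * x).
have dF x : is_derive x (1 : R) F (f x).
  have -> : f x = (expR (l * x) * (- phi v (L *m a) x) + phi v a x * (l * expR (l * x)))
       + (- (K / (l - delta)) * ((l - delta) * expR ((l - delta) * x))).
    rewrite /f phiD -scaleNr phiZ; field; by rewrite gt_eqF.
  apply: is_deriveD; last exact: is_derive_scale (is_derive_expRM _ _).
  exact: (is_deriveM (is_derive_expRM l x) (phi_deriv L v a x)).
have f0 x : 0 <= x -> f x <= 0.
  move=> x0; rewrite /f subr_le0 mulNr -mulrN.
  have -> : K * expR ((l - delta) * x) = expR (l * x) * (K * expR (- delta * x)).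
    by rewrite mulrCA -expRD; congr (_ * expR _); ring.
  rewrite ler_wpM2l ?expR_ge0 //; have := bnd x x0.
  by rewrite ler_norml => /andP[]; rewrite lerNl.
have := derive_nincr dF f0 t0; rewrite /F !mulr0 expR0 mul1r mulr1 => le.
have e1 : expR (- l * t) * expR (l * t) = 1 by rewrite -expRD mulNr addNr expR0.
have e2 : expR (- l * t) * expR ((l - delta) * t) = expR (- delta * t).
  by rewrite -expRD; congr expR; ring.
have -> : phi v a t = expR (- l * t) * (expR (l * t) * phi v a t).
  by rewrite mulrA e1 mul1r.
apply: (@le_trans _ _ (expR (- l * t) * (`|phi v a 0| + K / (l - delta) * expR ((l - delta) * t)))).
  rewrite ler_wpM2l ?expR_ge0 // -lerBlDr -mulNr; apply: (le_trans le).
  rewrite lerBlDr; apply: (le_trans (ler_norm _)); rewrite lerDl divr_ge0 //.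
  exact: ltW.
rewrite mulrDr mulrCA e2 mulrDl lerD2r mulrC ler_wpM2l // ler_expR.
by rewrite !mulNr lerN2 ler_wpM2r // ltW.
Qed.

(** Induction on the factors of a polynomial annihilating [a]: removing the factor
    [L - l] costs one integration, which keeps the rate [delta < l]. *)
Lemma phi_decay v (delta : R) : 0 < delta ->
  forall s', (forall l, l \in s' -> delta < l) -> forall a, shifts L s' a = 0 ->
  exists2 K, 0 <= K & forall t, 0 <= t -> `|phi v a t| <= K * expR (- delta * t).
Proof.
move=> d0; elim/last_ind => [|s' l IH] sd a.
  move=> /= ->; exists 0 => // t _; rewrite mul0r.
  by have := phiZ L v 0 0 t; rewrite scaler0 mul0r => ->; rewrite normr0.
rewrite /shifts foldr_rcons -/(shifts _ _ _) => sa.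
have [|K K0 bK] := IH _ _ sa.
  by move=> x xs; apply: sd; rewrite mem_rcons inE xs orbT.
have dl : 0 < delta < l by rewrite d0 sd // mem_rcons mem_head.
exists (`|phi v a 0| + K / (l - delta)).
  by rewrite addr_ge0 // divr_ge0 // subr_ge0 ltW //; case/andP: dl.
move=> t t0; rewrite ler_norml; apply/andP; split; last exact: phi_shift_upper bK _ _.
rewrite lerNl; have := @phi_shift_upper v (- a) l delta K dl K0.
have pN b x : phi v (- b) x = - phi v b x.
  by rewrite -[in LHS]scaleN1r phiZ mulN1r.
move=> /(_ _ t t0); rewrite !pN normrN; apply=> x x0.
by rewrite mulmxN scalerN -opprD pN normrN bK.
Qed.

Lemma phi_exp_bound v : exists2 delta : R, 0 < delta & forall a,
  exists2 K, 0 <= K & forall t, 0 <= t -> `|phi v a t| <= K * expR (- delta * t).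
Proof.
have [delta d0 sd] : exists2 delta : R, 0 < delta & forall l, l \in s -> delta < l.
  elim: s s_pos => [|l s' IH] sp; first by exists 1.
  have [|e e0 se] := IH; first by move=> x xs; apply: sp; rewrite inE xs orbT.
  exists (Num.min e (l / 2)).
    by rewrite lt_min e0 divr_gt0 // sp // mem_head.
  move=> x; rewrite inE => /orP[/eqP ->|/se ex]; rewrite gt_min ?ex ?orbT //.
  by rewrite [l / 2 < l]ltr_pdivrMr // ltr_pMr ?ltr1n ?orbT // sp // mem_head.
exists delta => // a.
exact: (phi_decay v d0 sd (char_poly_shifts a char_split)).
Qed.

Lemma phi_continuous v a : continuous (phi v a).
Proof. by apply: derive_continuous => t; exact: phi_deriv. Qed.

(** The bilinear form of the gramian, before it is expressed in coordinates. *)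
Definition gram v a a' : R := \int[mu]_(t in `[0, +oo[) (phi v a t * phi v a' t).

Let gram_FTC v a a' :
  mu.-integrable `[0, +oo[ (EFin \o (fun t => phi v a t * phi v a' t)) /\
  \int[mu]_(t in `[0, +oo[) (phi v a t * phi v (- 1 *: (L *m a')) t
       + phi v a' t * phi v (- 1 *: (L *m a)) t) = - (phi v a 0 * phi v a' 0).
Proof.
have [delta d0 bound] := phi_exp_bound v.
have bprod b b' : exists2 K, 0 <= K & forall t, 0 <= t ->
    `|phi v b t * phi v b' t| <= K * expR (- (delta + delta) * t).
  have [K K0 bK] := bound b; have [K' K'0 bK'] := bound b'.
  exists (K * K'); first exact: mulr_ge0.
  move=> t t0; rewrite normrM opprD mulrDl expRD mulrACA.
  exact: (ler_pM (normr_ge0 _) (normr_ge0 _) (bK _ t0) (bK' _ t0)).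
have [K1 K10 b1] := bprod a a'; have [K2 K20 b2] := bprod a (L *m a').
have [K3 K30 b3] := bprod a' (L *m a).
have dd : 0 < delta + delta by rewrite addr_gt0.
have cphi b b' : continuous (fun t => phi v b t * phi v b' t).
  by move=> t; apply: cvgM; exact: phi_continuous.
have dphi t : is_derive t (1 : R) (fun t => phi v a t * phi v a' t)
   (phi v a t * phi v (- 1 *: (L *m a')) t + phi v a' t * phi v (- 1 *: (L *m a)) t).
  rewrite !phiZ !mulN1r; exact: (is_deriveM (phi_deriv L v a t) (phi_deriv L v a' t)).
pose K := K1 + K2 + K3.
have K0 : 0 <= K by rewrite !addr_ge0.
have [intf If] := expRM_integrable dd K0.
have := @decay_FTC R _ _ K _ dd K0 dphi _ _ _ => [[|t t0|t t0|_ ->]].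
- by move=> t; apply: cvgD; exact: cphi.
- rewrite !phiZ !mulN1r !mulrN -opprD normrN; apply: (le_trans (ler_normD _ _)).
  apply: (le_trans (lerD (b2 t t0) (b3 t t0))); rewrite -mulrDl.
  by rewrite ler_wpM2r ?expR_ge0 // /K -addrA lerDr.
- by rewrite /K -addrA mulrDl -[leLHS]addr0 lerD ?b1 // mulr_ge0 ?expR_ge0 ?addr_ge0.
split=> //; apply: (le_integrable _ _ _ intf) => //.
  by apply/measurable_EFinP; apply: measurable_funTS; exact: continuous_measurable_fun.
move=> t /=; rewrite in_itv /= andbT => t0; rewrite lee_fin.
apply: (le_trans (b1 _ t0)); apply: (le_trans _ (ler_norm _)).
by rewrite ler_wpM2r ?expR_ge0 // /K -addrA lerDl addr_ge0.
Qed.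

Lemma gram_integrable v a a' :
  mu.-integrable `[0, +oo[ (EFin \o (fun t => phi v a t * phi v a' t)).
Proof. by have [] := gram_FTC v a a'. Qed.

Lemma gramC v a a' : gram v a a' = gram v a' a.
Proof. by congr Rintegral; apply/funext => t; rewrite mulrC. Qed.

Lemma gram_linl v x a b a' : gram v (x *: a + b) a' = x * gram v a a' + gram v b a'.
Proof.
rewrite /gram -RintegralZl //; last exact: gram_integrable.
rewrite -RintegralD //; last 2 first.
- have := gram_integrable v (x *: a) a'; congr (_.-integrable _ _).
  by apply/funext => t /=; rewrite phiZ mulrA.
- exact: gram_integrable.
by congr Rintegral; apply/funext => t; rewrite phi_lin mulrDl mulrA.
Qed.

Lemma gram_lyapunov v a a' :
  gram v (L *m a) a' + gram v a (L *m a') = (v^T *m a) 0 0 * (v^T *m a') 0 0.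
Proof.
have [_] := gram_FTC v a a'; rewrite RintegralD ?gram_integrable //.
rewrite -/(gram v a _) -/(gram v a' _) !phi0 => E.
have gN b b' : gram v b (- 1 *: b') = - gram v b b'.
  rewrite gramC -[- 1 *: b']addr0 gram_linl mulN1r [gram v b' b]gramC.
  rewrite (_ : gram v 0 b = 0) ?addr0 //.
  have := gram_linl v 0 0 0 b; rewrite scaler0 addr0 mul0r add0r => _.
  have := gram_linl v 1 0 0 b; rewrite scaler0 addr0 mul1r => /eqP.
  by rewrite -subr_eq subrr eq_sym => /eqP.
move: E; rewrite (gN a) (gN a') -opprD => /oppr_inj <-.
by rewrite addrC [gram v a' _]gramC.
Qed.
Lemma expmx_tr (M : 'M[R]_k) : expmx M^T = (expmx M)^T.
Proof.
apply/matrixP => i j; rewrite !mxE; congr (limn (series _)); apply/funext => m.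
suff -> : (M^T) ^+ m = (M ^+ m)^T by rewrite mxE.
elim: m => [|m IH]; first by rewrite !expr0 trmx1.
by rewrite exprS exprSr IH -[RHS]/((_ *m _)^T) trmx_mul.
Qed.

Lemma gramianE v i j : gramian L v i j = gram v (delta_mx i 0) (delta_mx j 0).
Proof.
rewrite mxE; congr Rintegral; apply/funext => t.
rewrite -[_ *: L^T]linearZ /= expmx_tr; set E := expmx _.
have -> : E^T *m v *m v^T *m E = (v^T *m E)^T *m (v^T *m E).
  by rewrite trmx_mul trmxK !mulmxA.
by rewrite mxE big_ord1 mxE !expmx_phi.
Qed.

Lemma lin_sum (h : 'cV[R]_k -> R) a : (forall x b c, h (x *: b + c) = x * h b + h c) ->
  h a = \sum_i a i 0 * h (delta_mx i 0).
Proof.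
move=> hl; have h0 : h 0 = 0.
  by have /eqP := hl 1 0 0; rewrite scale1r addr0 mul1r -subr_eq subrr eq_sym => /eqP.
rewrite {1}(matrix_sum_delta a).
under eq_bigr => i _ do rewrite big_ord1.
elim/big_rec2: _ => // i y b _ <-; exact: hl.
Qed.

Lemma gramian_form v a a' : (a^T *m gramian L v *m a') 0 0 = gram v a a'.
Proof.
rewrite (@lin_sum (fun b => gram v b a') a); last by move=> *; exact: gram_linl.
rewrite -mulmxA mxE; apply: eq_bigr => i _; rewrite mxE; congr (_ * _).
rewrite gramC (@lin_sum (fun b => gram v b (delta_mx i 0)) a'); last first.
  by move=> *; exact: gram_linl.
by rewrite mxE; apply: eq_bigr => j _; rewrite gramianE gramC mulrC.
Qed.

Lemma gramian_psd v : psdmx (gramian L v).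
Proof.
split=> [|x]; first by apply/matrixP => i j; rewrite mxE !gramianE gramC.
by rewrite gramian_form Rintegral_ge0 // => t _; rewrite -expr2 sqr_ge0.
Qed.

(** The derivative of [phi a * phi a'] integrates to minus its value at [0]. *)
Lemma gramian_lyapunov v : L^T *m gramian L v + gramian L v *m L = v *m v^T.
Proof.
apply/matrixP => i j.
have entry (M : 'M[R]_k) : 
    M i j = ((delta_mx i 0 : 'cV[R]_k)^T *m M *m (delta_mx j 0 : 'cV[R]_k)) 0 0.
  rewrite trmx_delta -rowE !mxE (bigD1 j) //= !mxE !eqxx mulr1 big1 ?addr0 // => l lj.
  by rewrite !mxE (negPf lj) mulr0.
rewrite [LHS]entry [RHS]entry mulmxDr mulmxDl mxE !mulmxA -trmx_mul.
rewrite gramian_form -mulmxA gramian_form gram_lyapunov.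
rewrite -[_ *m v *m _ *m _]mulmxA [in RHS]mxE big_ord1; congr (_ * _).
transitivity (((delta_mx i 0 : 'cV[R]_k)^T *m v)^T 0 0); first by rewrite trmx_mul trmxK.
by rewrite mxE.
Qed.
End Gramian.

(** * Square roots and largest eigenvalues *)

Section Spectral.
Local Open Scope classical_set_scope.
Local Open Scope ring_scope.
Variable R : realType.
Local Notation C := R[i].
Local Notation toC := (real_complex R).
Local Notation toCmx := (map_mx toC).

Lemma real_spectral n (M : 'M[R]_n) : M^T = M ->
  exists (U : 'M[C]_n) (d : 'rV[R]_n), U *m U^H = 1%:M /\
    toCmx M = U^H *m toCmx (diag_mx d) *m U.
Proof.
move=> Ms; have Mh : toCmx M \is hermsymmx.
  by apply/is_hermitianmxP; rewrite expr0 scale1r adj_real Ms.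
have Uu := spectral_unitarymx (toCmx M).
have Dr := hermitian_spectral_diag_real Mh.
pose d := map_mx (@complex.Re R) (spectral_diag (toCmx M)).
have Ed : spectral_diag (toCmx M) = toCmx d.
  apply/matrixP => i j; rewrite !mxE; apply/esym/RRe_real.
  by move/mxOverP: Dr; apply.
exists (spectralmx (toCmx M)), d; split; first exact/unitarymxP.
have /hermitian_normalmx/orthomx_spectralP := Mh.
by rewrite invmx_unitary // Ed => {1}->; rewrite map_diag_mx.
Qed.

Lemma hform_diag n (d : 'rV[R]_n) (x : 'cV[C]_n) :
  hform (toCmx (diag_mx d)) x x = \sum_i toC (d 0 i) * `|x i 0| ^+ 2.
Proof.
rewrite /hform map_diag_mx mul_mx_diag mxE; apply: eq_bigr => i _.
by rewrite !mxE normCK; ring.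
Qed.

Lemma interpolate n (g : R -> R) (d : 'rV[R]_n) :
  exists p : {poly R}, forall i, p.[d 0 i] = g (d 0 i).
Proof.
suff [p Hp] : exists p : {poly R}, forall x, x \in [seq d 0 i | i : 'I_n] -> p.[x] = g x.
  by exists p => i; apply: Hp; apply: codom_f.
elim: [seq d 0 i | i : 'I_n] => [|a s [p Hp]]; first by exists 0.
have [as_|as_] := boolP (a \in s).
  by exists p => x; rewrite inE => /orP[/eqP ->|]; apply: Hp.
pose q : {poly R} := \prod_(b <- s) ('X - b%:P).
have qa : q.[a] != 0 by rewrite -[_ == _]/(root q a) root_prod_XsubC.
exists (p + ((g a - p.[a]) / q.[a])%:P * q) => x; rewrite hornerD hornerM hornerC inE.
move=> /orP[/eqP ->|xs]; first by rewrite divfK // addrC subrK.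
have /eqP -> : q.[x] == 0 by rewrite -[_ == _]/(root q x) root_prod_XsubC.
by rewrite mulr0 addr0 Hp.
Qed.

Lemma spectral_ge0 n (M : 'M[R]_n) (U : 'M[C]_n) (d : 'rV[R]_n) i :
  psdmx M -> U *m U^H = 1%:M -> toCmx M = U^H *m toCmx (diag_mx d) *m U -> 0 <= d 0 i.
Proof.
move=> Mp UU ME; have := psdmx_hform (U^H *m delta_mx i 0) Mp.
rewrite ME hform_mulr hform_mull mulmxA UU mul1mx hform_diag (bigD1 i) //=.
rewrite mxE !eqxx normr1 expr1n mulr1 big1 ?addr0; first by rewrite ler0c.
by move=> j ji; rewrite mxE (negPf ji) normr0 expr0n mulr0.
Qed.

Lemma spectral_psd n (M : 'M[R]_n) (U : 'M[C]_n) (d : 'rV[R]_n) :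
  toCmx M = U^H *m toCmx (diag_mx d) *m U -> (forall i, 0 <= d 0 i) -> psdmx M.
Proof.
move=> ME d0; split=> [|x].
  have : toCmx M^T = toCmx M.
    by rewrite -adj_real ME !adjM trmxCK adj_real tr_diag_mx mulmxA.
  exact: map_mx_inj.
rewrite -ler0c -hform_real ME hform_mulr hform_mull hform_diag sumr_ge0 // => i _.
by rewrite mulr_ge0 ?exprn_ge0 // ler0c.
Qed.

(** The square root is a polynomial in [M], which makes it real. *)
Lemma sqrtmxP n (M : 'M[R]_n) : psdmx M ->
  psdmx (sqrtmx M) /\ sqrtmx M *m sqrtmx M = M.
Proof.
move=> Mp; suff ex : exists B : 'M[R]_n, psdmx B /\ B *m B = M.
  rewrite /sqrtmx; have [B HB] := ex.
  exact: (@xgetPex _ 0 [set B | psdmx B /\ B *m B = M] ex).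
case: n M Mp => [|n] M Mp.
  by exists M; split=> //; apply/matrixP => -[].
have [Ms _] := Mp; have [U [d [UU ME]]] := real_spectral Ms.
have d0 i := spectral_ge0 i Mp UU ME.
have [p Hp] := interpolate Num.sqrt d.
have Uu : U \in unitmx by case: (mulmx1_unit UU).
have UH : invmx U = U^H by rewrite -[LHS]mulmx1 -UU mulmxA mulVmx // mul1mx.
have HD : horner_mx (diag_mx d) p = diag_mx (\row_i Num.sqrt (d 0 i)).
  by rewrite horner_mx_diag; congr diag_mx; apply/rowP => i; rewrite !mxE Hp.
have HC : toCmx (horner_mx M p) = U^H *m toCmx (diag_mx (\row_i Num.sqrt (d 0 i))) *m U.
  by rewrite map_horner_mx ME -UH (horner_mx_uconjC _ _ Uu) -map_horner_mx HD.
exists (horner_mx M p); split.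
  by apply: spectral_psd HC _ => i; rewrite mxE sqrtr_ge0.
set D := \row_i Num.sqrt (d 0 i) in HC.
have DD : diag_mx D *m diag_mx D = diag_mx d.
  by rewrite mulmx_diag; congr diag_mx; apply/rowP => i; rewrite !mxE -expr2 sqr_sqrtr.
apply: (@map_mx_inj _ _ toC); rewrite map_mxM HC ME -DD map_mxM !mulmxA.
by rewrite -(mulmxA _ U) UU mulmx1.
Qed.

Lemma eigenvalue_le n (M : 'M[R]_n) a g :
  psdmx (g%:M - M) -> eigenvalue M a -> a <= g.
Proof.
move=> [_ Mp] /eigenvalueP [v Mv v0].
have := Mp v^T; rewrite trmxK mulmxBr mulmxBl Mv mul_mx_scalar -!scalemxAl.
rewrite -scalerBl mxE pmulr_lge0 ?subr_ge0 // lt_def.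
have := sqnorm_ge0 v^T; rewrite trmxK => -> /=; rewrite andbT.
apply: contra_neq v0; rewrite mxE => /eqP.
rewrite psumr_eq0 => [/allP vi|i _]; last by rewrite mxE -expr2 sqr_ge0.
apply/rowP => i; have := vi i (mem_index_enum _).
by rewrite !mxE mulf_eq0 orbb => /eqP.
Qed.

(** In a spectral decomposition every diagonal entry is an eigenvalue, and the set of
    eigenvalues is bounded, so each entry is below the supremum. *)
Lemma lambda_max_lt n (M : 'M[R]_n) g : M^T = M ->
  lambda_max M < g -> pdmx (g%:M - M).
Proof.
move=> Ms lg; have [U [d [UU ME]]] := real_spectral Ms.
have Uu : U \in unitmx by case: (mulmx1_unit UU).
have eig i : eigenvalue M (d 0 i).
  rewrite -(eigenvalue_map toC); apply/eigenvalueP; exists (row i U).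
    rewrite ME !mulmxA -row_mul UU rowE mulmx1.
    by rewrite -rowE map_diag_mx row_diag_mx -scalemxAl -rowE mxE.
  apply/eqP => Ui; have : row i U *m U^H = 0 by rewrite Ui mul0mx.
  by rewrite -row_mul UU => /rowP /(_ i) /eqP; rewrite !mxE eqxx oner_eq0.
have gE h : toCmx (h%:M - M) = U^H *m toCmx (diag_mx (const_mx h - d)) *m U.
  have UHU : U^H *m U = 1%:M by apply: mulmx1C.
  rewrite linearB /= diag_const_mx !map_mxB mulmxBr mulmxBl -ME map_scalar_mx.
  by rewrite mul_mx_scalar -scalemxAl UHU scalemx1.
have ub : has_ubound [set a : R | eigenvalue M a].
  exists (\sum_i `|d 0 i|) => a /=; apply: eigenvalue_le.
  apply: spectral_psd (gE _) _ => i; rewrite !mxE subr_ge0.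
  by apply: (le_trans (ler_norm _)); rewrite (bigD1 i) //= lerDl sumr_ge0.
have dg i : d 0 i < g by apply: le_lt_trans lg; apply: ub_le_sup => //; exact: eig.
have [Hs Hp] : psdmx (g%:M - M).
  by apply: spectral_psd (gE _) _ => i; rewrite !mxE subr_ge0 ltW.
split=> // x x0; rewrite lt_def Hp andbT.
apply: contra x0 => /eqP E.
have /eqP : hform (toCmx (g%:M - M)) (toCmx x) (toCmx x) = 0 by rewrite hform_real E.
rewrite gE hform_mulr hform_mull hform_diag psumr_eq0; last first.
  by move=> i _; rewrite mulr_ge0 ?exprn_ge0 // ler0c !mxE subr_ge0 ltW.
move=> /allP Ux; have : U *m toCmx x = 0.
  apply/colP => i; have := Ux i (mem_index_enum _); rewrite [RHS]mxE.
  have h : toC ((const_mx g - d) 0 i) != 0.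
    by rewrite fmorph_eq0 !mxE subr_eq0 gt_eqF.
  by rewrite mulf_eq0 (negPf h) /= expf_eq0 normr_eq0 => /eqP.
move/(congr1 (mulmx (invmx U))); rewrite mulKmx // mulmx0 => /eqP.
by rewrite -(map_mx0 toC) (inj_eq (@map_mx_inj _ _ toC _ _)).
Qed.
End Spectral.

(** * Schur complements and the coupling constraint *)

Section SchurComplements.
Variable R : realType.

Lemma pdmx_cong k l (M : 'M[R]_k) (G : 'M[R]_(k, l)) :
  inj_cols G -> pdmx M -> pdmx (G^T *m M *m G).
Proof.
move=> Ginj Mp; have [Ms Mpos] := Mp; have [H _] := psdmx_cong G (pdmx_psdmx Mp).
split=> // x x0; have := Mpos (G *m x); rewrite trmx_mul !mulmxA; apply.
by apply: contra_neq x0; apply: Ginj.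
Qed.

Lemma pdmx_unit k (M : 'M[R]_k) : pdmx M -> M \in unitmx.
Proof.
move=> [_ Mp]; apply: inj_cols_unit => y My; apply/eqP/negP => /negP /Mp.
by rewrite -mulmxA My mulmx0 mxE ltxx.
Qed.

Lemma pdmx_cong_unit k (M G : 'M[R]_k) : G \in unitmx -> pdmx (G^T *m M *m G) -> pdmx M.
Proof.
move=> Gu H; have -> : M = (invmx G)^T *m (G^T *m M *m G) *m invmx G.
  rewrite -!mulmxA mulmxV // mulmx1 mulmxA -trmx_mul mulmxV // trmx1 mul1mx //.
apply: pdmx_cong H => y Gy; by rewrite -[y](mulKVmx Gu) Gy mulmx0.
Qed.

Lemma pdmx_inv k (M : 'M[R]_k) : pdmx M -> pdmx (invmx M).
Proof.
move=> Mp; have Mu := pdmx_unit Mp; have [Ms _] := Mp.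
by apply: (pdmx_cong_unit Mu); rewrite Ms mulmxV // mul1mx.
Qed.

Lemma pdmxD k (M N : 'M[R]_k) : pdmx M -> psdmx N -> pdmx (M + N).
Proof.
move=> [Ms Mp] [Ns Np]; split=> [|x x0]; first by rewrite linearD /= Ms Ns.
by rewrite mulmxDr mulmxDl mxE ltr_pwDl // Mp.
Qed.

Lemma pdmx_scalar k (a : R) : 0 < a -> pdmx (a%:M : 'M[R]_k).
Proof.
move=> a0; split=> [|x x0]; first by rewrite tr_scalar_mx.
rewrite mul_mx_scalar -scalemxAl mxE mulr_gt0 // lt_def sqnorm_ge0 andbT.
apply: contra_neq x0; rewrite mxE => /eqP.
rewrite psumr_eq0 => [/allP vi|i _]; last by rewrite mxE -expr2 sqr_ge0.
apply/colP => i; have := vi i (mem_index_enum _).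
by rewrite !mxE mulf_eq0 orbb => /eqP.
Qed.

Lemma pdmx_diag k l (P : 'M[R]_k) (Q : 'M[R]_l) :
  pdmx P -> pdmx Q -> pdmx (block_mx P 0 0 Q).
Proof.
move=> Pp Qp; have [Ps P0] := Pp; have [Qs Q0] := Qp.
split=> [|x x0]; first by rewrite tr_block_mx Ps Qs !trmx0.
have [_ Pge] := pdmx_psdmx Pp; have [_ Qge] := pdmx_psdmx Qp.
rewrite -[x]vsubmxK tr_col_mx mul_row_block mul_row_col !mulmx0 addr0 add0r mxE.
have [u0|/P0 u0] := eqVneq (usubmx x) 0; last by rewrite ltr_pwDl.
have [d0|/Q0 d0] := eqVneq (dsubmx x) 0; last by rewrite ltr_wpDl.
by move: x0; rewrite -[x]vsubmxK u0 d0 col_mx0 eqxx.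
Qed.

Lemma pdmx_ul k l (P : 'M[R]_k) r (Q : 'M[R]_l) : pdmx (block_mx P r r^T Q) -> pdmx P.
Proof.
move=> H; have -> : P = (col_mx 1%:M 0)^T *m block_mx P r r^T Q *m col_mx 1%:M 0.
  rewrite tr_col_mx trmx1 trmx0 mul_row_block mul_row_col.
  by rewrite !mul1mx !mul0mx mulmx1 mulmx0 !addr0.
apply: pdmx_cong H => y; rewrite mul_col_mx mul1mx mul0mx -col_mx0.
by move=> /eq_col_mx [].
Qed.

Lemma pdmx_schur_dr k l (P : 'M[R]_k) (r : 'M[R]_(k, l)) (Q : 'M[R]_l) :
  P \in unitmx -> pdmx (block_mx P r r^T Q) -> pdmx (Q - r^T *m invmx P *m r).
Proof.
move=> Pu H; have [Hs _] := H; have := Hs; rewrite tr_block_mx.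
move=> /eq_block_mx [Ps _ _ _]; pose G := col_mx (- invmx P *m r) 1%:M.
have -> : Q - r^T *m invmx P *m r = G^T *m block_mx P r r^T Q *m G.
  rewrite /G tr_col_mx trmx_mul linearN /= trmx_inv Ps trmx1 mul_row_block mul_row_col.
  rewrite !mulmxN !mulNmx !mul1mx mulmx1 mulmxKV // addNr mul0mx ?oppr0 add0r.
  by rewrite addrC.
apply: pdmx_cong H => y; rewrite mul_col_mx mul1mx -col_mx0.
by move=> /eq_col_mx [].
Qed.

Lemma pdmx_schur_ul k l (P : 'M[R]_k) (r : 'M[R]_(k, l)) (Q : 'M[R]_l) :
  Q \in unitmx -> pdmx (block_mx P r r^T Q) -> pdmx (P - r *m invmx Q *m r^T).
Proof.
move=> Qu H; have [Hs _] := H; have := Hs; rewrite tr_block_mx.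
move=> /eq_block_mx [_ _ _ Qs]; pose G := col_mx 1%:M (- invmx Q *m r^T).
have -> : P - r *m invmx Q *m r^T = G^T *m block_mx P r r^T Q *m G.
  rewrite /G tr_col_mx trmx_mul linearN /= trmx_inv Qs trmx1 trmxK.
  rewrite mul_row_block mul_row_col.
  by rewrite !mulmxN !mulNmx !mul1mx mulmx1 mulmxKV // subrr mul0mx ?oppr0 addr0.
apply: pdmx_cong H => y; rewrite mul_col_mx mul1mx -col_mx0.
by move=> /eq_col_mx [].
Qed.

Lemma pdmx_block k l (P : 'M[R]_k) (r : 'M[R]_(k, l)) (Q : 'M[R]_l) :
  pdmx P -> pdmx (Q - r^T *m invmx P *m r) -> pdmx (block_mx P r r^T Q).
Proof.
move=> Pp Qp; have Pu := pdmx_unit Pp; have [Ps _] := Pp.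
pose G : 'M[R]_(k + l) := block_mx 1%:M (invmx P *m r) 0 1%:M.
have -> : block_mx P r r^T Q =
    G^T *m block_mx P 0 0 (Q - r^T *m invmx P *m r) *m G.
  rewrite /G tr_block_mx trmx_mul trmx_inv Ps !trmx1 trmx0 !mulmx_block.
  rewrite !mul1mx !mul0mx !mulmx0 !mulmx1 !addr0 !add0r mulmxKV // mulKVmx //.
  by rewrite mulmxA addrC subrK.
apply: pdmx_cong (pdmx_diag Pp Qp); apply/inj_colsP; rewrite row_free_unit unitmx_tr.
by rewrite unitmxE det_ublock !det1 mulr1 unitr1.
Qed.

Lemma sym_bound n (N : 'M[R]_n) : N^T = N -> exists2 nu, 0 < nu & pdmx (nu%:M - N).
Proof.
move=> Ns; exists (`|lambda_max N| + 1); first by rewrite ltr_wpDl.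
apply: lambda_max_lt => //; apply: (le_lt_trans (ler_norm _)).
by rewrite ltrDl.
Qed.

(** [M > 1 / nu] and [M^-1 < nu] are Schur complements of one block matrix. *)
Lemma pdmx_margin n (M : 'M[R]_n) : pdmx M -> exists2 mu, 0 < mu & pdmx (M - mu%:M).
Proof.
move=> Mp; have [Vs _] := pdmx_inv Mp; have [nu nu0 H] := sym_bound Vs.
exists nu^-1; first by rewrite invr_gt0.
have /pdmx_schur_ul : pdmx (block_mx M 1%:M 1%:M^T nu%:M).
  by apply: pdmx_block => //; rewrite trmx1 mul1mx mulmx1.
rewrite trmx1 mul1mx mulmx1 invmx_scalar; apply.
by rewrite unitmxE det_scalar unitrX // unitfE gt_eqF.
Qed.

Lemma pdmx_perturb n (M N : 'M[R]_n) : pdmx M -> N^T = N ->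
  exists2 delta, 0 < delta & pdmx (M - delta *: N).
Proof.
move=> /pdmx_margin [mu mu0 Mmu] /sym_bound [nu nu0 Nnu].
exists (mu / nu); first by rewrite divr_gt0.
have -> : M - (mu / nu) *: N = (M - mu%:M) + (mu / nu) *: (nu%:M - N).
  rewrite scalerBr scale_scalar_mx divfK ?gt_eqF //.
  by rewrite addrA subrK.
by apply: pdmxD => //; apply: psdmxZ; [rewrite divr_ge0 ?ltW | exact: pdmx_psdmx].
Qed.

(** Two lower bounds [LX] and [LY] inverse to each other satisfy the coupling
    constraint; [LY] extends [S ZX^-1 S^T] by a small multiple of the identity. *)
Lemma coupling n k l (S : 'M[R]_(n, k)) (T : 'M[R]_(n, l)) ZX ZY :
  pdmx (block_mx ZX (- (T^T *m S)^T) (- (T^T *m S)) ZY) ->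
  exists LX LY : 'M[R]_n, [/\ LX^T = LX /\ LY^T = LY,
    pdmx (ZX - S^T *m LX *m S), pdmx (ZY - T^T *m LY *m T) &
    forall X Y, psdmx (X - LX) -> psdmx (Y - LY) ->
      psdmx (block_mx X (- 1%:M) (- 1%:M) Y)].
Proof.
set J := T^T *m S => H.
have JT : (- J^T)^T = - J by rewrite linearN /= trmxK.
have H' : pdmx (block_mx ZX (- J^T) (- J^T)^T ZY) by rewrite JT.
have Zp := pdmx_ul H'; have Zu := pdmx_unit Zp; have [Zs _] := Zp.
have Yp := pdmx_schur_dr Zu H'.
have TTs : (T^T *m T)^T = T^T *m T by rewrite trmx_mul trmxK.
have [delta d0 Yd] := pdmx_perturb Yp TTs.
pose W := S *m invmx ZX *m S^T + delta%:M.
have Wp : pdmx W.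
  rewrite /W addrC; apply: pdmxD; first exact: pdmx_scalar.
  have := psdmx_cong S^T (pdmx_psdmx (pdmx_inv Zp)); by rewrite trmxK.
have Wu := pdmx_unit Wp; have [Ws _] := Wp.
exists (invmx W), W; split.
- by rewrite trmx_inv Ws.
- have /(pdmx_schur_ul Wu) : pdmx (block_mx ZX S^T S^T^T W); last by rewrite trmxK.
  apply: pdmx_block => //; rewrite trmxK /W [_ + delta%:M]addrC addrK.
  exact: pdmx_scalar.
- move: Yd; rewrite JT /W mulmxDr mulmxDl.
  rewrite mul_mx_scalar -scalemxAl opprD !mulNmx mulmxN opprK /J trmx_mul trmxK !mulmxA.
  by rewrite addrA.
move=> X Y HX HY; pose G : 'M[R]_(n, n + n) := row_mx (- invmx W) 1%:M.
have -> : block_mx X (- 1%:M) (- 1%:M) Y =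
    block_mx (X - invmx W) 0 0 (Y - W) + G^T *m W *m G.
  rewrite /G tr_row_mx trmx1 linearN /= trmx_inv Ws mul_col_mx mul_col_row.
  rewrite !mul1mx !mulmx1 !mulmxN !mulNmx mulVmx // mulmxV // mul1mx opprK.
  by rewrite add_block_mx !subrK !add0r.
apply: psdmxD; last exact/psdmx_cong/pdmx_psdmx.
exact: psdmx_diag.
Qed.
End SchurComplements.

(** * Lyapunov equations with an antistable matrix *)

Section LyapunovEquation.
Variables (R : realType) (k : nat) (L : 'M[R]_k) (s : seq R).
Hypothesis char_split : char_poly L = \prod_(a <- s) ('X - a%:P).
Hypothesis s_pos : forall a, a \in s -> 0 < a.

Lemma eigenvector_L (a : R) (v : 'cV[R]_k) : v != 0 -> L^T *m v = a *: v -> 0 < a.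
Proof.
move=> v0 Lv; apply: s_pos; rewrite -root_prod_XsubC -char_split -eigenvalue_root_char.
apply/eigenvalueP; exists v^T; last by rewrite -trmx0 (inj_eq (@trmx_inj _ _ _)).
by apply: trmx_inj; rewrite trmx_mul trmxK Lv linearZ /= trmxK.
Qed.

(** [X] intertwines [L] and [- L^T], which have no common eigenvalue. *)
Lemma lyapunov_unique (X : 'M[R]_k) : L^T *m X + X *m L = 0 -> X = 0.
Proof.
move=> LX; apply/eqP/negP => /negP X0.
have [u Xu] : exists u : 'cV[R]_k, X *m u <> 0.
  apply/existsNP => Xu; case/negP: X0; apply/eqP/matrixP => i j.
  by have /colP /(_ i) := Xu (delta_mx j 0); rewrite -colE !mxE.
have := @shifts_eigenvector _ _ L (fun=> True) (fun v => X *m v = 0) s u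
  (fun _ _ _ => I) I Xu.
rewrite (char_poly_shifts _ char_split) mulmx0 => /(_ erefl) [a [v [as_ _ Xv XLv]]].
have : 0 < - a.
  apply: (@eigenvector_L _ (X *m v)); first exact/eqP.
  have -> : L^T *m (X *m v) = - (X *m (L *m v)).
    by rewrite !mulmxA -mulNmx; congr (_ *m v); apply/eqP; rewrite -addr_eq0 LX.
  by move/eqP: XLv; rewrite mulmxBr -scalemxAr subr_eq0 scaleNr => /eqP ->.
by rewrite oppr_gt0 ltNge ltW // s_pos.
Qed.
End LyapunovEquation.

Section LyapunovSolutions.
Variables (R : realType) (k : nat) (L : 'M[R]_k) (s : seq R).
Hypothesis char_split : char_poly L = \prod_(a <- s) ('X - a%:P).
Hypothesis s_pos : forall a, a \in s -> 0 < a.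

Lemma lyapunov_solve l (V : 'M[R]_(k, l)) :
  exists2 Y, psdmx Y & L^T *m Y + Y *m L = V *m V^T.
Proof.
have -> : V *m V^T = \sum_i col i V *m (col i V)^T.
  apply/matrixP => i j; rewrite mxE summxE; apply: eq_bigr => x _.
  by rewrite !mxE big_ord1 !mxE.
elim/big_ind: _ => [|M N [Y Yp <-] [Y' Yp' <-]|i _].
- exists 0; last by rewrite mulmx0 mul0mx addr0.
  by split=> [|x]; rewrite ?trmx0 // mulmx0 mul0mx mxE.
- exists (Y + Y'); first exact: psdmxD.
  by rewrite mulmxDr mulmxDl addrACA.
- exists (gramian L (col i V)); first exact: gramian_psd char_split s_pos _.
  exact: gramian_lyapunov char_split s_pos _.
Qed.

(** By uniqueness, [X] is the sum of the gramians of the columns of a square root of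
    the right-hand side. *)
Lemma lyapunov_psd (X : 'M[R]_k) : psdmx (L^T *m X + X *m L) -> psdmx X.
Proof.
move=> /sqrtmxP [[Bs _] BB]; set B := sqrtmx _ in Bs BB.
have [Y Yp EY] := lyapunov_solve B.
suff /eqP : X - Y = 0 by rewrite subr_eq0 => /eqP ->.
apply: (lyapunov_unique char_split s_pos).
by rewrite mulmxBr mulmxBl addrACA -opprD EY Bs BB subrr.
Qed.

Lemma psdmx_kernel (M : 'M[R]_k) (x : 'cV_k) : psdmx M -> (x^T *m M *m x) 0 0 = 0 -> M *m x = 0.
Proof.
move=> /sqrtmxP [[Bs _] BB]; rewrite -BB; set B := sqrtmx _ in Bs *.
have -> : x^T *m (B *m B) *m x = (B *m x)^T *m (B *m x).
  by rewrite trmx_mul Bs !mulmxA.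
move=> H; suff -> : B *m B *m x = 0 by [].
rewrite -mulmxA; suff -> : B *m x = 0 by rewrite mulmx0.
apply/eqP/negP => /negP Bx.
have [_ /(_ _ Bx)] := pdmx_scalar k (@ltr01 R).
by rewrite mulmx1 H ltxx.
Qed.

(** The kernel of the gramian is an [L]-invariant subspace annihilated by [v],
    so a nonzero kernel would contain an unobservable eigenvector. *)
Lemma gramian_pd v :
  (forall a (x : 'cV[R]_k), x != 0 -> 0 < a -> L *m x = a *: x -> v^T *m x != 0) ->
  pdmx (gramian L v).
Proof.
move=> obs; set F := gramian L v.
have Fp : psdmx F := gramian_psd char_split s_pos v.
have FL : L^T *m F + F *m L = v *m v^T := gramian_lyapunov char_split s_pos v.
have [Fs F0] := Fp; split=> // x x0; rewrite lt_def F0 andbT; apply/eqP => xFx.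
have ker_v (y : 'cV[R]_k) : F *m y = 0 -> v^T *m y = 0.
  move=> Fy; apply/eqP/negP => /negP vy; have [_ /(_ _ vy)] := pdmx_scalar 1 (@ltr01 R).
  rewrite mulmx1 trmx_mul trmxK -mulmxA [v *m _]mulmxA -FL mulmxDl.
  rewrite -[L^T *m F *m y]mulmxA Fy mulmx0 add0r -mulmxA.
  have -> : y^T *m (F *m (L *m y)) = (F *m y)^T *m (L *m y).
    by rewrite trmx_mul Fs mulmxA.
  by rewrite Fy trmx0 mul0mx mxE ltxx.
have ker_L (y : 'cV[R]_k) : F *m y = 0 -> F *m (L *m y) = 0.
  move=> Fy; have := congr1 (mulmx^~ y) FL.
  by rewrite mulmxDl -!mulmxA Fy mulmx0 add0r ker_v // mulmx0.
have [b u||a [y [as_ Fy y0 /eqP Ly]]] := @shifts_eigenvector _ _ L (fun y => F *m y = 0)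
   (fun y => y = 0) s x _ (psdmx_kernel Fp xFx) (elimN eqP x0) _.
- by move=> Fu; rewrite mulmxBr -scalemxAr ker_L // Fu scaler0 subrr.
- exact: char_poly_shifts char_split.
have := obs a y (introN eqP y0) (s_pos as_).
by rewrite ker_v // eqxx => /(_ _)/negP; case=> //; apply/eqP; rewrite -subr_eq0.
Qed.
End LyapunovSolutions.

(** * The matrix whose largest eigenvalue is [gamma_hat] *)

Section GammaHat.
Local Open Scope classical_set_scope.
Local Open Scope ring_scope.
Variables (R : realType) (k1 k2 : nat).
Variables (F H1 : 'M[R]_k1) (G H2 : 'M[R]_k2) (J : 'M[R]_(k2, k1)).
Hypotheses (Fp : pdmx F) (Gp : pdmx G) (H1p : psdmx H1) (H2p : psdmx H2).

Let Fi := isqrtmx F.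
Let Gi := isqrtmx G.

Definition gamma_hat_mx : 'M[R]_((k1 + k2) + (k1 + k2)) :=
  block_mx
    (block_mx 0 (Fi *m J^T *m Gi) (Gi *m J *m Fi) 0)
    (block_mx (Fi *m sqrtmx H1) 0 0 (Gi *m sqrtmx H2))
    (block_mx (sqrtmx H1 *m Fi) 0 0 (sqrtmx H2 *m Gi))
    0.

Definition antistable_mx (g : R) : 'M[R]_(k1 + k2) :=
  block_mx (g *: F - g^-1 *: H1) (- J^T) (- J) (g *: G - g^-1 *: H2).

Let Phi : 'M[R]_(k1 + k2) := block_mx Fi 0 0 Gi.
Let r : 'M[R]_(k1 + k2) := block_mx (Fi *m sqrtmx H1) 0 0 (Gi *m sqrtmx H2).

Lemma isqrtmxP n (M : 'M[R]_n) : pdmx M ->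
  [/\ (isqrtmx M)^T = isqrtmx M, isqrtmx M \in unitmx & isqrtmx M *m M *m isqrtmx M = 1%:M].
Proof.
move=> Mp; have [[Bs _] BB] := sqrtmxP (pdmx_psdmx Mp).
have Bu : sqrtmx M \in unitmx.
  by have := pdmx_unit Mp; rewrite -{1}BB unitmx_mul => /andP[].
rewrite /isqrtmx trmx_inv Bs unitmx_inv; split=> //.
by rewrite -{2}BB mulKmx // mulmxV.
Qed.

(** Eliminate the lower right block of [g - E], then undo the congruence by the
    inverse square roots of [F] and [G]. *)
Lemma gamma_hat_mx_schur g : 0 < g ->
  g%:M - gamma_hat_mx = block_mx (g%:M - Phi *m block_mx 0 J^T J 0 *m Phi) (- r) (- r)^T g%:M
  /\ g%:M - Phi *m block_mx 0 J^T J 0 *m Phi - g^-1 *: (- r *m (- r)^T)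
     = Phi^T *m antistable_mx g *m Phi.
Proof.
move=> g0; have gn : g != 0 by rewrite gt_eqF.
have [Fs Fu F1] := isqrtmxP Fp; have [Gs Gu G1] := isqrtmxP Gp.
have [[B1s _] B1] := sqrtmxP H1p; have [[B2s _] B2] := sqrtmxP H2p.
have EP : Phi *m block_mx 0 J^T J 0 *m Phi =
    block_mx 0 (Fi *m J^T *m Gi) (Gi *m J *m Fi) 0.
  by rewrite /Phi !mulmx_block !mulmx0 !mul0mx !addr0 !add0r !mul0mx.
split.
  rewrite EP /gamma_hat_mx scalar_mx_block opp_block_mx add_block_mx oppr0 addr0 !add0r.
  congr block_mx; rewrite linearN /= /r tr_block_mx !trmx0 !trmx_mul.
  by rewrite Fs Gs B1s B2s.
have rT : (- r)^T = - r^T by rewrite linearN.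
rewrite EP rT mulNmx mulmxN opprK /r /antistable_mx /Phi !tr_block_mx !trmx0 !trmx_mul.
rewrite Fs Gs B1s B2s !mulmx_block !mulmx0 !mul0mx !addr0 !add0r.
rewrite [g%:M]scalar_mx_block scale_block_mx !opp_block_mx !add_block_mx.
rewrite !scaler0 !oppr0 !addr0 !add0r.
have e n (Mi M H B : 'M[R]_n) : Mi *m M *m Mi = 1%:M -> B *m B = H ->
   g%:M - g^-1 *: (Mi *m B *m (B *m Mi)) = Mi *m (g *: M - g^-1 *: H) *m Mi.
  move=> M1 BH; rewrite mulmxBr mulmxBl -!scalemxAr -!scalemxAl M1 scalemx1 -BH.
  by rewrite !mulmxA.
by congr block_mx; rewrite ?(e _ _ F H1) ?(e _ _ G H2) // ?mulmxN ?mulNmx.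
Qed.

Lemma gamma_hat_mx_sym : gamma_hat_mx^T = gamma_hat_mx.
Proof.
have [Fs _ _] := isqrtmxP Fp; have [Gs _ _] := isqrtmxP Gp.
have [[B1s _] _] := sqrtmxP H1p; have [[B2s _] _] := sqrtmxP H2p.
rewrite /gamma_hat_mx !tr_block_mx !trmx0 !trmx_mul Fs Gs B1s B2s !trmxK.
by rewrite !mulmxA.
Qed.

Lemma Phi_unit : Phi \in unitmx.
Proof.
have [_ Fu _] := isqrtmxP Fp; have [_ Gu _] := isqrtmxP Gp.
by move: Fu Gu; rewrite !unitmxE /Phi det_ublock unitrM => -> ->.
Qed.

Lemma gamma_hat_le g : 0 < g -> psdmx (antistable_mx g) -> lambda_max gamma_hat_mx <= g.
Proof.
move=> g0 Np; have [E1 E2] := gamma_hat_mx_schur g0.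
have Ep : psdmx (g%:M - gamma_hat_mx).
  by rewrite E1; apply/psdmx_schur => //; rewrite E2; apply: psdmx_cong.
rewrite /lambda_max; have [->|] := eqVneq [set a : R | eigenvalue gamma_hat_mx a] set0.
  by rewrite sup0 ltW.
move=> /set0P ne; apply: ge_sup => // a; exact: eigenvalue_le.
Qed.

Lemma gamma_hat_lt g : lambda_max gamma_hat_mx < g -> 0 < g /\ pdmx (antistable_mx g).
Proof.
move=> Eg; have Ep := lambda_max_lt gamma_hat_mx_sym Eg.
have g0 : 0 < g.
  have [kk|kk] := posnP (k1 + k2).
    apply: le_lt_trans Eg; rewrite /lambda_max.
    suff -> : [set a : R | eigenvalue gamma_hat_mx a] = set0 by rewrite sup0.
    rewrite -subset0 => a /= /eigenvalueP [v _] /eqP; apply.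
    apply/rowP => i; have := ltn_ord i; by rewrite [X in (_ < X)%N](_ : _ = 0%N) ?kk.
  pose x := delta_mx (rshift (k1 + k2) (Ordinal kk)) 0 : 'cV[R]_((k1 + k2) + (k1 + k2)).
  have x0 : x != 0.
    apply/eqP => /colP /(_ (rshift (k1 + k2) (Ordinal kk))) /eqP.
    by rewrite !mxE !eqxx oner_eq0.
  have entry (M : 'M[R]_((k1 + k2) + (k1 + k2))) :
      (x^T *m M *m x) 0 0 = M (rshift (k1 + k2) (Ordinal kk)) (rshift (k1 + k2) (Ordinal kk)).
    by rewrite /x trmx_delta -rowE -colE !mxE.
  have E0 : gamma_hat_mx (rshift (k1 + k2) (Ordinal kk)) (rshift (k1 + k2) (Ordinal kk)) = 0.
    by rewrite /gamma_hat_mx block_mxEdr mxE.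
  have subE (M M' : 'M[R]_((k1 + k2) + (k1 + k2))) i j : (M - M') i j = M i j - M' i j.
    by rewrite !mxE.
  by have [_ /(_ _ x0)] := Ep; rewrite entry subE E0 subr0 mxE eqxx mulr1n.
split=> //; have [E1 E2] := gamma_hat_mx_schur g0.
move: Ep; rewrite E1 => /pdmx_schur_ul; rewrite invmx_scalar => H.
apply: (pdmx_cong_unit Phi_unit); rewrite -E2.
move: H; rewrite mul_mx_scalar -scalemxAl; apply.
by rewrite unitmxE det_scalar unitrX // unitfE gt_eqF.
Qed.
End GammaHat.

(** * Transposition, the value at infinity, and infima *)

Section Duality.
Variables (R : realType) (n : nat).
Local Notation C := R[i].
Local Notation toC := (real_complex R).
Local Notation toCmx := (map_mx toC).

Lemma eigenvalue_tr (F : fieldType) m (M : 'M[F]_m) a :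
  eigenvalue M^T a = eigenvalue M a.
Proof.
rewrite /eigenvalue /eigenspace !kermx_eq0 !row_free_unit -[in RHS]unitmx_tr.
by rewrite linearB /= tr_scalar_mx.
Qed.

Lemma tf_tr (A : 'M[R]_n) b c d z : tf A^T c b d z = tf A b c d z.
Proof.
rewrite /tf; congr (_ + _); rewrite -map_trmx.
transitivity (((toCmx b)^T *m invmx (z%:M - (toCmx A)^T) *m toCmx c)^T 0 0).
  by rewrite [RHS]mxE.
by rewrite !trmx_mul trmxK trmx_inv linearB /= tr_scalar_mx trmxK mulmxA.
Qed.

Lemma detectable_tr (A : 'M[R]_n) (c : 'cV[R]_n) : detectable A c^T -> stabilizable A^T c.
Proof.
move=> [K hK]; exists K^T => z.
have -> : A^T + c *m K^T = (A + K *m c^T)^T by rewrite linearD /= trmx_mul trmxK.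
by rewrite -map_trmx eigenvalue_tr; apply: hK.
Qed.

Lemma lmi_filter_control (A : 'M[R]_n) b1 c1 d11 g Y : Y^T = Y ->
  lmi_filter_mx A b1 c1 d11 g Y = lmi_control_mx A^T c1 b1 d11 g Y.
Proof.
move=> Ys; rewrite /lmi_filter_mx /lmi_control_mx /He !trmx_mul Ys trmxK.
by rewrite [Y *m A + _]addrC.
Qed.
End Duality.

Section TransferAtInfinity.
Local Open Scope classical_set_scope.
Local Open Scope ring_scope.
Variables (R : realType) (n : nat) (A : 'M[R]_n) (b c : 'cV[R]_n) (d : R).
Local Notation C := R[i].
Local Notation toC := (real_complex R).
Local Notation toCmx := (map_mx toC).
Local Notation normc := (@Normc.normc R).

Let nrm (x : 'cV[C]_n) : C := \sum_i `|x i 0|.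
Let alpha : C := \sum_i \sum_j `|toCmx A i j|.

Let nrmM x : nrm (toCmx A *m x) <= alpha * nrm x.
Proof.
rewrite /nrm mulr_suml; apply: ler_sum => i _.
rewrite mxE (le_trans (ler_norm_sum _ _ _)) // mulr_suml.
apply: ler_sum => j _; rewrite normrM ler_wpM2l // (bigD1 j) //= lerDl sumr_ge0 //.
Qed.

Let nrm_resolvent s x y : s *: x = toCmx A *m x + y -> (`|s| - alpha) * nrm x <= nrm y.
Proof.
move=> E; rewrite mulrBl lerBlDr.
have -> : `|s| * nrm x = nrm (s *: x).
  by rewrite /nrm mulr_sumr; apply: eq_bigr => i _; rewrite mxE normrM.
rewrite E; apply: (@le_trans _ _ (nrm (toCmx A *m x) + nrm y)); last first.
  by rewrite addrC lerD2l nrmM.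
rewrite /nrm -big_split; apply: ler_sum => i _; rewrite mxE; exact: ler_normD.
Qed.

(** The resolvent is of order [1 / |s|]. *)
Lemma tf_cvg_infty (e : R) : 0 < e -> exists M : R,
  forall s : C, M < normc s -> normc (tf A b c d s - toC d) < e.
Proof.
move=> e0; pose K : C := nrm (toCmx c) * nrm (toCmx b).
have nrm_ge0 x : 0 <= nrm x by rewrite sumr_ge0.
have K0 : 0 <= K by rewrite mulr_ge0.
have al0 : 0 <= alpha by rewrite sumr_ge0 // => i _; rewrite sumr_ge0.
have eC : 0 < toC e by rewrite (ltcR 0).
(* beyond this radius [K / (|s| - alpha) < e] *)
exists (complex.Re (alpha + (K / toC e + 1))) => s.
rewrite -ltcR RRe_real; last by rewrite ger0_real // !addr_ge0 // divr_ge0 // ltW.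
rewrite -[X in _ < X]/(`|s|) => sM.
have sal : 0 < `|s| - alpha.
  rewrite subr_gt0; apply: le_lt_trans sM; rewrite lerDl addr_ge0 //.
  by rewrite divr_ge0 // ltW.
have inj : inj_cols (s%:M - toCmx A).
  move=> x.
  move=> /eqP; rewrite mulmxBl mul_scalar_mx subr_eq0 => /eqP Ex.
  have := @nrm_resolvent s x 0; rewrite addr0 => /(_ Ex).
  have -> : nrm 0 = 0 by rewrite /nrm big1 // => i _; rewrite mxE normr0.
  rewrite pmulr_rle0 // => x0; apply/colP => i; rewrite mxE; apply/eqP.
  rewrite -normr_le0.
  by apply: le_trans x0; rewrite /nrm (bigD1 i) //= lerDl sumr_ge0.
have u : s%:M - toCmx A \in unitmx by exact: inj_cols_unit.
rewrite -ltcR -[X in X < _]/(`|tf A b c d s - toC d|) /tf addrK -mulmxA.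
set x := invmx _ *m _.
have Ex : s *: x = toCmx A *m x + toCmx b.
  have : (s%:M - toCmx A) *m x = toCmx b by rewrite mulmxA mulmxV // mul1mx.
  by rewrite mulmxBl mul_scalar_mx => <-; rewrite addrC subrK.
have bx := nrm_resolvent Ex.
apply: (@le_lt_trans _ _ (nrm (toCmx c) * nrm x)).
  rewrite mxE (le_trans (ler_norm_sum _ _ _)) // {1}/nrm mulr_suml.
  apply: ler_sum => i _; rewrite normrM mxE ler_wpM2l //.
  by rewrite /nrm (bigD1 i) //= lerDl sumr_ge0.
rewrite -(ltr_pM2l sal) mulrCA; apply: (@le_lt_trans _ _ K).
  by rewrite /K ler_wpM2l.
apply: (@lt_le_trans _ _ ((K / toC e + 1) * toC e)).
  by rewrite mulrDl divfK ?gt_eqF // mul1r ltrDl.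
by rewrite ler_pM2r // lerBrDl ltW.
Qed.

Lemma tf_inftyE : tf_infty A b c d = toC d.
Proof.
rewrite /tf_infty; set P := [set v : C | _].
have Pd : P (toC d) by move=> e; exact: tf_cvg_infty.
have : P (xget 0 P) by apply: xgetPex; exists (toC d).
set v := xget 0 P => Pv; apply/eqP; rewrite -subr_eq0; apply/negP => /negP vd.
pose e := normc (v - toC d) / 2.
have e0 : 0 < e.
  by rewrite divr_gt0 // -(ltcR 0) -[X in _ < X]/(`|v - toC d|) normr_gt0.
have [M1 H1] := Pd e e0; have [M2 H2] := Pv e e0.
pose s := toC (`|M1| + `|M2| + 1).
have ns : normc s = `|M1| + `|M2| + 1.
  by rewrite /s /= expr0n addr0 sqrtr_sqr ger0_norm // !addr_ge0.
have s1 : M1 < normc s.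
  by rewrite ns ltr_pwDr // (le_trans (ler_norm _)) // lerDl.
have s2 : M2 < normc s.
  by rewrite ns ltr_pwDr // (le_trans (ler_norm _)) // lerDr.
have := H1 s s1; have := H2 s s2; set t := tf _ _ _ _ _ => h2 h1.
have : normc (v - toC d) < e + e.
  apply: (@le_lt_trans _ _ (normc (t - toC d) + normc (t - v))); last exact: ltrD.
  have -> : v - toC d = (t - toC d) + - (t - v) by rewrite opprB; ring.
  by apply: (le_trans (le_normcD _ _)); rewrite normcN.
by rewrite /e -splitr ltxx.
Qed.
End TransferAtInfinity.

Section Infimum.
Local Open Scope classical_set_scope.
Local Open Scope ring_scope.
Variable R : realType.

Lemma ereal_inf_eq (P : set R) (v : R) :
  (forall g, P g -> v <= g) -> (forall g, v < g -> P g) ->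
  ereal_inf [set g%:E | g in P] = v%:E.
Proof.
move=> lb ub; apply/eqP; rewrite eq_le; apply/andP; split.
  apply/lee_addgt0Pr => e e0; apply: ereal_inf_lbound.
  by exists (v + e) => //; apply: ub; rewrite ltrDl.
by apply: le_ereal_inf_tmp => _ [g Pg <-]; rewrite lee_fin lb.
Qed.

Lemma bigmax_lt_seq (T : eqType) (x0 m : R) (s : seq T) (F : T -> R) :
  (\big[Num.max/x0]_(z <- s) F z < m) <-> (x0 < m /\ forall z, z \in s -> F z < m).
Proof.
elim: s => [|a s IH]; first by rewrite big_nil; split=> [|[]].
rewrite big_cons gt_max; split=> [/andP[am /IH [xm sm]]|[xm sm]].
  by split=> // z; rewrite inE => /orP[/eqP ->|/sm].
rewrite sm ?mem_head //; apply/IH; split=> // z zs.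
by apply: sm; rewrite inE zs orbT.
Qed.
End Infimum.

(** * The optimal value *)

Section Value.
Variables (R : realType) (n : nat) (A : 'M[R]_n).
Variables (b1 b2 c1 c2 : 'cV[R]_n) (d11 d12 d21 : R).
Variable N1 : 'M[R]_(n + 1 + 1, n + 1 + 1 - \rank (lmi_perp_mx b2 d12)).
Variable N2 : 'M[R]_(n + 1 + 1, n + 1 + 1 - \rank (lmi_perp_mx c2 d21)).
Variables (lam omega : seq R[i]) (k1 k2 : nat).
Variables (zs1 : k1.-tuple R[i]) (zs2 : k2.-tuple R[i]).
Variables (Lambda : 'M[R]_k1) (S : 'M[R]_(n, k1)) (f : 'cV[R]_k1).
Variables (Omega : 'M[R]_k2) (T : 'M[R]_(n, k2)) (g : 'cV[R]_k2).
Hypotheses (N1p : is_perp N1) (N2p : is_perp N2).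
Hypotheses (stab : stabilizable A b2) (det : detectable A c2^T).
Hypotheses (off1 : off_axis_zeros_real A b2 c1 d12).
Hypotheses (off2 : off_axis_zeros_real A^T c2 b1 d21).
Hypotheses (imag1 : imaginary_zeros A b2 c1 d12 lam).
Hypotheses (imag2 : imaginary_zeros A^T c2 b1 d21 omega).
Hypothesis not_eig : forall z : R[i], z \in lam ++ omega ->
     ~~ eigenvalue (map_mx (real_complex R) A) z /\
     ~~ eigenvalue (map_mx (real_complex R) A) (conjc z).
Hypotheses (rhp1 : rhp_zeros A b2 c1 d12 zs1) (rhp2 : rhp_zeros A^T c2 b1 d21 zs2).
Hypothesis data1 : rhp_null_data A b2 c1 d12 zs1 Lambda S f.
Hypothesis data2 : rhp_null_data A^T c2 b1 d21 zs2 Omega T g.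

Let h1 := S^T *m b1 + d11 *: f.
Let h2 := T^T *m c1 + d11 *: g.
Let J := T^T *m S.
Let s1 := [seq complex.Re z | z <- zs1].
Let s2 := [seq complex.Re z | z <- zs2].
Local Notation G_zw := (tf A b1 c1 d11).
Local Notation gamma_hat := (lambda_max (Emx b1 c1 d11 Lambda S f Omega T g)).

Let not_eig1 z : z \in lam ->
  ~~ eigenvalue (map_mx (real_complex R) A) z /\
  ~~ eigenvalue (map_mx (real_complex R) A) (conjc z).
Proof. by move=> zl; apply: not_eig; rewrite mem_cat zl. Qed.

Let not_eig2 z : z \in omega ->
  ~~ eigenvalue (map_mx (real_complex R) A^T) z /\
  ~~ eigenvalue (map_mx (real_complex R) A^T) (conjc z).
Proof.
move=> zl; rewrite -map_trmx !eigenvalue_tr; apply: not_eig.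
by rewrite mem_cat zl orbT.
Qed.

Let split1 : char_poly Lambda = \prod_(x <- s1) ('X - x%:P).
Proof. exact: (char_poly_null_data_real imag1 rhp1 data1 off1). Qed.

Let split2 : char_poly Omega = \prod_(x <- s2) ('X - x%:P).
Proof. exact: (char_poly_null_data_real imag2 rhp2 data2 off2). Qed.

Let pos1 x : x \in s1 -> 0 < x. Proof. exact: (Re_zs_pos rhp1). Qed.
Let pos2 x : x \in s2 -> 0 < x. Proof. exact: (Re_zs_pos rhp2). Qed.

Let F_pd : pdmx (gramian Lambda f).
Proof.
apply: (gramian_pd split1 pos1).
exact: (null_data_observable imag1 rhp1 data1 stab).
Qed.

Let G_pd : pdmx (gramian Omega g).
Proof.
apply: (gramian_pd split2 pos2).
exact: (null_data_observable imag2 rhp2 data2 (detectable_tr det)).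
Qed.

Let H1_psd := gramian_psd split1 pos1 h1.
Let H2_psd := gramian_psd split2 pos2 h2.

Let antistable gam := antistable_mx (gramian Lambda f) (gramian Lambda h1)
  (gramian Omega g) (gramian Omega h2) J gam.

Let EmxE : Emx b1 c1 d11 Lambda S f Omega T g =
  gamma_hat_mx (gramian Lambda f) (gramian Lambda h1) (gramian Omega g) (gramian Omega h2) J.
Proof. by []. Qed.

Lemma gramian_defect k (L : 'M[R]_k) s (v h : 'cV[R]_k) gam Z :
  char_poly L = \prod_(x <- s) ('X - x%:P) -> (forall x, x \in s -> 0 < x) ->
  L^T *m (gam *: gramian L v - gam^-1 *: gramian L h - Z)
  + (gam *: gramian L v - gam^-1 *: gramian L h - Z) *m L
  = gam *: (v *m v^T) - gam^-1 *: (h *m h^T) - (L^T *m Z + Z *m L).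
Proof.
move=> sp ps; have lyap := gramian_lyapunov sp ps.
move: (gramian L v) (gramian L h) (lyap v) (lyap h) => Gv Gh <- <-.
rewrite !mulmxBr !mulmxBl -!scalemxAr -!scalemxAl !scalerDr.
move: (L^T *m Gv) (Gv *m L) (L^T *m Gh) (Gh *m L) (L^T *m Z) (Z *m L) => a a' b b' c c'.
by apply/matrixP => i j; rewrite !mxE; ring.
Qed.

(** The compressions [S^T X S] and [T^T Y T] are at most [gam F - H1 / gam] and
    [gam G - H2 / gam]; compressing the coupling constraint by [S] and [T] then makes
    the matrix behind [gamma_hat] semidefinite. *)
Lemma feasible_bound gam X Y : 0 < gam -> lmi_feasible A b1 c1 d11 N1 N2 gam X Y ->
  [/\ gamma_hat <= gam, forall z, z \in lam ++ omega -> Normc.normc (G_zw z) <= gam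
    & d12 = 0 \/ d21 = 0 -> `|d11| <= gam].
Proof.
move=> g0 [[Xs Ys] HX]; rewrite (lmi_filter_control _ _ _ _ _ Ys) => HY HXY.
have [P1 z1 i1] := channel_lower N1p imag1 not_eig1 data1 g0 Xs HX.
have [P2 z2 i2] := channel_lower N2p imag2 not_eig2 data2 g0 Ys HY.
split; last by case.
- rewrite EmxE; apply: gamma_hat_le => //; rewrite -/(antistable gam).
  set Z1 := S^T *m X *m S in P1; set Z2 := T^T *m Y *m T in P2.
  have D1 : psdmx (gam *: gramian Lambda f - gam^-1 *: gramian Lambda h1 - Z1).
    by apply: (lyapunov_psd split1 pos1); rewrite (gramian_defect _ _ _ _ split1 pos1).
  have D2 : psdmx (gam *: gramian Omega g - gam^-1 *: gramian Omega h2 - Z2).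
    by apply: (lyapunov_psd split2 pos2); rewrite (gramian_defect _ _ _ _ split2 pos2).
  pose V : 'M[R]_(n + n, k1 + k2) := block_mx S 0 0 T.
  have -> : antistable gam = V^T *m block_mx X (- 1%:M) (- 1%:M) Y *m V
     + block_mx (gam *: gramian Lambda f - gam^-1 *: gramian Lambda h1 - Z1) 0 0
                (gam *: gramian Omega g - gam^-1 *: gramian Omega h2 - Z2).
    rewrite /V tr_block_mx !trmx0 !mulmx_block !mulmx0 !mul0mx !addr0 !add0r.
    rewrite !mulmxN !mulNmx !mulmx1 add_block_mx !addr0.
    rewrite /antistable /antistable_mx /J trmx_mul trmxK /Z1 /Z2.
    by rewrite [_ + (_ - S^T *m X *m S)]addrC subrK [_ + (_ - T^T *m Y *m T)]addrC subrK.
  apply: psdmxD; first exact: psdmx_cong.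
  exact: psdmx_diag.
- move=> z; rewrite mem_cat => /orP[/z1 //|/z2].
  by rewrite tf_tr.
Qed.

(** Prescribe the compressions to be the extremal values minus [e] times a solution of
    the Lyapunov equation with right-hand side [1]: this slack makes the inequalities
    strict, and [coupling] provides the lower bounds for [X] and [Y]. *)
Lemma bound_feasible gam : gamma_hat < gam ->
  (forall z, z \in lam ++ omega -> Normc.normc (G_zw z) < gam) ->
  (d12 = 0 \/ d21 = 0 -> `|d11| < gam) ->
  exists X Y, lmi_feasible A b1 c1 d11 N1 N2 gam X Y.
Proof.
rewrite EmxE => /(gamma_hat_lt F_pd G_pd H1_psd H2_psd) [g0 Np] Gz Gi.
have [P1 [P1s _] E1] := lyapunov_solve split1 pos1 1%:M.
have [P2 [P2s _] E2] := lyapunov_solve split2 pos2 1%:M.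
have Ps : (block_mx P1 0 0 P2)^T = block_mx P1 0 0 P2.
  by rewrite tr_block_mx P1s P2s !trmx0.
have [e e0] := pdmx_perturb Np Ps.
rewrite /antistable_mx scale_block_mx !scaler0 opp_block_mx add_block_mx !oppr0 !addr0.
set Z1 := (X in block_mx X); set Z2 := (X in block_mx _ _ _ X) => Hp.
have [LX [LY [[LXs LYs] H1 H2 coup]]] := coupling Hp.
have defect k (L : 'M[R]_k) s (v h : 'cV[R]_k) P :
    char_poly L = \prod_(x <- s) ('X - x%:P) -> (forall x, x \in s -> 0 < x) ->
    L^T *m P + P *m L = 1%:M *m 1%:M^T ->
    let Z := gam *: gramian L v - gam^-1 *: gramian L h - e *: P in
    P^T = P -> Z^T = Z /\
    pdmx (gam *: (v *m v^T) - gam^-1 *: (h *m h^T) - (L^T *m Z + Z *m L)).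
  move=> sp ps EP Z Psym; split.
    have [Fs _] := gramian_psd sp ps v; have [Hs _] := gramian_psd sp ps h.
    have sym (M : 'M[R]_k) i j : M^T = M -> M j i = M i j by move=> {2}<-; rewrite mxE.
    apply/matrixP => i j; have := (sym _ i j Fs, sym _ i j Hs, sym _ i j Psym).
    by rewrite /Z; move: (gramian L v) (gramian L h) => M N E; rewrite !mxE !E.
  rewrite -(gramian_defect v h gam Z sp ps).
  have -> : gam *: gramian L v - gam^-1 *: gramian L h - Z = e *: P.
    by rewrite /Z opprB addrC subrK.
  rewrite -scalemxAr -scalemxAl -scalerDr EP trmx1 mulmx1 scalemx1.
  exact: pdmx_scalar.
have [Z1s D1] := defect _ _ _ f h1 _ split1 pos1 E1 P1s.
have [Z2s D2] := defect _ _ _ g h2 _ split2 pos2 E2 P2s.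
have [X [Xs HX XL]] : exists X : 'M[R]_n, [/\ X^T = X,
    psdmx (- (N1^T *m lmi_control_mx A b1 c1 d11 gam X *m N1)) & psdmx (X - LX)].
  apply: (channel_upper (b1 := b1) (d11 := d11) (Z := Z1) N1p imag1 not_eig1 rhp1 data1 g0
    _ _ D1 Z1s LXs H1).
  - by move=> z zl; apply: Gz; rewrite mem_cat zl.
  - by move=> ?; apply: Gi; left.
have [Y [Ys HY YL]] : exists Y : 'M[R]_n, [/\ Y^T = Y,
    psdmx (- (N2^T *m lmi_control_mx A^T c1 b1 d11 gam Y *m N2)) & psdmx (Y - LY)].
  apply: (channel_upper (b1 := c1) (d11 := d11) (Z := Z2) N2p imag2 not_eig2 rhp2 data2 g0
    _ _ D2 Z2s LYs H2).
  - by move=> z zl; rewrite tf_tr; apply: Gz; rewrite mem_cat zl orbT.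
  - by move=> ?; apply: Gi; right.
exists X, Y; split; [by []|exact: HX| |exact: coup XL YL].
by rewrite (lmi_filter_control _ _ _ _ _ Ys).
Qed.

Lemma feasible_level gam X Y : lmi_feasible A b1 c1 d11 N1 N2 gam X Y -> 0 <= gam.
Proof.
by case=> _ HX _ _; exact: lmi_control_level N1p HX.
Qed.

Lemma feasible_mono gam gam' X Y : gam <= gam' ->
  lmi_feasible A b1 c1 d11 N1 N2 gam X Y -> lmi_feasible A b1 c1 d11 N1 N2 gam' X Y.
Proof.
move=> gg [[Xs Ys] HX HY HXY]; split; [by []|exact: lmi_control_mono HX| |exact: HXY].
by move: HY; rewrite !(lmi_filter_control _ _ _ _ _ Ys); apply: lmi_control_mono.
Qed.

Lemma lmi_value_eq v :
  (forall gam, v < gam <->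
    [/\ gamma_hat < gam, forall z, z \in lam ++ omega -> Normc.normc (G_zw z) < gam
      & d12 = 0 \/ d21 = 0 -> `|d11| < gam]) ->
  lmi_value A b1 c1 d11 N1 N2 = v%:E.
Proof.
move=> vP; apply: ereal_inf_eq => gam.
  (* feasibility persists for larger levels, which are positive *)
  move=> [X [Y HXY]]; apply/ler_addgt0Pr => e e0.
  have gam0 := feasible_level HXY.
  have [||hat zw inf] := @feasible_bound (gam + e / 2) X Y.
  - by rewrite ltr_wpDl // divr_gt0.
  - by apply: feasible_mono HXY; rewrite lerDl divr_ge0 // ltW.
  have lt : gam + e / 2 < gam + e by rewrite ltrD2l ltr_pdivrMr // ltr_pMr // ltr1n.
  apply/ltW/vP; split=> [|z /zw zle|/inf ile]; exact: le_lt_trans lt.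
by move=> /vP [hat zw inf]; exact: bound_feasible.
Qed.
End Value.

Theorem theorem1 (R : realType) (n : nat) (A : 'M[R]_n)
    (b1 b2 c1 c2 : 'cV[R]_n) (d11 d12 d21 : R)
    (* the matrices M^perp appearing in the LMI problem *)
    (N1 : 'M[R]_(n + 1 + 1, n + 1 + 1 - \rank (lmi_perp_mx b2 d12)))
    (N2 : 'M[R]_(n + 1 + 1, n + 1 + 1 - \rank (lmi_perp_mx c2 d21)))
    (* zeros on the imaginary axis: lambda_j (of G_zu), omega_j (of G_yw) *)
    (lam omega : seq R[i])
    (* open right half plane zeros and null vectors *)
    (k1 k2 : nat) (zs1 : k1.-tuple R[i]) (zs2 : k2.-tuple R[i])
    (Lambda : 'M[R]_k1) (S : 'M[R]_(n, k1)) (f : 'cV[R]_k1)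
    (Omega : 'M[R]_k2) (T : 'M[R]_(n, k2)) (g : 'cV[R]_k2) :
  is_perp N1 -> is_perp N2 ->
  (* (i) *)
  stabilizable A b2 -> detectable A c2^T ->
  (* (ii) *)
  off_axis_zeros_real A b2 c1 d12 -> off_axis_zeros_real A^T c2 b1 d21 ->
  (* (iii) *)
  imaginary_zeros A b2 c1 d12 lam -> imaginary_zeros A^T c2 b1 d21 omega ->
  (* (iv) *)
  tf_not_identically_zero A b2 c1 d12 -> tf_not_identically_zero A b1 c2 d21 ->
  (* no invariant zero on the imaginary axis is an eigenvalue of A *)
  (forall z : R[i], z \in lam ++ omega ->
     ~~ eigenvalue (map_mx (real_complex R) A) z /\
     ~~ eigenvalue (map_mx (real_complex R) A) (conjc z)) ->
  (* data defining E *)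
  rhp_zeros A b2 c1 d12 zs1 -> rhp_zeros A^T c2 b1 d21 zs2 ->
  rhp_null_data A b2 c1 d12 zs1 Lambda S f ->
  rhp_null_data A^T c2 b1 d21 zs2 Omega T g ->
  let gamma_hat := lambda_max (Emx b1 c1 d11 Lambda S f Omega T g) in
  let G_zw := tf A b1 c1 d11 in
  let bound :=
    \big[Num.max/gamma_hat]_(z <- lam ++ omega) Normc.normc (G_zw z) in
  (d12 != 0 -> d21 != 0 -> lmi_value A b1 c1 d11 N1 N2 = bound%:E) /\
  (d12 = 0 \/ d21 = 0 ->
     lmi_value A b1 c1 d11 N1 N2 =
       (Num.max bound (Normc.normc (tf_infty A b1 c1 d11)))%:E).
Proof.
move=> N1p N2p stab det off1 off2 imag1 imag2 _ _ not_eig rhp1 rhp2 data1 data2.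
move=> gamma_hat G_zw bound.
have value := lmi_value_eq N1p N2p stab det off1 off2 imag1 imag2 not_eig
  rhp1 rhp2 data1 data2.
split=> [d12n d21n|d0]; apply: value => gam.
  split=> [/bigmax_lt_seq [hat zw]|[hat zw _]]; last exact/bigmax_lt_seq.
  by split=> // -[] /eqP; rewrite ?(negPf d12n) ?(negPf d21n).
have -> : Normc.normc (tf_infty A b1 c1 d11) = `|d11|.
  by rewrite tf_inftyE /= expr0n addr0 sqrtr_sqr.
rewrite gt_max; split=> [/andP[/bigmax_lt_seq [hat zw] inf]|[hat zw inf]] //.
by rewrite inf // andbT; apply/bigmax_lt_seq.
Qed.
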